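(* Let $n\ge 3$, $\eta\in\mathbb R$, $\kappa>-1$ and $\Xi\in so(n)$. Consider on $(T^*V_{n,2},\omega_\eta)$ the Hamiltonian system of $$H_\kappa=\tfrac12\langle \mathbf p_1,\mathbf p_1\rangle+\tfrac12\langle \mathbf p_2,\mathbf p_2\rangle-(1+2\kappa)\langle \mathbf p_1,\mathbf e_2\rangle\langle \mathbf p_2,\mathbf e_1\rangle+V_I(\mathbf e_1,\mathbf e_2),$$ with potential $V_I(\mathbf e_1,\mathbf e_2)=\langle \mathbf e_1\wedge\mathbf e_2,\Xi\rangle=-\langle \Xi\mathbf e_1,\mathbf e_2\rangle$. (i) The Hamiltonian equations imply the matrix equation with a spectral parameter $\lambda$ $$\frac{d}{dt}\mathcal L(\lambda)=[\mathcal A(\lambda),\mathcal L(\lambda)],$$ where $$\mathcal L(\lambda)=\lambda\Phi_\eta+\sqrt{-1}\,\big(\mathbf e_1\wedge\mathbf e_2-\lambda^2\Xi\big),\qquad \mathcal A(\lambda)=\Phi_\eta-\sqrt{-1}\,\lambda\,\Xi .$$ (ii) For a generic $\Xi\in so(n)$ the system is Liouville integrable: the Noether integral $\Psi$ and the invariants of $\mathcal L(\lambda)$ form a complete set of $2n-3$ involutive polynomials on $(T^*V_{n,2},\omega_\eta)$.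
   Context: **Stiefel variety and cotangent bundle.** $V_{n,2}=\{(\mathbf e_1,\mathbf e_2)\in\mathbb R^{n}\times\mathbb R^n : \langle \mathbf e_1,\mathbf e_1\rangle=\langle \mathbf e_2,\mathbf e_2\rangle=1,\ \langle \mathbf e_1,\mathbf e_2\rangle=0\}$. Its cotangent bundle is realized as the set of $(\mathbf e_1,\mathbf e_2,\mathbf p_1,\mathbf p_2)\in\mathbb R^{4n}$ with $(\mathbf e_1,\mathbf e_2)\in V_{n,2}$ and $\langle \mathbf e_1,\mathbf p_1\rangle=0$, $\langle \mathbf e_2,\mathbf p_2\rangle=0$, $\langle \mathbf e_1,\mathbf p_2\rangle+\langle \mathbf e_2,\mathbf p_1\rangle=0$; thus $\dim T^*V_{n,2}=4n-6$. **Twisted symplectic form.** $\omega_\eta$ is the restriction to $T^*V_{n,2}$ of $\sum_i \big(dp_1^i\wedge de_1^i+dp_2^i\wedge de_2^i\big)+\eta\sum_i de_1^i\wedge de_2^i$. The sign convention for Hamiltonian vector fields is that in the ambient space $\mathbb R^{4n}$ the equations of $H$ are $\dot{\mathbf e}_i=\partial H/\partial\mathbf p_i$, $\dot{\mathbf p}_1=-\partial H/\partial\mathbf e_1+\eta\,\partial H/\partial\mathbf p_2$, $\dot{\mathbf p}_2=-\partial H/\partial\mathbf e_2-\eta\,\partial H/\partial\mathbf p_1$; on $T^*V_{n,2}$ one takes the Hamiltonian vector field of the restriction of $H$ to the symplectic submanifold $(T^*V_{n,2},\omega_\eta)$. **Notation.** For $x,y\in\mathbb R^n$ (columns), $x\wedge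 y=xy^T-yx^T\in so(n)$; $\langle A,B\rangle=-\frac12\operatorname{tr}(AB)$ on $so(n)$. $\Phi_\eta=\mathbf p_1\wedge \mathbf e_1+\mathbf p_2\wedge \mathbf e_2+\eta\,\mathbf e_1\wedge \mathbf e_2$ and $\Psi=\langle \mathbf e_1,\mathbf p_2\rangle-\langle \mathbf e_2,\mathbf p_1\rangle$ are the momentum mappings of the left $SO(n)$-action and of the right $SO(2)$-action (rotations in $\operatorname{span}\{\mathbf e_1,\mathbf e_2\}$), respectively. **Invariants and completeness.** The invariants of $\mathcal L(\lambda)$ are the coefficients, as polynomials in $\lambda$, of the adjoint-invariant polynomials on $so(n)$ (complexified) evaluated at $\mathcal L(\lambda)$, e.g. of $\operatorname{tr}\mathcal L(\lambda)^{2k}$ (coefficients are considered up to constant factors). A set of functions on the $(4n-6)$-dimensional symplectic manifold is a complete involutive set if its elements pairwise Poisson commute and it contains $2n-3$ functions functionally independent on an open dense set. *)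

(* Defs.v *)
From HB Require Import structures.
From mathcomp Require Import all_boot all_order all_algebra.
From mathcomp Require Import all_classical all_reals all_analysis.
From mathcomp Require Import complex.
(* mpoly is not imported: its notations clash with those of analysis. *)
From mathcomp Require mpoly.

Set Implicit Arguments.
Unset Strict Implicit.
Unset Printing Implicit Defensive.

Import Order.TTheory GRing.Theory Num.Theory.
Import numFieldNormedType.Exports.

Local Open Scope classical_set_scope.
Local Open Scope ring_scope.

Section LinearAlgebra.
Variables (K : fieldType) (n : nat).

Definition dot (u v : 'cV[K]_n) : K := \sum_(i < n) u i 0 * v i 0.

Definition wedge (u v : 'cV[K]_n) : 'M[K]_n := u *m v^T - v *m u^T.

Definition in_so (A : 'M[K]_n) : Prop := A^T = - A.

Definition so_form (A B : 'M[K]_n) : K := - (2%:R^-1 * \tr (A *m B)).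

Definition commutator (A B : 'M[K]_n) : 'M[K]_n := A *m B - B *m A.

Definition mx_eval (p : nat) (P : mpoly.mpoly (n * p) K) (A : 'M[K]_(n, p)) : K :=
  mpoly.meval (fun k => mxvec A 0 k) P.

(* Polynomials on so(n, K) are represented by polynomials in all n * n matrix
   entries, of which only the values at skew-symmetric matrices matter. *)
Definition adjoint_invariant (F : mpoly.mpoly (n * n) K) : Prop :=
  forall g A : 'M[K]_n, g^T *m g = 1%:M -> \det g = 1 -> in_so A ->
    mx_eval F (g *m A *m invmx g) = mx_eval F A.

(* "For generic Xi": on a nonempty Zariski open subset of so(n, K). *)
Definition generically_on_so (Q : 'M[K]_n -> Prop) : Prop :=
  exists P : mpoly.mpoly (n * n) K,
    (exists Xi, in_so Xi /\ mx_eval P Xi != 0) /\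
    (forall Xi, in_so Xi -> mx_eval P Xi != 0 -> Q Xi).

End LinearAlgebra.

Section PhaseSpace.
Variables (R : realType) (n : nat).

(* The four columns of x are the vectors e1, e2, p1, p2. *)
Definition phase := 'M[R]_(n, 4).

Definition e1 (x : phase) : 'cV[R]_n := col 0 x.
Definition e2 (x : phase) : 'cV[R]_n := col 1 x.
Definition p1 (x : phase) : 'cV[R]_n := col 2 x.
Definition p2 (x : phase) : 'cV[R]_n := col 3 x.

Definition stiefel (u v : 'cV[R]_n) : Prop :=
  [/\ dot u u = 1, dot v v = 1 & dot u v = 0].

Definition cotangent_stiefel : set phase :=
  [set x | [/\ stiefel (e1 x) (e2 x),
               dot (e1 x) (p1 x) = 0,
               dot (e2 x) (p2 x) = 0 &
               dot (e1 x) (p2 x) + dot (e2 x) (p1 x) = 0]].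

(* Tangent space of the cotangent bundle at x: the kernel of the differentials
   of its six (independent) defining equations. *)
Definition tangent (x : phase) : set phase :=
  [set v | [/\ dot (e1 x) (e1 v) = 0,
               dot (e2 x) (e2 v) = 0 &
               dot (e1 v) (e2 x) + dot (e1 x) (e2 v) = 0] /\
           [/\ dot (e1 v) (p1 x) + dot (e1 x) (p1 v) = 0,
               dot (e2 v) (p2 x) + dot (e2 x) (p2 v) = 0 &
               dot (e1 v) (p2 x) + dot (e1 x) (p2 v) +
               (dot (e2 v) (p1 x) + dot (e2 x) (p1 v)) = 0]].

(* With (a /\ b)(u, v) = a(u) b(v) - a(v) b(u). *)
Definition twisted_form (eta : R) (u v : phase) : R :=
  (dot (p1 u) (e1 v) - dot (p1 v) (e1 u)) +
  (dot (p2 u) (e2 v) - dot (p2 v) (e2 u)) +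
  eta * (dot (e1 u) (e2 v) - dot (e1 v) (e2 u)).

(* Functions on the cotangent bundle are given by smooth extensions to R^{4n};
   only derivatives along tangent vectors are used below. *)

(* The sign makes the same equation on all of R^{4n} (v unrestricted) read
   e_i' = dH/dp_i, p1' = - dH/de1 + eta dH/dp2, p2' = - dH/de2 - eta dH/dp1. *)
Definition is_ham_vector (eta : R) (f : phase -> R) (x X : phase) : Prop :=
  tangent x X /\
  forall v, tangent x v -> twisted_form eta X v = - 'd f x v.

(* Total function; on the cotangent bundle the twisted form is nondegenerate on
   tangent spaces, so the Hamiltonian vector exists and is unique there. *)
Definition ham_field (eta : R) (f : phase -> R) (x : phase) : phase :=
  xget 0 [set X | is_ham_vector eta f x X].

Definition poisson (eta : R) (f g : phase -> R) (x : phase) : R :=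
  'd f x (ham_field eta g x).

Definition poisson_commute (eta : R) (f g : phase -> R) : Prop :=
  forall x, cotangent_stiefel x -> poisson eta f g x = 0.

Definition independent_at (m : nat) (f : 'I_m -> phase -> R) (x : phase) : Prop :=
  forall c : 'I_m -> R,
    (forall v, tangent x v -> \sum_(k < m) c k * 'd (f k) x v = 0) ->
    forall k, c k = 0.

Definition independent_on_open_dense (m : nat) (f : 'I_m -> phase -> R) : Prop :=
  exists U : set phase,
    [/\ open U,
        cotangent_stiefel `<=` closure (cotangent_stiefel `&` U) &
        forall x, cotangent_stiefel x -> U x -> independent_at f x].

(* dim = 4n - 6: half of it is 2n - 3. *)
Definition complete_involutive (eta : R) (S : set (phase -> R)) : Prop :=
  (forall f g, S f -> S g -> poisson_commute eta f g) /\
  (exists f : 'I_(2 * n - 3) -> phase -> R,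
     (forall k, S (f k)) /\ independent_on_open_dense f).

Definition polynomial_fun (f : phase -> R) : Prop :=
  exists P : mpoly.mpoly (n * 4) R, forall x, f x = mx_eval P x.

Definition integral_curve (eta : R) (H : phase -> R) (I : set R)
    (gamma : R -> phase) : Prop :=
  forall t, I t -> cotangent_stiefel (gamma t) /\
    is_derive t 1 gamma (ham_field eta H (gamma t)).

Definition Phi (eta : R) (x : phase) : 'M[R]_n :=
  wedge (p1 x) (e1 x) + wedge (p2 x) (e2 x) + eta *: wedge (e1 x) (e2 x).

Definition Psi (x : phase) : R := dot (e1 x) (p2 x) - dot (e2 x) (p1 x).

Definition V_I (Xi : 'M[R]_n) (x : phase) : R :=
  so_form (wedge (e1 x) (e2 x)) Xi.

Definition Hamiltonian (kappa : R) (Xi : 'M[R]_n) (x : phase) : R :=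
  2%:R^-1 * dot (p1 x) (p1 x) + 2%:R^-1 * dot (p2 x) (p2 x)
  - (1 + 2%:R * kappa) * (dot (p1 x) (e2 x) * dot (p2 x) (e1 x))
  + V_I Xi x.

Definition complexify (A : 'M[R]_n) : 'M[R[i]]_n := map_mx (real_complex R) A.

Definition lax_L (eta : R) (Xi : 'M[R]_n) (lambda : R[i]) (x : phase)
    : 'M[R[i]]_n :=
  lambda *: complexify (Phi eta x) +
  ('i)%C *: (complexify (wedge (e1 x) (e2 x)) - lambda ^+ 2 *: complexify Xi).

Definition lax_A (eta : R) (Xi : 'M[R]_n) (lambda : R[i]) (x : phase)
    : 'M[R[i]]_n :=
  complexify (Phi eta x) - (('i)%C * lambda) *: complexify Xi.

(* D is the derivative at t of the complex matrix valued curve G. *)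
Definition is_derive_cmx (t : R) (G : R -> 'M[R[i]]_n) (D : 'M[R[i]]_n) : Prop :=
  is_derive t 1 (fun s => map_mx (@complex.Re R) (G s)) (map_mx (@complex.Re R) D) /\
  is_derive t 1 (fun s => map_mx (@complex.Im R) (G s)) (map_mx (@complex.Im R) D).

(* f is, up to a nonzero constant, the coefficient of lambda ^ j in F(L(lambda)),
   where F is an adjoint-invariant polynomial on so(n, C). The polynomial q is
   determined by its values, R[i] being infinite.
   Considering only real valued f loses nothing: since the complex conjugate of
   L(lambda) is - L(- conj lambda), the conjugate of a coefficient is, up to
   sign, the same coefficient for another F, hence so are its real and imaginary
   parts. *)
Definition lax_invariant (eta : R) (Xi : 'M[R]_n) (f : phase -> R) : Prop :=
  exists (F : mpoly.mpoly (n * n) R[i]) (j : nat) (c : R[i]),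
    [/\ adjoint_invariant F, c != 0 &
        forall x, exists q : {poly R[i]},
          (forall lambda, q.[lambda] = mx_eval F (lax_L eta Xi lambda x)) /\
          real_complex R (f x) = c * q`_j].

Definition lax_integrals (eta : R) (Xi : 'M[R]_n) : set (phase -> R) :=
  [set Psi] `|` [set f | lax_invariant eta Xi f].

End PhaseSpace.

(* Main.v *)
Require Import Defs.
From HB Require Import structures.
From mathcomp Require Import all_boot all_order all_algebra.
From mathcomp Require Import all_classical all_reals all_analysis.
From mathcomp Require Import complex.
From mathcomp Require Import -(notations) mpoly.
From mathcomp Require Import ring lra zify.

Set Implicit Arguments.
Unset Strict Implicit.
Unset Printing Implicit Defensive.

Import Order.TTheory GRing.Theory Num.Theory.
Import numFieldNormedType.Exports.

Local Open Scope classical_set_scope.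
Local Open Scope ring_scope.

(* At a point of the cotangent bundle the differential of any function of
   (Phi, E), with E = e1 /\ e2, is tested on two families of tangent vectors:
   infinitesimal rotations and vertical shifts. These turn the Poisson bracket
   into the Lie-Poisson bracket of the semidirect product so(n) + so(n), for which
   {Phi, Phi} = Phi, {Phi, E} = E, {E, E} = 0. Let Z and W be the gradients of two
   invariants at L(l) and L(u), l <> u. The bracket pairs [Z, W] with a
   combination of L(l) and L(u), and [Z, L(l)] = [W, L(u)] = 0; interpolation in
   the spectral parameter passes from values to coefficients.

   For completeness take the traces of the powers of Xi + s Phi + s^2 E, which is
   proportional to L(i / s), and their coefficients of s, ..., s^4. That their
   differentials are independent means that a Gram determinant, polynomial in Xi,
   Phi and E, does not vanish. If it is nonzero at one ambient point then it is
   nonzero on a dense open set: it is a polynomial along the affine segment from a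
   given point of the cotangent bundle to the good one, and the Gram-Schmidt
   process brings the segment back to the cotangent bundle, acting on (Phi, E) by
   the weighted dilation (c Phi, c^2 E), to which independence is insensitive. At
   a point with Phi = 0 and Xi block diagonal the odd and even coefficients
   decouple, and independence becomes a statement on polynomials in one variable
   vanishing at the squares of the frequencies. *)

(** * Polynomial functions and their differentials *)

(** The combination u^2 L(l) - l^2 L(u) is free of Xi and divisible by u - l. Hence l and u must
    differ, and two invariants are interpolated at disjoint sets of nodes. On the cotangent bundle
    the product in H equals - Psi^2 / 4, so kappa only adds to the flow a multiple of the right
    rotation, which moves neither Phi nor E; this is why kappa is absent from the Lax pair. The
    count: m = [n/2] and M = [(n-1)/2] satisfy m + M = n - 1, and the coefficients of s, s^2, s^3,
    s^4 supply m, m, M and M - 1 functions. The one left out for s^4 is tr E^2, constant on the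
    bundle. Psi is already present: on the bundle the coefficient of s^3 in the trace of the square
    is -4 (Psi + eta). At the special point the obstacle is that E has rank two: commutators with E
    test a skew matrix N only through [N, E] and leave open a multiple of E on the frame. The
    vertical direction along E settles this for the odd coefficients, the omission of tr E^2 for the
    even ones. *)

Section FunctionAlgebra.
Variables (T : Type) (K : comNzRingType) (A : (T -> K) -> Prop).

(** Instances are the polynomial functions, real or complex valued, the functions continuous at a
    point and the functions polynomial in one real parameter; determinants, powers and traces are
    thus treated once for all of them. *)
Definition fun_alg : Prop :=
  [/\ forall c, A (fun=> c),
      forall f g, A f -> A g -> A (fun x => f x + g x) &
      forall f g, A f -> A g -> A (fun x => f x * g x)].

Hypothesis algA : fun_alg.

Lemma fun_alg_cst c : A (fun=> c). Proof. by case: algA. Qed.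

Lemma fun_algD f g : A f -> A g -> A (fun x => f x + g x).
Proof. by case: algA => _ + _; exact. Qed.

Lemma fun_algM f g : A f -> A g -> A (fun x => f x * g x).
Proof. by case: algA => _ _; exact. Qed.

Lemma fun_alg_ext f g : f =1 g -> A f -> A g.
Proof. by move=> /funext ->. Qed.

Lemma fun_algN f : A f -> A (fun x => - f x).
Proof.
move=> Af; apply: (@fun_alg_ext (fun x => -1 * f x)) => [x|].
  by rewrite mulN1r.
exact: fun_algM (fun_alg_cst _) Af.
Qed.

Lemma fun_algB f g : A f -> A g -> A (fun x => f x - g x).
Proof. by move=> Af Ag; apply: fun_algD => //; exact: fun_algN. Qed.

Lemma fun_alg_sum (I : Type) (r : seq I) (P : pred I) (F : I -> T -> K) :
  (forall i, P i -> A (F i)) -> A (fun x => \sum_(i <- r | P i) F i x).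
Proof.
move=> AF; elim: r => [|i r IHr].
  by apply: fun_alg_ext (fun_alg_cst 0) => x; rewrite big_nil.
case: (boolP (P i)) => Pi; last first.
  by apply: fun_alg_ext IHr => x; rewrite big_cons (negbTE Pi).
by apply: fun_alg_ext (fun_algD (AF _ Pi) IHr) => x; rewrite big_cons Pi.
Qed.

Lemma fun_alg_prod (I : Type) (r : seq I) (P : pred I) (F : I -> T -> K) :
  (forall i, P i -> A (F i)) -> A (fun x => \prod_(i <- r | P i) F i x).
Proof.
move=> AF; elim: r => [|i r IHr].
  by apply: fun_alg_ext (fun_alg_cst 1) => x; rewrite big_nil.
case: (boolP (P i)) => Pi; last first.
  by apply: fun_alg_ext IHr => x; rewrite big_cons (negbTE Pi).
by apply: fun_alg_ext (fun_algM (AF _ Pi) IHr) => x; rewrite big_cons Pi.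
Qed.

Lemma fun_alg_mulmx m n p (B : T -> 'M[K]_(m, n)) (C : T -> 'M[K]_(n, p)) :
  (forall i j, A (fun x => B x i j)) -> (forall i j, A (fun x => C x i j)) ->
  forall i j, A (fun x => (B x *m C x) i j).
Proof.
move=> AB AC i j; pose S x := \sum_k B x i k * C x k j.
apply: (@fun_alg_ext S) => [x|]; first by rewrite mxE.
by apply: fun_alg_sum => k _; exact: fun_algM.
Qed.

Lemma fun_alg_det n (B : T -> 'M[K]_n) :
  (forall i j, A (fun x => B x i j)) -> A (fun x => \det (B x)).
Proof.
move=> AB; rewrite /determinant; apply: fun_alg_sum => s _.
by apply: fun_algM; [exact: fun_alg_cst|apply: fun_alg_prod => i _; exact: AB].
Qed.

Lemma fun_alg_coefM (p q : T -> {poly K}) :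
  (forall j, A (fun x => (p x)`_j)) -> (forall j, A (fun x => (q x)`_j)) ->
  forall j, A (fun x => (p x * q x)`_j).
Proof.
move=> Ap Aq j; pose S x := \sum_(i < j.+1) (p x)`_i * (q x)`_(j - i).
apply: (@fun_alg_ext S) => [x|]; first by rewrite coefM.
by apply: fun_alg_sum => k _; exact: fun_algM.
Qed.

Lemma fun_alg_coef_mulmx m n p (B : T -> 'M[{poly K}]_(m, n))
    (C : T -> 'M[{poly K}]_(n, p)) :
  (forall i j d, A (fun x => (B x i j)`_d)) ->
  (forall i j d, A (fun x => (C x i j)`_d)) ->
  forall i j d, A (fun x => ((B x *m C x) i j)`_d).
Proof.
move=> AB AC i j d; pose S x := \sum_k (B x i k * C x k j)`_d.
apply: (@fun_alg_ext S) => [x|]; first by rewrite mxE coef_sum.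
by apply: fun_alg_sum => k _; exact: fun_alg_coefM.
Qed.

Lemma fun_alg_coef_exp n (B : T -> 'M[{poly K}]_n) (N : nat) :
  (forall i j d, A (fun x => (B x i j)`_d)) ->
  forall i j d, A (fun x => ((B x ^+ N) i j)`_d).
Proof.
move=> AB; elim: N => [|N IHN] i j d.
  apply: fun_alg_ext (fun_alg_cst ((1%:M : 'M[{poly K}]_n) i j)`_d) => x.
  by rewrite expr0.
apply: (@fun_alg_ext (fun x => ((B x *m (B x ^+ N)) i j)`_d)) => [x|].
  by rewrite exprS.
exact: fun_alg_coef_mulmx.
Qed.

Lemma fun_alg_coef_tr n (B : T -> 'M[{poly K}]_n) :
  (forall i j d, A (fun x => (B x i j)`_d)) ->
  forall d, A (fun x => (\tr (B x))`_d).
Proof.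
move=> AB d; apply: (@fun_alg_ext (fun x => \sum_i (B x i i)`_d)) => [x|].
  by rewrite /mxtrace coef_sum.
exact: fun_alg_sum.
Qed.

End FunctionAlgebra.

(** Induction along ring operations instead of monomials, the shape shared by [fun_alg] and the
    rules for [jet]. *)
Lemma mpoly_ring_ind (K : comNzRingType) N (P : mpoly.mpoly N K -> Prop) :
  (forall c, P (mpoly.mpolyC N c)) ->
  (forall i, P (mpoly.mpolyX K (mpoly.mnm1 i))) ->
  (forall p q, P p -> P q -> P (p + q)) ->
  (forall p q, P p -> P q -> P (p * q)) -> forall p, P p.
Proof.
move=> PC PX PD PM; elim/mpoly.mpolyind => [|c m p _ _ Pp].
  by rewrite -mpoly.mpolyC0; exact: PC.
apply: (PD) => //; rewrite -mpoly.mul_mpolyC; apply: (PM) => //.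
rewrite mpoly.mpolyXE_id; elim/big_ind: _ => [||i _].
- by rewrite -mpoly.mpolyC1; exact: PC.
- exact: PM.
elim: (m i) => [|k IHk]; first by rewrite expr0 -mpoly.mpolyC1; exact: PC.
by rewrite exprS; exact: PM.
Qed.

Lemma mnmBB N (m : multinom N) : mnm_sub m m = mnm0.
Proof. by apply/mnmP => i; rewrite mnmBE subnn mnm0E. Qed.

Lemma fun_alg_meval T (K : comNzRingType) (A : (T -> K) -> Prop) N
    (g : T -> 'I_N -> K) (P : mpoly N K) :
  fun_alg A -> (forall i, A (fun x => g x i)) -> A (fun x => meval (g x) P).
Proof.
move=> algA Ag; elim/mpoly_ring_ind: P => [c|i|p q Ap Aq|p q Ap Aq].
- by apply: (fun_alg_ext _ (fun_alg_cst algA c)) => x; rewrite mevalC.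
- by apply: (fun_alg_ext _ (Ag i)) => x; rewrite mevalXU.
- by apply: (fun_alg_ext _ (fun_algD algA Ap Aq)) => x; rewrite mevalD.
- by apply: (fun_alg_ext _ (fun_algM algA Ap Aq)) => x; rewrite mevalM.
Qed.

Section PolynomialFunctions.
Variables (K : fieldType) (n p : nat).

Definition polyfun (f : 'M[K]_(n, p) -> K) : Prop :=
  exists P : mpoly (n * p) K, forall x, f x = mx_eval P x.

Lemma polyfun_alg : fun_alg polyfun.
Proof.
split=> [c|f g [P fP] [Q gQ]|f g [P fP] [Q gQ]].
- by exists (mpolyC _ c) => x; rewrite /mx_eval mevalC.
- by exists (P + Q) => x; rewrite fP gQ /mx_eval mevalD.
- by exists (P * Q) => x; rewrite fP gQ /mx_eval mevalM.
Qed.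

Lemma polyfun_coord i j : polyfun (fun x => x i j).
Proof.
by exists (mpolyX K (mnm1 (mxvec_index i j))) => x; rewrite /mx_eval mevalXU mxvecE.
Qed.

End PolynomialFunctions.

(** * Differentials in a fixed direction *)

Section Jets.
Variables (R : realType) (V : normedModType R).

(** Differentiability travels with the value, since the sum and product rules need both; fixing the
    direction turns them into rules for scalars. *)
Definition jet (f : V -> R) (x v : V) (d : R) : Prop :=
  differentiable f x /\ 'd f x v = d.

Lemma jet_ext f g x v d : f =1 g -> jet f x v d -> jet g x v d.
Proof. by move=> /funext ->. Qed.

Lemma jet_eq f x v d d' : d = d' -> jet f x v d -> jet f x v d'.
Proof. by move=> ->. Qed.

Lemma jet_unique f x v d d' : jet f x v d -> jet f x v d' -> d = d'.
Proof. by move=> [_ <-] [_ <-]. Qed.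

Lemma jet_cst c x v : jet (fun=> c) x v 0.
Proof. by split; [exact: differentiable_cst|rewrite diff_cst]. Qed.

Lemma jetD f g x v a b :
  jet f x v a -> jet g x v b -> jet (fun y => f y + g y) x v (a + b).
Proof.
move=> [df <-] [dg <-]; split; first exact: differentiableD.
by rewrite (_ : (fun _ => _) = f \+ g)// diffD.
Qed.

Lemma jetM f g x v a b : jet f x v a -> jet g x v b ->
  jet (fun y => f y * g y) x v (a * g x + f x * b).
Proof.
move=> [df <-] [dg <-]; split; first exact: differentiableM.
have -> : 'd (fun y => f y * g y) x = f x \*: 'd g x + g x \*: 'd f x :> (V -> R).
  exact: diffM.
by rewrite addrC mulrC.
Qed.

Lemma jetN f x v a : jet f x v a -> jet (fun y => - f y) x v (- a).
Proof.
move=> [df <-]; split; first exact: differentiableN.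
by rewrite (_ : (fun _ => _) = - f)// diffN.
Qed.

Lemma jetB f g x v a b :
  jet f x v a -> jet g x v b -> jet (fun y => f y - g y) x v (a - b).
Proof. by move=> jf jg; apply: jetD => //; exact: jetN. Qed.

Lemma jetZ c f x v a : jet f x v a -> jet (fun y => c * f y) x v (c * a).
Proof.
by move=> jf; apply: jet_eq (jetM (jet_cst c x v) jf); rewrite mul0r add0r.
Qed.

Lemma jet_sum (I : Type) (r : seq I) (P : pred I) (F : I -> V -> R) d x v :
  (forall i, P i -> jet (F i) x v (d i)) ->
  jet (fun y => \sum_(i <- r | P i) F i y) x v (\sum_(i <- r | P i) d i).
Proof.
move=> jF; elim: r => [|i r IHr].
  by rewrite big_nil; apply: jet_ext (jet_cst 0 x v) => y; rewrite big_nil.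
rewrite big_cons; case: ifPn => Pi; last first.
  by apply: jet_ext IHr => y; rewrite big_cons (negbTE Pi).
by apply: jet_ext (jetD (jF _ Pi) IHr) => y; rewrite big_cons Pi.
Qed.

(** Phase space is real, so complex values are differentiated through their real and imaginary
    parts. *)
Definition jetC (f : V -> R[i]) (x v : V) (d : R[i]) : Prop :=
  jet (fun y => complex.Re (f y)) x v (complex.Re d) /\
  jet (fun y => complex.Im (f y)) x v (complex.Im d).

Lemma jetC_ext f g x v d : f =1 g -> jetC f x v d -> jetC g x v d.
Proof. by move=> /funext ->. Qed.

Lemma jetC_eq f x v d d' : d = d' -> jetC f x v d -> jetC f x v d'.
Proof. by move=> ->. Qed.

Lemma jetC_unique f x v d d' : jetC f x v d -> jetC f x v d' -> d = d'.
Proof.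
move=> [r1 i1] [r2 i2]; rewrite [d]complexE [d']complexE.
by rewrite (jet_unique r1 r2) (jet_unique i1 i2).
Qed.

Lemma jetC_real f x v d : jet f x v d <->
  jetC (fun y => real_complex R (f y)) x v (real_complex R d).
Proof. by split=> [jf|[]//]; split=> //=; exact: jet_cst. Qed.

Lemma jetC_cst c x v : jetC (fun=> c) x v 0.
Proof. by split; exact: jet_cst. Qed.

Lemma jetCD f g x v a b :
  jetC f x v a -> jetC g x v b -> jetC (fun y => f y + g y) x v (a + b).
Proof.
move=> [fr fi] [gr gi]; split; rewrite raddfD.
  by apply: jet_ext (jetD fr gr) => y; rewrite raddfD.
by apply: jet_ext (jetD fi gi) => y; rewrite raddfD.
Qed.

Lemma jetCM f g x v a b : jetC f x v a -> jetC g x v b ->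
  jetC (fun y => f y * g y) x v (a * g x + f x * b).
Proof.
move=> [fr fi] [gr gi]; split.
  apply: jet_ext (jet_eq _ (jetB (jetM fr gr) (jetM fi gi))) => [y|].
    by case: (f y) (g y) => ? ? [].
  by case: (f x) (g x) a b {fr fi gr gi} => ? ? [? ?] [? ?] [? ?] /=; ring.
apply: jet_ext (jet_eq _ (jetD (jetM fr gi) (jetM fi gr))) => [y|].
  by case: (f y) (g y) => ? ? [].
by case: (f x) (g x) a b {fr fi gr gi} => ? ? [? ?] [? ?] [? ?] /=; ring.
Qed.

Lemma jetCZ c f x v a : jetC f x v a -> jetC (fun y => c * f y) x v (c * a).
Proof.
by move=> jf; apply: jetC_eq (jetCM (jetC_cst c x v) jf); rewrite mul0r add0r.
Qed.

Lemma jetC_sum (I : Type) (r : seq I) (P : pred I) (F : I -> V -> R[i]) d x v :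
  (forall i, P i -> jetC (F i) x v (d i)) ->
  jetC (fun y => \sum_(i <- r | P i) F i y) x v (\sum_(i <- r | P i) d i).
Proof.
move=> jF; elim: r => [|i r IHr].
  by rewrite big_nil; apply: jetC_ext (jetC_cst 0 x v) => y; rewrite big_nil.
rewrite big_cons; case: ifPn => Pi; last first.
  by apply: jetC_ext IHr => y; rewrite big_cons (negbTE Pi).
by apply: jetC_ext (jetCD (jF _ Pi) IHr) => y; rewrite big_cons Pi.
Qed.

Lemma jetC_meval N (g : V -> 'I_N -> R[i]) (d : 'I_N -> R[i])
    (P : mpoly N R[i]) x v : (forall i, jetC (fun y => g y i) x v (d i)) ->
  jetC (fun y => meval (g y) P) x v (\sum_i meval (g x) (mderiv i P) * d i).
Proof.
move=> jg; elim/mpoly_ring_ind: P => [c|i|p q jp jq|p q jp jq].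
- apply: jetC_ext (jetC_eq _ (jetC_cst c x v)) => [y|]; first by rewrite mevalC.
  by rewrite big1// => i _; rewrite mderivC meval0 mul0r.
- apply: jetC_ext (jetC_eq _ (jg i)) => [y|]; first by rewrite mevalXU.
  rewrite (bigD1 i)//= mderivX mnm1E eqxx scale1r mnmBB mpolyX0 meval1 mul1r.
  rewrite big1 ?addr0// => j ji.
  by rewrite mderivX mnm1E eq_sym (negbTE ji) scale0r meval0 mul0r.
- apply: jetC_ext (jetC_eq _ (jetCD jp jq)) => [y|]; first by rewrite mevalD.
  by rewrite -big_split; apply: eq_bigr => i _; rewrite mderivD mevalD mulrDl.
- apply: jetC_ext (jetC_eq _ (jetCM jp jq)) => [y|]; first by rewrite mevalM.
  rewrite mulr_suml mulr_sumr -big_split; apply: eq_bigr => i _.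
  by rewrite /= mderivM mevalD !mevalM mulrDl mulrAC mulrA.
Qed.

End Jets.

Section CoordinateJets.
Variable R : realType.

Lemma jet_coord n p (x v : 'M[R]_(n, p)) i j :
  jet (fun y : 'M[R]_(n, p) => y i j) x v (v i j).
Proof.
split; first exact: differentiable_coord.
have @f : {linear 'M[R]_(n, p) -> R}.
  by exists (fun N : 'M[R]_(_, _) => N i j); do 2![eexists]; do ?[constructor];
     rewrite ?mxE// => ? *; rewrite ?mxE//; move=> ?; rewrite !mxE.
rewrite (_ : (fun _ => _) = f)// diff_lin//; exact: coord_continuous.
Qed.

Lemma jet_id (x v : R) : jet (fun y : R => y) x v v.
Proof. by have [d e] := is_diff_id x; split=> //; rewrite e. Qed.

End CoordinateJets.

Section ComplexPolynomialFunctions.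
Variables (R : realType) (n p : nat).

Definition polyfunC (f : 'M[R]_(n, p) -> R[i]) : Prop :=
  polyfun (fun x => complex.Re (f x)) /\ polyfun (fun x => complex.Im (f x)).

Lemma polyfunC_alg : fun_alg polyfunC.
Proof.
have alg := @polyfun_alg R n p.
split=> [c|f g [fr fi] [gr gi]|f g [fr fi] [gr gi]].
- by split; exact: (fun_alg_cst alg).
- split; [apply: (fun_alg_ext _ (fun_algD alg fr gr)) => x
         |apply: (fun_alg_ext _ (fun_algD alg fi gi)) => x];
  by case: (f x) (g x) => ? ? [].
- split.
    have := fun_algB alg (fun_algM alg fr gr) (fun_algM alg fi gi).
    by apply: fun_alg_ext => x; case: (f x) (g x) => ? ? [].
  have := fun_algD alg (fun_algM alg fr gi) (fun_algM alg fi gr).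
  by apply: fun_alg_ext => x; case: (f x) (g x) => ? ? [].
Qed.

Lemma polyfunC_real f : polyfun f <-> polyfunC (fun x => real_complex R (f x)).
Proof.
split=> [fP|[]//]; split=> //=; exact: (fun_alg_cst (@polyfun_alg R n p)).
Qed.

End ComplexPolynomialFunctions.

Section MatrixJets.
Variables (R : realType) (V : normedModType R) (x v : V).

Definition jet_mx m n (G : V -> 'M[R[i]]_(m, n)) (D : 'M[R[i]]_(m, n)) : Prop :=
  forall i j, jetC (fun y => G y i j) x v (D i j).

Lemma jet_mx_ext m n (G H : V -> 'M[R[i]]_(m, n)) D :
  G =1 H -> jet_mx G D -> jet_mx H D.
Proof. by move=> /funext ->. Qed.

Lemma jet_mx_eq m n (G : V -> 'M[R[i]]_(m, n)) D D' :
  D = D' -> jet_mx G D -> jet_mx G D'.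
Proof. by move=> ->. Qed.

Lemma jet_mx_cst m n (A : 'M[R[i]]_(m, n)) : jet_mx (fun=> A) 0.
Proof. by move=> i j; rewrite mxE; exact: jetC_cst. Qed.

Lemma jet_mxD m n (G H : V -> 'M[R[i]]_(m, n)) D D' :
  jet_mx G D -> jet_mx H D' -> jet_mx (fun y => G y + H y) (D + D').
Proof.
move=> jG jH i j; rewrite mxE.
by apply: jetC_ext (jetCD (jG i j) (jH i j)) => y; rewrite mxE.
Qed.

Lemma jet_mxZ m n c (G : V -> 'M[R[i]]_(m, n)) D :
  jet_mx G D -> jet_mx (fun y => c *: G y) (c *: D).
Proof.
move=> jG i j; rewrite mxE.
by apply: jetC_ext (jetCZ c (jG i j)) => y; rewrite mxE.
Qed.

Lemma jet_mxZl m n (f : V -> R[i]) (A : 'M[R[i]]_(m, n)) d :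
  jetC f x v d -> jet_mx (fun y => f y *: A) (d *: A).
Proof.
move=> jf i j; rewrite mxE; apply: jetC_ext (jetC_eq _ (jetCM jf (jetC_cst (A i j) x v))).
  by move=> y; rewrite mxE.
by rewrite mulr0 addr0.
Qed.

Lemma jet_mulmx m n p (G : V -> 'M[R[i]]_(m, n)) (H : V -> 'M[R[i]]_(n, p)) D D' :
  jet_mx G D -> jet_mx H D' ->
  jet_mx (fun y => G y *m H y) (D *m H x + G x *m D').
Proof.
move=> jG jH i j; rewrite !mxE -big_split/=.
apply: jetC_ext; last first.
  by apply: jetC_sum => k _; exact: jetCM (jG i k) (jH k j).
by move=> y; rewrite mxE.
Qed.

End MatrixJets.

(** * Gradients of invariant polynomials *)

Section Gradient.
Variables (R : realType) (n : nat) (F : mpoly (n * n) R[i]).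

Definition grad_mx (A : 'M[R[i]]_n) : 'M[R[i]]_n :=
  \matrix_(i, j) meval (fun k => mxvec A 0 k) (mderiv (mxvec_index i j) F).

Lemma jet_mx_eval (V : normedModType R) (x v : V) G D : jet_mx x v G D ->
  jetC (fun y => mx_eval F (G y)) x v (\tr ((grad_mx (G x))^T *m D)).
Proof.
move=> jG.
have jv k : jetC (fun y => mxvec (G y) 0 k) x v (mxvec D 0 k).
  case/mxvec_indexP: k => i j; rewrite mxvecE.
  by apply: jetC_ext (jG i j) => y; rewrite mxvecE.
apply: jetC_eq (jetC_meval F jv).
rewrite (reindex _ (curry_mxvec_bij _ _)) /=.
pose f i j := meval (fun k => mxvec (G x) 0 k) (mderiv (mxvec_index i j) F) *
  mxvec D 0 (mxvec_index i j).
rewrite (eq_bigr (fun p => f p.1 p.2)); last by case.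
rewrite -(pair_bigA _ f) exchange_big.
apply: eq_bigr => i _; rewrite mxE; apply: eq_bigr => j _.
by rewrite /f mxvecE !mxE.
Qed.

End Gradient.

(* Invariance under SO(n, C) is differentiated along x /\ y with x isotropic: then
   (x /\ y)^3 = 0, the one-parameter group is polynomial in its parameter, and for
   n >= 3 such elements span so(n, C). *)
Section Unipotent.
Variables (R : realType) (n : nat).
Notation C := R[i].

(** Each term of the middle factor starts with x or ends with x^T, and the outer factors kill x on
    the right and x^T on the left. *)
Lemma wedge_nilp (x y : 'cV[C]_n) : x^T *m x = 0 -> x^T *m y = 0 ->
  wedge x y *m wedge x y *m wedge x y = 0.
Proof.
move=> xx xy; have yx : y^T *m x = 0 by rewrite -(trmxK x) -trmx_mul xy trmx0.
have wx : wedge x y *m x = 0.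
  by rewrite /wedge mulmxBl -!mulmxA xx yx !mulmx0 subrr.
have xw : x^T *m wedge x y = 0.
  by rewrite /wedge mulmxBr !mulmxA xx xy !mul0mx subrr.
suff gen (A B : 'M[C]_n) : A *m x = 0 -> x^T *m B = 0 -> A *m wedge x y *m B = 0.
  exact: gen.
move=> Ax xB; rewrite /wedge mulmxBr mulmxBl !mulmxA Ax.
by rewrite !mul0mx -(mulmxA (A *m y)) xB mulmx0 subrr.
Qed.

Lemma wedge_so (K : fieldType) (x y : 'cV[K]_n) : in_so (wedge x y).
Proof. by rewrite /in_so /wedge linearB/= !trmx_mul !trmxK opprB. Qed.

Variable xi : 'M[C]_n.
Hypothesis xi_so : in_so xi.
Hypothesis xi_nilp : xi *m xi *m xi = 0.

(** The exponential of [t *: xi], whose series stops by [xi_nilp]. *)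
Definition unip (t : C) : 'M[C]_n := 1%:M + t *: xi + (t ^+ 2 / 2) *: (xi *m xi).

Lemma unipD s t : unip s *m unip t = unip (s + t).
Proof.
have xi_nilp' : xi *m (xi *m xi) = 0 by rewrite mulmxA.
rewrite /unip !mulmxDl !mulmxDr !mul1mx !mulmx1 -!scalemxAl -!scalemxAr.
rewrite !mulmxA xi_nilp !mul0mx !scaler0 !addr0.
by apply/matrixP => i j; rewrite !mxE; field.
Qed.

Lemma unip0 : unip 0 = 1%:M.
Proof. by rewrite /unip expr0n mul0r !scale0r !addr0. Qed.

Lemma tr_unip t : (unip t)^T = unip (- t).
Proof.
rewrite /unip !linearD/= !linearZ/= trmx1 trmx_mul xi_so mulNmx mulmxN opprK.
by rewrite sqrrN scalerN scaleNr.
Qed.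

Lemma unip_orth t : (unip t)^T *m unip t = 1%:M.
Proof. by rewrite tr_unip unipD addNr unip0. Qed.

Lemma unip_inv t : invmx (unip t) = unip (- t).
Proof.
have [u _] := mulmx1_unit (unip_orth (- t)).
have e : unip t *m unip (- t) = 1%:M by rewrite unipD subrr unip0.
have [ut _] := mulmx1_unit e.
by rewrite -[LHS]mulmx1 -e mulmxA mulVmx// mul1mx.
Qed.

(** Orthogonality only makes the square of a determinant equal to 1; applied to [unip (t / 2)] this
    suffices, because [unip t] is its square. *)
Lemma det_unip t : \det (unip t) = 1.
Proof.
have := congr1 determinant (unip_orth (t / 2)); rewrite det_mulmx det_tr det1.
by rewrite -det_mulmx unipD -splitr.
Qed.

(** The function t |-> F(g A g^-1) with g = [unip t] is constant; its derivative at t = 0 along the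
    real axis is this trace. *)
Lemma invariant_unip F A : adjoint_invariant F -> in_so A ->
  \tr ((grad_mx F A)^T *m (xi *m A - A *m xi)) = 0.
Proof.
move=> Finv soA.
pose G (t : R) := unip (real_complex R t) *m A *m unip (- real_complex R t).
have jt : jetC (fun t : R => real_complex R t) 0 1 1.
  by apply/(jetC_real (fun t => t)); exact: jet_id.
have ju : jet_mx (0 : R) (1 : R) (fun t : R => unip (real_complex R t)) xi.
  apply: jet_mx_eq (jet_mxD (jet_mxD (jet_mx_cst _ _ 1%:M) (jet_mxZl xi jt))
    (jet_mxZl (xi *m xi) (jetCM (jetCM jt jt) (jetC_cst 2^-1 (0 : R) (1 : R))))).
  by rewrite rmorph0 add0r scale1r !(mulr0, mul0r, addr0, scale0r).
have juN : jet_mx (0 : R) (1 : R) (fun t : R => unip (- real_complex R t)) (- xi).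
  apply: jet_mx_ext (jet_mx_eq _ (jet_mxD (jet_mxD (jet_mx_cst _ _ 1%:M)
    (jet_mxZ (-1) (jet_mxZl xi jt)))
    (jet_mxZl (xi *m xi) (jetCM (jetCM jt jt) (jetC_cst 2^-1 (0 : R) (1 : R)))))) => [t|].
    by rewrite /unip sqrrN expr2 scaleN1r scaleNr.
  by rewrite rmorph0 add0r scale1r !(mulr0, mul0r, addr0, scale0r) scaleN1r.
have jG : jet_mx (0 : R) (1 : R) G (xi *m A - A *m xi).
  apply: jet_mx_eq (jet_mulmx (jet_mulmx ju (jet_mx_cst _ _ A)) juN).
  by rewrite rmorph0 oppr0 unip0 mulmx0 addr0 !mulmx1 mul1mx mulmxN.
have := jet_mx_eval F jG.
rewrite {2}/G rmorph0 oppr0 unip0 mulmx1 mul1mx => j1.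
apply: (jetC_unique j1); apply: jetC_ext (jetC_cst (mx_eval F A) (0 : R) (1 : R)) => t.
by rewrite /G -unip_inv Finv ?unip_orth ?det_unip.
Qed.

End Unipotent.

Lemma exists_ord3 n (i k : 'I_n) : (3 <= n)%N -> exists j : 'I_n, (j != i) && (j != k).
Proof.
move=> hn; apply/existsP; apply: contraTT hn; rewrite negb_exists => /forallP h.
rewrite -ltnNge ltnS -[n]size_enum_ord.
apply: (@uniq_leq_size _ _ [:: i; k]) (enum_uniq _) _ => j _.
by have := h j; rewrite negb_and !negbK !inE.
Qed.

Lemma mxtrace_mul_comm (K : comNzRingType) n (A Z xi : 'M[K]_n) :
  \tr ((Z *m A - A *m Z) *m xi) = - \tr (Z *m (xi *m A - A *m xi)).
Proof.
rewrite mulmxBr mulmxBl !raddfB/= opprK [RHS]addrC !mulmxA.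
by congr (_ - _); rewrite -!mulmxA mxtrace_mulC mulmxA.
Qed.

(** Z is the skew part of the transposed gradient, which pairs with skew matrices as the full
    gradient does. Put M = [Z, A]. Invariance along x /\ y says y^T M x = 0 for isotropic x
    orthogonal to y, and enough such pairs exist to force M = 0. *)
Lemma invariant_gradient (R : realType) n (F : mpoly (n * n) R[i]) A :
  (3 <= n)%N -> adjoint_invariant F -> in_so A ->
  exists Z : 'M[R[i]]_n, [/\ in_so Z, Z *m A = A *m Z &
    forall B, in_so B -> \tr ((grad_mx F A)^T *m B) = \tr (Z *m B)].
Proof.
move=> hn Finv soA; pose g := grad_mx F A; pose Z := 2^-1 *: (g^T - g).
have soZ : in_so Z by rewrite /in_so /Z linearZ/= linearB/= trmxK -scalerN opprB.
have ZB B : in_so B -> \tr (g^T *m B) = \tr (Z *m B).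
  move=> soB; rewrite /Z -scalemxAl mxtraceZ mulmxBl linearB/=.
  have -> : \tr (g *m B) = - \tr (g^T *m B).
    by rewrite -mxtrace_tr trmx_mul soB mulNmx linearN/= mxtrace_mulC.
  by rewrite opprK; field.
exists Z; split=> //; apply/eqP; rewrite -subr_eq0; apply/eqP.
set M := Z *m A - A *m Z.
have soM : in_so M by rewrite /in_so /M linearB/= !trmx_mul soA soZ !mulNmx !mulmxN !opprK opprB.
have Mxy (x y : 'cV[R[i]]_n) : x^T *m x = 0 -> x^T *m y = 0 -> y^T *m M *m x = 0.
  move=> xx xy; have := invariant_unip (wedge_so x y) (wedge_nilp xx xy) Finv soA.
  set xi := wedge x y; rewrite -/g ZB; last first.
    rewrite /in_so linearB/= !trmx_mul soA (wedge_so x y : _^T = _) !mulNmx !mulmxN.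
    by rewrite !opprK opprB.
  move=> tr0; have {}tr0 : \tr (M *m xi) = 0.
    by rewrite mxtrace_mul_comm tr0 oppr0.
  have scal (a : 'M[R[i]]_1) : \tr a = 0 -> a = 0.
    rewrite /mxtrace big_ord1 => a0; apply/matrixP => i j.
    by rewrite !ord1 a0 mxE.
  apply: scal; move: tr0; rewrite /xi /wedge mulmxBr linearB/= !mulmxA.
  rewrite mxtrace_mulC mulmxA [X in _ - X]mxtrace_mulC mulmxA.
  have -> : \tr (y^T *m M *m x) = - \tr (x^T *m M *m y).
    by rewrite -mxtrace_tr !trmx_mul trmxK soM mulNmx mulmxN linearN/= mulmxA.
  by rewrite -opprD -mulr2n => /eqP; rewrite oppr_eq0 mulrn_eq0/= => /eqP ->; rewrite oppr0.
apply/matrixP => k i; rewrite [RHS]mxE.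
have [->|ki] := eqVneq k i.
  have /matrixP/(_ i i) := soM; rewrite !mxE => /eqP.
  by rewrite -addr_eq0 -mulr2n mulrn_eq0/= => /eqP.
have [j /andP[jk ji]] := exists_ord3 k i hn.
pose e l : 'cV[R[i]]_n := delta_mx l 0.
have ee a b : (e a)^T *m e b = (a == b)%:R%:M.
  rewrite /e trmx_delta mul_delta_mx_cond; apply/matrixP => r s.
  by rewrite !ord1; case: (a == b); rewrite !mxE.
have eMe a b : (e a)^T *m M *m e b = (M a b)%:M.
  rewrite /e trmx_delta -rowE -colE; apply/matrixP => r s; rewrite !ord1 !mxE.
  by rewrite mulr1n.
(* With z^2 = -1 the vector e_i + z e_j is isotropic and orthogonal to e_k. The third index j comes
   from n >= 3, and the two roots z together isolate M k i. *)
have iso (z : R[i]) : z ^+ 2 = -1 -> M k i + z * M k j = 0.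
  move=> z2; pose x := e i + z *: e j.
  have xT : x^T = (e i)^T + z *: (e j)^T by rewrite linearD linearZ.
  have xx : x^T *m x = 0.
    rewrite xT mulmxDl !mulmxDr -!scalemxAl -!scalemxAr !ee !eqxx.
    rewrite [i == j]eq_sym (negbTE ji) raddf0 !scaler0 addr0 add0r scalerA -expr2 z2.
    by rewrite scaleN1r subrr.
  have xy : x^T *m e k = 0.
    rewrite xT mulmxDl -scalemxAl !ee (negbTE jk) eq_sym (negbTE ki).
    by rewrite raddf0 scaler0 addr0.
  have /matrixP/(_ 0 0) := Mxy _ _ xx xy.
  by rewrite mulmxDr -scalemxAr !eMe !mxE !mulr1n.
have hi : 'i%C ^+ 2 = -1 :> R[i] by rewrite sqr_i.
have e1 := iso _ hi; have := iso (- 'i%C); rewrite sqrrN => /(_ hi) e2.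
have /eqP : M k i *+ 2 = 0.
  by rewrite mulr2n -[RHS](addr0 0) -{1}e1 -e2; ring.
by rewrite mulrn_eq0/= => /eqP.
Qed.

(** * The cotangent bundle in matrix form *)

Section MatrixForm.
Variables (R : realType) (n : nat).
Implicit Types (x v X : phase R n) (e p w u : 'M[R]_(n, 2)).

(** With frame and momenta as n x 2 matrices e and p, the bundle is e^T e = 1, e^T p + p^T e = 0,
    one has e1 /\ e2 = e J e^T with J = [J2], and the right rotations are generated by right
    multiplication by J. *)
Definition eM x : 'M[R]_(n, 2) := lsubmx (x : 'M[R]_(n, 2 + 2)).
Definition pM x : 'M[R]_(n, 2) := rsubmx (x : 'M[R]_(n, 2 + 2)).
Definition mk_phase e p : phase R n := row_mx e p : 'M[R]_(n, 2 + 2).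

Definition J2 : 'M[R]_2 := \matrix_(i, j) ((i < j)%N%:R - (j < i)%N%:R).

Lemma eM_mk e p : eM (mk_phase e p) = e. Proof. exact: row_mxKl. Qed.
Lemma pM_mk e p : pM (mk_phase e p) = p. Proof. exact: row_mxKr. Qed.
Lemma mk_phaseK x : mk_phase (eM x) (pM x) = x.
Proof. exact: (@hsubmxK _ n 2 2 x). Qed.

Lemma eMB x v : eM (x - v) = eM x - eM v.
Proof. exact: (linearB (@lsubmx R n 2 2)). Qed.
Lemma pMB x v : pM (x - v) = pM x - pM v.
Proof. exact: (linearB (@rsubmx R n 2 2)). Qed.

Lemma e1E x : e1 x = col 0 (eM x).
Proof. by apply/matrixP => i j; rewrite !mxE; congr (x _ _); apply/val_inj. Qed.
Lemma e2E x : e2 x = col 1 (eM x).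
Proof. by apply/matrixP => i j; rewrite !mxE; congr (x _ _); apply/val_inj. Qed.
Lemma p1E x : p1 x = col 0 (pM x).
Proof. by apply/matrixP => i j; rewrite !mxE; congr (x _ _); apply/val_inj. Qed.
Lemma p2E x : p2 x = col 1 (pM x).
Proof. by apply/matrixP => i j; rewrite !mxE; congr (x _ _); apply/val_inj. Qed.

Lemma dot_col m q (A : 'M[R]_(n, m)) (B : 'M[R]_(n, q)) i j :
  dot (col i A) (col j B) = (A^T *m B) i j.
Proof. by rewrite mxE; apply: eq_bigr => k _; rewrite !mxE. Qed.

Definition cols_dotE := (e1E, e2E, p1E, p2E, dot_col).

Lemma sum_ord2 (f : 'I_2 -> R) : \sum_i f i = f 0 + f 1.
Proof. by rewrite big_ord_recl big_ord1; congr (_ + f _); apply/val_inj. Qed.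

Lemma ord2P (P : 'I_2 -> Prop) : P 0 -> P 1 -> forall i, P i.
Proof.
move=> P0 P1 [[|[|//]] hi].
  by rewrite (_ : Ordinal hi = 0)//; apply/val_inj.
by rewrite (_ : Ordinal hi = 1)//; apply/val_inj.
Qed.

Lemma wedge_cols (A B : 'M[R]_(n, 2)) :
  wedge (col 0 A) (col 0 B) + wedge (col 1 A) (col 1 B) = A *m B^T - B *m A^T.
Proof.
by apply/matrixP => i j; rewrite !mxE !big_ord1 !sum_ord2 !mxE; ring.
Qed.

Lemma wedge_col01 (A : 'M[R]_(n, 2)) : wedge (col 0 A) (col 1 A) = A *m J2 *m A^T.
Proof.
apply/matrixP => i j; rewrite !mxE !big_ord1 !sum_ord2 !mxE !sum_ord2 !mxE /=.
by ring.
Qed.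

Definition Em x : 'M[R]_n := eM x *m J2 *m (eM x)^T.

Lemma wedge_e x : wedge (e1 x) (e2 x) = Em x.
Proof. by rewrite e1E e2E wedge_col01. Qed.

Lemma PhiE eta x :
  Phi eta x = pM x *m (eM x)^T - eM x *m (pM x)^T + eta *: Em x.
Proof. by rewrite /Phi wedge_e p1E p2E e1E e2E wedge_cols. Qed.

Lemma sym2P (A : 'M[R]_2) :
  A + A^T = 0 <-> [/\ A 0 0 = 0, A 1 1 = 0 & A 0 1 + A 1 0 = 0].
Proof.
split=> [/matrixP h|[h0 h1 h01]].
  have := h 0 0; have := h 1 1; have := h 0 1; rewrite !mxE => -> h11 h00.
  by split=> //; lra.
apply/matrixP; apply: ord2P; apply: ord2P; rewrite !mxE ?h0 ?h1 ?addr0//.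
by rewrite addrC.
Qed.

Lemma trmx_mulT m q r (A : 'M[R]_(m, q)) (B : 'M[R]_(m, r)) :
  (A^T *m B)^T = B^T *m A.
Proof. by rewrite trmx_mul trmxK. Qed.

Lemma tr_coef m q (A : 'M[R]_(n, m)) (B : 'M[R]_(n, q)) i j :
  (A^T *m B) i j = (B^T *m A) j i.
Proof. by rewrite -trmx_mulT mxE. Qed.

Lemma cotangentE x : cotangent_stiefel x <->
  (eM x)^T *m eM x = 1%:M /\ (eM x)^T *m pM x + (pM x)^T *m eM x = 0.
Proof.
rewrite /cotangent_stiefel /stiefel /= !cols_dotE -[(pM x)^T *m _]trmx_mulT.
rewrite sym2P.
split=> [[[a b c] d f g]|[/matrixP h [d f g]]].
  split; last by split.
  have c' : ((eM x)^T *m eM x) 1 0 = 0 by rewrite tr_coef c.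
  by apply/matrixP; apply: ord2P; apply: ord2P; rewrite [RHS]mxE ?a ?b ?c ?c'.
by split=> //; first by split; rewrite h mxE.
Qed.

Lemma tangentE x v : tangent x v <->
  (eM x)^T *m eM v + (eM v)^T *m eM x = 0 /\
  (eM v)^T *m pM x + (pM x)^T *m eM v +
  ((eM x)^T *m pM v + (pM v)^T *m eM x) = 0.
Proof.
have e2 : (eM v)^T *m pM x + (pM x)^T *m eM v +
    ((eM x)^T *m pM v + (pM v)^T *m eM x) =
    ((eM v)^T *m pM x + (eM x)^T *m pM v) + ((eM v)^T *m pM x + (eM x)^T *m pM v)^T.
  by rewrite linearD/= !trmx_mulT addrACA.
have addE (A B : 'M[R]_2) i j : (A + B) i j = A i j + B i j by rewrite mxE.
rewrite /tangent /= !cols_dotE (tr_coef (eM v) (eM x) 0 1).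
rewrite -[(eM v)^T *m eM x]trmx_mulT e2 !sym2P !addE.
split=> [[[a b c] [d f g]]|[[a b c] [d f g]]]; split; split=> //.
- by rewrite addrC.
- by rewrite addrC.
Qed.

Lemma twisted_formE eta x v : twisted_form eta x v =
  \tr ((pM x)^T *m eM v) - \tr ((pM v)^T *m eM x) +
  eta * \tr (J2^T *m ((eM x)^T *m eM v)).
Proof.
rewrite /twisted_form !cols_dotE /mxtrace !sum_ord2 (tr_coef (eM v) (eM x)).
set A := _^T *m eM v; set B := _^T *m eM x; set C := (eM x)^T *m _.
by rewrite ![(J2^T *m _) _ _]mxE !sum_ord2 !mxE /=; ring.
Qed.

Lemma so_formE (A B : 'M[R]_n) : so_form A B = - (2^-1 * \tr (A *m B)).
Proof. by []. Qed.

Definition dEm x v : 'M[R]_n :=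
  eM v *m J2 *m (eM x)^T + eM x *m J2 *m (eM v)^T.

Definition dPhi eta x v : 'M[R]_n :=
  pM v *m (eM x)^T - eM v *m (pM x)^T + pM x *m (eM v)^T - eM x *m (pM v)^T +
  eta *: dEm x v.

Lemma trJ2 : J2^T = - J2.
Proof. by apply/matrixP => i j; rewrite !mxE opprB. Qed.

Lemma J2J2 : J2 *m J2 = - 1%:M.
Proof.
apply/matrixP; apply: ord2P; apply: ord2P; rewrite !mxE sum_ord2 !mxE /=; ring.
Qed.

End MatrixForm.

Section LinearTranspose.
Variable K : pzRingType.

Lemma trmxB m q (A B : 'M[K]_(m, q)) : (A - B)^T = A^T - B^T.
Proof. exact: linearB. Qed.

Lemma trmxD m q (A B : 'M[K]_(m, q)) : (A + B)^T = A^T + B^T.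
Proof. exact: linearD. Qed.

Lemma trmxZ m q c (A : 'M[K]_(m, q)) : (c *: A)^T = c *: A^T.
Proof. exact: linearZ. Qed.

Lemma mxtraceB m (A B : 'M[K]_m) : \tr (A - B) = \tr A - \tr B.
Proof. exact: linearB. Qed.

Lemma mxtraceN m (A : 'M[K]_m) : \tr (- A) = - \tr A.
Proof. exact: linearN. Qed.

End LinearTranspose.

Section RealMatrixJets.
Variables (R : realType) (V : normedModType R) (x v : V).

Definition rjet_mx m n (G : V -> 'M[R]_(m, n)) (D : 'M[R]_(m, n)) : Prop :=
  forall i j, jet (fun y => G y i j) x v (D i j).

Lemma rjet_mx_ext m n (G H : V -> 'M[R]_(m, n)) D :
  G =1 H -> rjet_mx G D -> rjet_mx H D.
Proof. by move=> /funext ->. Qed.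

Lemma rjet_mx_eq m n (G : V -> 'M[R]_(m, n)) D D' :
  D = D' -> rjet_mx G D -> rjet_mx G D'.
Proof. by move=> ->. Qed.

Lemma rjet_mx_cst m n (A : 'M[R]_(m, n)) : rjet_mx (fun=> A) 0.
Proof. by move=> i j; rewrite mxE; exact: jet_cst. Qed.

Lemma rjet_mxD m n (G H : V -> 'M[R]_(m, n)) D D' :
  rjet_mx G D -> rjet_mx H D' -> rjet_mx (fun y => G y + H y) (D + D').
Proof.
move=> jG jH i j; rewrite mxE.
by apply: jet_ext (jetD (jG i j) (jH i j)) => y; rewrite mxE.
Qed.

Lemma rjet_mxZ m n c (G : V -> 'M[R]_(m, n)) D :
  rjet_mx G D -> rjet_mx (fun y => c *: G y) (c *: D).
Proof.
move=> jG i j; rewrite mxE.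
by apply: jet_ext (jetZ c (jG i j)) => y; rewrite mxE.
Qed.

Lemma rjet_mxB m n (G H : V -> 'M[R]_(m, n)) D D' :
  rjet_mx G D -> rjet_mx H D' -> rjet_mx (fun y => G y - H y) (D - D').
Proof.
move=> jG jH; have := rjet_mxD jG (rjet_mxZ (-1) jH).
by rewrite scaleN1r; apply: rjet_mx_ext => y; rewrite scaleN1r.
Qed.

Lemma rjet_tr m n (G : V -> 'M[R]_(m, n)) D :
  rjet_mx G D -> rjet_mx (fun y => (G y)^T) D^T.
Proof. by move=> jG i j; rewrite mxE; apply: jet_ext (jG j i) => y; rewrite mxE. Qed.

Lemma rjet_mulmx m n p (G : V -> 'M[R]_(m, n)) (H : V -> 'M[R]_(n, p)) D D' :
  rjet_mx G D -> rjet_mx H D' ->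
  rjet_mx (fun y => G y *m H y) (D *m H x + G x *m D').
Proof.
move=> jG jH i j; rewrite !mxE -big_split/=.
apply: jet_ext; last by apply: jet_sum => k _; exact: jetM (jG i k) (jH k j).
by move=> y; rewrite mxE.
Qed.

Lemma rjet_mxtrace n (G : V -> 'M[R]_n) D :
  rjet_mx G D -> jet (fun y => \tr (G y)) x v (\tr D).
Proof. by move=> jG; apply: jet_sum. Qed.

Lemma rjet_mxC n (G : V -> 'M[R]_n) D :
  rjet_mx G D -> jet_mx x v (fun y => complexify (G y)) (complexify D).
Proof.
move=> jG i j; rewrite mxE; apply: jetC_ext ((jetC_real _ _ _ _).1 (jG i j)) => y.
by rewrite mxE.
Qed.

End RealMatrixJets.

(** * Tangent vectors, nondegeneracy and test vectors *)

Section Geometry.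
Variables (R : realType) (n : nat) (eta : R).
Implicit Types (x v X : phase R n) (e p w u : 'M[R]_(n, 2)) (xi : 'M[R]_n).

Lemma rjet_eM x v : rjet_mx x v (@eM R n) (eM v).
Proof. by move=> i j; rewrite mxE; apply: jet_ext (jet_coord x v _ _) => y; rewrite mxE. Qed.

Lemma rjet_pM x v : rjet_mx x v (@pM R n) (pM v).
Proof. by move=> i j; rewrite mxE; apply: jet_ext (jet_coord x v _ _) => y; rewrite mxE. Qed.

Lemma rjet_Em x v : rjet_mx x v (@Em R n) (dEm x v).
Proof.
apply: rjet_mx_eq (rjet_mulmx (rjet_mulmx (rjet_eM x v) (rjet_mx_cst _ _ (J2 R)))
  (rjet_tr (rjet_eM x v))).
by rewrite mulmx0 addr0.
Qed.

Lemma rjet_Phi x v : rjet_mx x v (Phi eta) (dPhi eta x v).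
Proof.
apply: rjet_mx_ext (rjet_mx_eq _ (rjet_mxD (rjet_mxB
  (rjet_mulmx (rjet_pM x v) (rjet_tr (rjet_eM x v)))
  (rjet_mulmx (rjet_eM x v) (rjet_tr (rjet_pM x v))))
  (rjet_mxZ eta (rjet_Em x v)))) => [y|]; first by rewrite PhiE.
rewrite /dPhi opprD; congr (_ + _).
by rewrite addrACA addrA.
Qed.

(** The symmetric S for which adding e S to the momentum part restores the momentum constraint, the
    constraint changing by 2 S because e^T e = 1. Such a term changes neither Phi, as e S e^T is
    symmetric, nor the pairing with a tangent v, as e^T v is skew. *)
Definition tan_corr x w u : 'M[R]_2 := - 2^-1 *:
  ((w^T *m pM x + (pM x)^T *m w) + ((eM x)^T *m u + u^T *m eM x)).

Definition tan_lift x w u : phase R n := mk_phase w (u + eM x *m tan_corr x w u).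

Lemma tan_corr_sym x w u : (tan_corr x w u)^T = tan_corr x w u.
Proof.
rewrite /tan_corr linearZ/=; congr (_ *: _); rewrite !linearD/= !trmx_mulT.
by congr (_ + _); exact: addrC.
Qed.

Lemma tr_tan_lift x w u :
  (u + eM x *m tan_corr x w u)^T = u^T + tan_corr x w u *m (eM x)^T.
Proof. by rewrite linearD/= trmx_mul tan_corr_sym. Qed.

Lemma tan_lift_tangent x w u : cotangent_stiefel x ->
  (eM x)^T *m w + w^T *m eM x = 0 -> tangent x (tan_lift x w u).
Proof.
move=> /cotangentE[ee _] ew; apply/tangentE; rewrite /tan_lift eM_mk pM_mk.
split=> //; rewrite tr_tan_lift; set S := tan_corr x w u.
rewrite mulmxDl mulmxDr mulmxA ee mul1mx -[S *m _ *m _]mulmxA ee mulmx1.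
rewrite [X in _ + X = _]addrACA.
have -> : S + S = - ((w^T *m pM x + (pM x)^T *m w) + ((eM x)^T *m u + u^T *m eM x)).
  by rewrite /S -scalerDl -opprD (_ : 2^-1 + 2^-1 = 1) ?scaleN1r//; lra.
by rewrite [LHS]addrA subrr.
Qed.

Lemma dEm_tan_lift x w u : dEm x (tan_lift x w u) = dEm x (mk_phase w u).
Proof. by rewrite /dEm !eM_mk. Qed.

Lemma dPhi_tan_lift x w u : dPhi eta x (tan_lift x w u) = dPhi eta x (mk_phase w u).
Proof.
rewrite /dPhi dEm_tan_lift /tan_lift !eM_mk !pM_mk; congr (_ + _).
rewrite tr_tan_lift.
rewrite mulmxDl mulmxDr !mulmxA.
by apply/matrixP => i j; rewrite ![_ i j]mxE; ring.
Qed.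

Lemma mxtrace_sym_anti m (S A : 'M[R]_m) : S^T = S -> A + A^T = 0 -> \tr (S *m A) = 0.
Proof.
move=> ST /eqP; rewrite addrC addr_eq0 => /eqP AT.
suff : \tr (S *m A) = - \tr (S *m A) by move=> h; lra.
by rewrite -{1}mxtrace_tr trmx_mul ST AT mulNmx linearN/= mxtrace_mulC.
Qed.

Lemma mxtraceT2 m q (A B : 'M[R]_(m, q)) : \tr (A^T *m B) = \tr (B^T *m A).
Proof. by rewrite -trmx_mulT mxtrace_tr. Qed.

Lemma form_tan_lift x w u v : tangent x v ->
  twisted_form eta (tan_lift x w u) v = twisted_form eta (mk_phase w u) v.
Proof.
move=> /tangentE[ev _]; rewrite !twisted_formE /tan_lift !eM_mk !pM_mk.
rewrite tr_tan_lift.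
rewrite mulmxDl linearD/= -mulmxA (mxtrace_sym_anti (tan_corr_sym _ _ _)) ?addr0//.
by rewrite trmx_mulT.
Qed.

Lemma mxtrace_tr_mul0 m q (A : 'M[R]_(m, q)) : \tr (A^T *m A) = 0 -> A = 0.
Proof.
rewrite mxtrace_mulC /mxtrace => /eqP.
rewrite psumr_eq0 => [/allP h|i _]; last first.
  by rewrite mxE sumr_ge0// => j _; rewrite mxE -expr2 sqr_ge0.
apply/matrixP => i j; rewrite [RHS]mxE.
have := h i (mem_index_enum _); rewrite mxE psumr_eq0 => [/allP/(_ j (mem_index_enum _))|k _].
  by rewrite mxE -expr2 sqrf_eq0 => /eqP.
by rewrite mxE -expr2 sqr_ge0.
Qed.

(** Testing on the vertical vector with momentum part [eM X] gives the squared norm of [eM X]. Once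
    that vanishes, [pM X] is an admissible frame direction, and testing on its lift gives the
    squared norm of [pM X]. *)
Lemma twisted_form_nondegenerate x X : cotangent_stiefel x -> tangent x X ->
  (forall v, tangent x v -> twisted_form eta X v = 0) -> X = 0.
Proof.
move=> cx tX h; have /tangentE[eX pX] := tX; move/cotangentE: (cx) => [ee ep].
have t1 : tangent x (mk_phase 0 (eM X)).
  by apply/tangentE; rewrite eM_mk pM_mk trmx0 !mulmx0 !mul0mx !addr0 add0r.
have eX0 : eM X = 0.
  apply: mxtrace_tr_mul0; have := h _ t1; rewrite twisted_formE eM_mk pM_mk.
  by rewrite !mulmx0 mxtrace0 mulr0 addr0 sub0r => /eqP; rewrite oppr_eq0 => /eqP.
move: pX; rewrite eX0 trmx0 mul0mx mulmx0 !add0r => pX.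
have pX0 : pM X = 0.
  apply: mxtrace_tr_mul0; have := h _ (tan_lift_tangent 0 cx pX).
  rewrite twisted_formE /tan_lift eM_mk eX0 !trmx0 !mul0mx !mulmx0 !mxtrace0 mulr0.
  by rewrite subr0 addr0.
rewrite -[X]mk_phaseK eX0 pX0; exact: (@row_mx0 R n 2 2).
Qed.

Lemma twisted_formB X Y v :
  twisted_form eta (X - Y) v = twisted_form eta X v - twisted_form eta Y v.
Proof.
rewrite !twisted_formE eMB pMB !trmxB !(mulmxBl, mulmxBr) !mxtraceB; ring.
Qed.

Lemma tangentB x X Y : tangent x X -> tangent x Y -> tangent x (X - Y).
Proof.
move=> /tangentE[a b] /tangentE[c d]; apply/tangentE; rewrite eMB pMB; split.
  by rewrite trmxB mulmxBl mulmxBr addrACA -opprD a c subrr.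
rewrite !trmxB !mulmxBl !mulmxBr -[RHS](subrr 0) -{1}b -{1}d.
by apply/matrixP => i j; rewrite ![_ i j]mxE; ring.
Qed.

Lemma ham_fieldE f x X : cotangent_stiefel x -> is_ham_vector eta f x X ->
  ham_field eta f x = X.
Proof.
move=> cx hX; apply: xget_unique => // Y [tY hY]; case: hX => tX hX.
apply/eqP; rewrite -subr_eq0; apply/eqP.
apply: (twisted_form_nondegenerate cx); first exact: tangentB.
by move=> v tv; rewrite twisted_formB hY// hX// subrr.
Qed.

(** If g had no Hamiltonian vector at x, [ham_field] would be its default 0 and the bracket would
    again vanish; only a given Y has to be treated. *)
Lemma poissonE f g x d : (forall Y, is_ham_vector eta g x Y -> 'd f x Y = d) ->
  d = 0 -> poisson eta f g x = 0.
Proof.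
move=> h d0; rewrite /poisson /ham_field; case: xgetP => [Y _ hY|_].
  by rewrite h.
by rewrite linear0.
Qed.

Lemma twisted_formC X v : twisted_form eta X v = - twisted_form eta v X.
Proof. by rewrite /twisted_form; ring. Qed.

Lemma Em_so x : in_so (Em x).
Proof. by rewrite -wedge_e; exact: wedge_so. Qed.

Lemma dEm_so x v : in_so (dEm x v).
Proof.
rewrite /in_so /dEm linearD/= !trmx_mul !trmxK trJ2 !mulNmx !mulmxN !mulmxA.
by rewrite -opprD addrC.
Qed.

Lemma Phi_so x : in_so (Phi eta x).
Proof.
rewrite PhiE /in_so trmxD trmxB linearZ/= (Em_so x : _^T = _) !trmx_mul !trmxK.
by rewrite scalerN opprD opprB.
Qed.

Lemma dPhi_so x v : in_so (dPhi eta x v).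
Proof.
rewrite /in_so /dPhi trmxD linearZ/= (dEm_so x v : _^T = _).
rewrite !(trmxB, trmxD) !trmx_mul !trmxK.
by apply/matrixP => i j; rewrite ![_ i j]mxE; ring.
Qed.

Definition rot_field x xi : phase R n := mk_phase (xi *m eM x) (xi *m pM x).
(** The momentum u = xi e J is chosen so that u e^T - e u^T = [xi, e J e^T]. *)
Definition shift_field x xi : phase R n := tan_lift x 0 (xi *m eM x *m J2 R).

Lemma rot_field_tangent x xi : in_so xi -> tangent x (rot_field x xi).
Proof.
move=> so; apply/tangentE; rewrite eM_mk pM_mk !trmx_mul so.
split; rewrite !(mulmxN, mulNmx) !mulmxA ?subrr//.
by apply/matrixP => i j; rewrite ![_ i j]mxE; ring.
Qed.

Lemma dEm_rot x xi : in_so xi -> dEm x (rot_field x xi) = commutator xi (Em x).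
Proof.
by move=> so; rewrite /dEm /commutator /Em eM_mk trmx_mul so !mulmxN !mulmxA.
Qed.

Lemma dPhi_rot x xi : in_so xi ->
  dPhi eta x (rot_field x xi) = commutator xi (Phi eta x).
Proof.
move=> so; rewrite /dPhi dEm_rot// PhiE /commutator eM_mk pM_mk !trmx_mul so.
rewrite !(mulmxN, mulmxDl, mulmxDr, mulNmx, mulmxBr, mulmxBl) -!scalemxAl -!scalemxAr !mulmxA.
by apply/matrixP => i j; rewrite ![_ i j]mxE; ring.
Qed.

Lemma shift_field_tangent x xi : cotangent_stiefel x -> tangent x (shift_field x xi).
Proof.
by move=> cx; apply: tan_lift_tangent => //; rewrite mulmx0 trmx0 mul0mx addr0.
Qed.

Lemma dEm_shift x xi : dEm x (shift_field x xi) = 0.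
Proof. by rewrite dEm_tan_lift /dEm eM_mk trmx0 mulmx0 !mul0mx addr0. Qed.

Lemma dPhi_shift x xi : in_so xi ->
  dPhi eta x (shift_field x xi) = commutator xi (Em x).
Proof.
move=> so; rewrite dPhi_tan_lift /dPhi /dEm eM_mk pM_mk !trmx0 !mulmx0 !mul0mx.
rewrite !addr0 scaler0 addr0 subr0 /commutator /Em !trmx_mul so trJ2.
by rewrite !(mulNmx, mulmxN) opprK !mulmxA.
Qed.

Lemma mxtrace_dEm x v xi : in_so xi ->
  \tr (dEm x v *m xi) = 2 * \tr (J2 R *m (eM x)^T *m xi *m eM v).
Proof.
move=> so; rewrite /dEm mulmxDl linearD/= mulr2n mulrDl !mul1r; congr (_ + _).
  by rewrite -!mulmxA mxtrace_mulC !mulmxA.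
rewrite -mxtrace_tr !trmx_mul trmxK so trJ2 !(mulNmx, mulmxN) opprK !mulmxA.
by rewrite -[_ *m J2 R *m _]mulmxA mxtrace_mulC !mulmxA.
Qed.

End Geometry.

Section Fields.
Variables (R : realType) (n : nat) (eta : R).
Implicit Types (x v X : phase R n) (xi : 'M[R]_n).

Local Notation J := (J2 R).

(** In other words, [shift_field x xi] is the Hamiltonian vector of [so_form (Em x) xi]. The next
    lemma does the same for [rot_field] and Phi: it is the momentum map property. *)
Lemma form_shift x xi v : in_so xi -> tangent x v ->
  twisted_form eta (shift_field x xi) v = 2^-1 * \tr (dEm x v *m xi).
Proof.
move=> so tv; rewrite form_tan_lift// twisted_formE eM_mk pM_mk.
rewrite trmx0 mul0mx !mulmx0 !mxtrace0 mulr0 addr0 subr0 mxtrace_dEm//.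
rewrite mulKf ?pnatr_eq0// !trmx_mul so trJ2.
by rewrite !(mulmxN, mulNmx) opprK !mulmxA.
Qed.

Lemma form_rot x xi v : in_so xi ->
  twisted_form eta (rot_field x xi) v = 2^-1 * \tr (dPhi eta x v *m xi).
Proof.
move=> so; rewrite twisted_formE eM_mk pM_mk /dPhi.
rewrite !mulmxDl !mulNmx -scalemxAl !mxtraceD !mxtraceN mxtraceZ mxtrace_dEm//.
have -> : \tr (eM x *m (pM v)^T *m xi) = - \tr (pM v *m (eM x)^T *m xi).
  rewrite -mxtrace_tr !trmx_mul trmxK so mulNmx mxtraceN.
  by rewrite [in RHS]mxtrace_mulC.
have -> : \tr (pM x *m (eM v)^T *m xi) = - \tr (eM v *m (pM x)^T *m xi).
  rewrite -mxtrace_tr !trmx_mul trmxK so mulNmx mxtraceN.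
  by rewrite [in RHS]mxtrace_mulC.
have -> : \tr ((xi *m pM x)^T *m eM v) = - \tr (eM v *m (pM x)^T *m xi).
  by rewrite trmx_mul so mulmxN mulNmx mxtraceN mxtrace_mulC mulmxA.
have -> : \tr ((pM v)^T *m (xi *m eM x)) = - \tr (pM v *m (eM x)^T *m xi).
  rewrite mulmxA -mxtrace_tr !trmx_mul trmxK so mulNmx mulmxN mxtraceN.
  by rewrite mulmxA mxtrace_mulC mulmxA.
have -> : \tr (J^T *m ((xi *m eM x)^T *m eM v)) = \tr (J *m (eM x)^T *m xi *m eM v).
  by rewrite trmx_mul so trJ2 !(mulmxN, mulNmx) opprK !mulmxA.
by field.
Qed.

(** The momentum property read backwards, by antisymmetry of the form: how Phi moves along the flow
    of g is determined by the derivatives of g along rotations. Shifts do the same for E in the next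
    lemma. *)
Lemma ham_dPhi g x Y xi : in_so xi -> is_ham_vector eta g x Y ->
  \tr (dPhi eta x Y *m xi) = 2 * 'd g x (rot_field x xi).
Proof.
move=> so [tY hY]; have := hY _ (rot_field_tangent x so).
rewrite twisted_formC form_rot// => /eqP; rewrite eqr_opp => /eqP <-.
by rewrite mulVKf ?pnatr_eq0.
Qed.

Lemma ham_dEm g x Y xi : cotangent_stiefel x -> in_so xi -> is_ham_vector eta g x Y ->
  \tr (dEm x Y *m xi) = 2 * 'd g x (shift_field x xi).
Proof.
move=> cx so [tY hY]; have := hY _ (shift_field_tangent xi cx).
rewrite twisted_formC form_shift// => /eqP; rewrite eqr_opp => /eqP <-.
by rewrite mulVKf ?pnatr_eq0.
Qed.

Lemma mxtrace_J (A : 'M[R]_2) : \tr (J^T *m A) = A 0 1 - A 1 0.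
Proof. by rewrite /mxtrace sum_ord2 !mxE !sum_ord2 !mxE /=; ring. Qed.

Lemma PsiE x : Psi x = \tr (J^T *m ((eM x)^T *m pM x)).
Proof. by rewrite mxtrace_J /Psi !cols_dotE. Qed.

Lemma jet_Psi x v :
  jet (@Psi R n) x v (\tr (J^T *m ((eM v)^T *m pM x + (eM x)^T *m pM v))).
Proof.
apply: jet_ext (jet_eq _ (rjet_mxtrace (rjet_mulmx (rjet_mx_cst x v J^T)
  (rjet_mulmx (rjet_tr (rjet_eM x v)) (rjet_pM x v))))) => [y|].
  by rewrite PsiE.
by rewrite mul0mx add0r.
Qed.

(** Generator of the right SO(2)-action and Hamiltonian vector of [Psi]. It fixes Phi and E, so
    [Psi] commutes with every function of these two. *)
Definition spin_field x : phase R n := mk_phase (eM x *m J) (pM x *m J).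

Lemma spin_field_tangent x : cotangent_stiefel x -> tangent x (spin_field x).
Proof.
move=> /cotangentE[ee /eqP]; rewrite addrC addr_eq0 => /eqP pe.
apply/tangentE; rewrite eM_mk pM_mk !trmx_mul !mulmxA; split.
  by rewrite ee mul1mx -mulmxA ee mulmx1 trJ2 subrr.
rewrite -[J^T *m _ *m pM x]mulmxA -[J^T *m _ *m eM x]mulmxA pe mulmxN mulNmx.
by apply/matrixP => i j; rewrite ![_ i j]mxE; ring.
Qed.

Lemma dEm_spin x : dEm x (spin_field x) = 0.
Proof.
rewrite /dEm eM_mk trmx_mul trJ2 mulNmx !mulmxN -!mulmxA.
by rewrite subrr.
Qed.

Lemma dPhi_spin x : dPhi eta x (spin_field x) = 0.
Proof.
rewrite /dPhi dEm_spin eM_mk pM_mk !trmx_mul trJ2 !mulNmx !mulmxN !mulmxA scaler0 addr0.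
by apply/matrixP => i j; rewrite ![_ i j]mxE; ring.
Qed.

Lemma form_spin x v : cotangent_stiefel x -> tangent x v ->
  twisted_form eta (spin_field x) v = - 'd (@Psi R n) x v.
Proof.
move=> /cotangentE[ee _] /tangentE[ev _]; rewrite (jet_Psi x v).2.
rewrite twisted_formE eM_mk pM_mk !trmx_mul mulmxDr mxtraceD.
(* The twist drops out: J^T J^T = -1 leaves the trace of the skew matrix e^T v. *)
have -> : \tr (J^T *m (J^T *m (eM x)^T *m eM v)) = 0.
  rewrite !mulmxA trJ2 mulNmx mulmxN opprK J2J2 -mulmxA mulNmx mul1mx mxtraceN.
  rewrite -[\tr _]mul1r -mxtraceZ scale1r.
  have := @mxtrace_sym_anti R _ 1%:M ((eM x)^T *m eM v) (trmx1 _ _).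
  by rewrite trmx_mulT mul1mx => ->; rewrite ?oppr0.
rewrite mulr0 addr0.
have -> : \tr ((pM v)^T *m (eM x *m J)) = \tr (J^T *m ((eM x)^T *m pM v)).
  by rewrite -mxtrace_tr trmx_mul trmxK trmx_mul mulmxA.
have -> : \tr (J^T *m ((eM v)^T *m pM x)) = - \tr (J^T *m (pM x)^T *m eM v).
  rewrite -mxtrace_tr trmx_mul trmx_mulT trmxK trJ2 mulNmx mulNmx mxtraceN opprK.
  by rewrite mxtrace_mulC mulmxA.
by ring.
Qed.

Lemma dPsi_rot x xi : in_so xi -> 'd (@Psi R n) x (rot_field x xi) = 0.
Proof.
move=> so; rewrite (jet_Psi _ _).2 eM_mk pM_mk trmx_mul so mulmxN mulNmx !mulmxA.
by rewrite addNr mulmx0 mxtrace0.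
Qed.

Lemma dPsi_shift x xi : cotangent_stiefel x -> in_so xi ->
  'd (@Psi R n) x (shift_field x xi) = 0.
Proof.
move=> /cotangentE[ee _] so; rewrite (jet_Psi _ _).2 /shift_field /tan_lift eM_mk pM_mk.
rewrite trmx0 mul0mx add0r mulmxDr [(eM x)^T *m (_ *m tan_corr _ _ _)]mulmxA ee mul1mx.
rewrite mulmxDr mxtraceD.
have -> : \tr (J^T *m tan_corr x 0 (xi *m eM x *m J)) = 0.
  rewrite mxtrace_J -{1}tan_corr_sym mxE subrr//.
rewrite addr0 mxtrace_mulC !mulmxA -[_ *m J *m J^T]mulmxA trJ2 [J *m - J]mulmxN J2J2 opprK mulmx1.
have := @mxtrace_sym_anti R 2 1%:M ((eM x)^T *m xi *m eM x) (trmx1 _ _).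
rewrite mul1mx; apply; rewrite !trmx_mul trmxK so mulNmx mulmxN mulmxA.
by rewrite subrr.
Qed.

Lemma dPsi_spin x : 'd (@Psi R n) x (spin_field x) = 0.
Proof.
rewrite (jet_Psi _ _).2 eM_mk pM_mk trmx_mul mulmxDr mxtraceD.
rewrite [X in _ + X]mxtrace_mulC !mulmxA -[X in _ + \tr X]mulmxA.
rewrite trJ2 !(mulmxN, mulNmx) opprK J2J2 !(mulmxN, mulNmx) mul1mx mulmx1 opprK mxtraceN.
by rewrite addNr.
Qed.
End Fields.

(** * The Lax equation *)

Section HamiltonianField.
Variables (R : realType) (n : nat) (eta kappa : R) (Xi : 'M[R]_n).
Hypothesis soXi : in_so Xi.
Implicit Types (x v X : phase R n).

Local Notation J := (J2 R).

Lemma HamiltonianE x : Hamiltonian kappa Xi x =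
  2^-1 * \tr ((pM x)^T *m pM x)
  - (1 + 2 * kappa) * (((pM x)^T *m eM x) 0 1 * ((pM x)^T *m eM x) 1 0)
  - 2^-1 * \tr (Em x *m Xi).
Proof.
rewrite /Hamiltonian /V_I so_formE wedge_e /mxtrace sum_ord2 !cols_dotE mulrDr.
by [].
Qed.

Definition dHam x v : R :=
  let N := (pM x)^T *m eM x in
  let M := (pM v)^T *m eM x + (pM x)^T *m eM v in
  \tr ((pM x)^T *m pM v) - (1 + 2 * kappa) * (M 0 1 * N 1 0 + N 0 1 * M 1 0)
  - 2^-1 * \tr (dEm x v *m Xi).

Lemma jet_Ham x v : jet (Hamiltonian kappa Xi) x v (dHam x v).
Proof.
have jN := rjet_mulmx (rjet_tr (rjet_pM x v)) (rjet_eM x v).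
have jE := rjet_mulmx (rjet_Em x v) (rjet_mx_cst x v Xi).
have jp := rjet_mulmx (rjet_tr (rjet_pM x v)) (rjet_pM x v).
apply: jet_ext (jet_eq _ (jetB (jetB (jetZ 2^-1 (rjet_mxtrace jp))
  (jetZ (1 + 2 * kappa) (jetM (jN 0 1) (jN 1 0)))) (jetZ 2^-1 (rjet_mxtrace jE)))) => [y|].
  by rewrite HamiltonianE.
rewrite /dHam mulmx0 addr0 mxtraceD [\tr ((pM v)^T *m _)]mxtraceT2.
by congr (_ - _ - _); field.
Qed.

(** [ham_w] and [ham_u] are the right-hand sides of the ambient equations, simplified by p2.e1 = -
    p1.e2, which holds on the bundle. The multiples of [ham_a] form a multiple of [spin_field],
    apart from a twist term that [tan_lift] absorbs. As [ham_w] already respects the frame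
    constraints, the Lagrange multipliers supplied by [tan_lift] enter the momenta only. *)
Definition ham_a x : R := (1 + 2 * kappa) * ((pM x)^T *m eM x) 0 1.
Definition ham_w x : 'M[R]_(n, 2) := pM x - ham_a x *: (eM x *m J).
Definition ham_u x : 'M[R]_(n, 2) :=
  - ham_a x *: (pM x *m J) + Xi *m eM x *m J - eta *: (ham_w x *m J).
Definition ham_vec x : phase R n := tan_lift x (ham_w x) (ham_u x).

Lemma pTe x : cotangent_stiefel x ->
  (pM x)^T *m eM x = ((pM x)^T *m eM x) 0 1 *: J.
Proof.
move=> /cotangentE[_ pe].
have := (sym2P ((pM x)^T *m eM x)).1; rewrite trmx_mulT addrC => /(_ pe)[h0 h1 h].
apply/matrixP; apply: ord2P; apply: ord2P; rewrite [RHS]mxE [J _ _]mxE /= ?h0 ?h1; try ring.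
by move/eqP: h; rewrite addrC addr_eq0 => /eqP ->; ring.
Qed.

Lemma ham_w_tangent x : cotangent_stiefel x ->
  (eM x)^T *m ham_w x + (ham_w x)^T *m eM x = 0.
Proof.
move=> /cotangentE[ee pe]; rewrite /ham_w trmxB trmxZ trmx_mul.
rewrite mulmxBr mulmxBl -scalemxAr -scalemxAl mulmxA ee mul1mx -mulmxA ee mulmx1.
by rewrite addrACA pe add0r -opprD -scalerDr trJ2 subrr scaler0 oppr0.
Qed.

Lemma ham_vec_ham x : cotangent_stiefel x ->
  is_ham_vector eta (Hamiltonian kappa Xi) x (ham_vec x).
Proof.
move=> cx; split=> [|v tv]; first exact: tan_lift_tangent (ham_w_tangent cx).
rewrite (jet_Ham x v).2 form_tan_lift// twisted_formE eM_mk pM_mk /dHam /=.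
set a := ham_a x; set N := (pM x)^T *m eM x; set w := ham_w x.
have N10 : N 1 0 = - N 0 1.
  have /matrixP/(_ 1 0) := pTe cx; rewrite -/N [RHS]mxE [J _ _]mxE /= => ->.
  by ring.
rewrite mxtrace_dEm// N10.
have -> : \tr ((ham_u x)^T *m eM v) = - a * \tr (J^T *m ((pM x)^T *m eM v)) +
    \tr (J *m (eM x)^T *m Xi *m eM v) - eta * \tr (J^T *m (w^T *m eM v)).
  rewrite /ham_u -/w -/a trmxB trmxD !trmxZ !trmx_mul soXi mulmxBl mulmxDl.
  rewrite -!scalemxAl mxtraceB mxtraceD !mxtraceZ !mulmxA [in X in _ + X - _]trJ2.
  by rewrite !(mulmxN, mulNmx) opprK.
have -> : \tr ((pM v)^T *m w) = \tr ((pM x)^T *m pM v) +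
    a * \tr (J^T *m ((pM v)^T *m eM x)).
  rewrite /w /ham_w mulmxBr mxtraceB -/a -scalemxAr mxtraceZ mxtraceT2.
  by rewrite [(pM v)^T *m (_ *m J)]mulmxA [\tr (_ *m J)]mxtrace_mulC trJ2 mulNmx mxtraceN mulrN.
set M := (pM v)^T *m eM x + _.
have MJ : M 0 1 - M 1 0 =
    \tr (J^T *m ((pM v)^T *m eM x)) + \tr (J^T *m ((pM x)^T *m eM v)).
  by rewrite -mxtrace_J /M mulmxDr mxtraceD.
have -> : (1 + 2 * kappa) * (M 0 1 * - N 0 1 + N 0 1 * M 1 0) = - a * (M 0 1 - M 1 0).
  by rewrite /a /ham_a -/N; ring.
by rewrite MJ; field.
Qed.

Lemma ham_fieldH x : cotangent_stiefel x ->
  ham_field eta (Hamiltonian kappa Xi) x = ham_vec x.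
Proof. by move=> cx; apply: ham_fieldE => //; exact: ham_vec_ham. Qed.

(** In [Phi, E] the terms e p^T E and E p e^T cancel because p^T e is a multiple of J ([pTe]); by
    e^T e = 1 the other two are the variation of E along p. *)
Lemma dEm_ham x : cotangent_stiefel x ->
  dEm x (ham_vec x) = commutator (Phi eta x) (Em x).
Proof.
move=> cx; have /cotangentE[ee /eqP] := cx; rewrite addr_eq0 => /eqP ep.
rewrite dEm_tan_lift /dEm eM_mk /commutator PhiE.
rewrite [X in _ = X - _]mulmxDl [X in _ = _ - X]mulmxDr -scalemxAl -scalemxAr.
rewrite opprD addrACA subrr addr0 [_ *m Em x]mulmxBl mulmxBr.
have pEe : eM x *m (pM x)^T *m Em x = ((pM x)^T *m eM x) 0 1 *: (eM x *m J *m J *m (eM x)^T).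
  rewrite /Em !mulmxA -[_ *m (pM x)^T *m _]mulmxA {1}(pTe cx).
  by rewrite -scalemxAr -!scalemxAl.
have eEp : Em x *m (pM x *m (eM x)^T) =
    - (((pM x)^T *m eM x) 0 1 *: (eM x *m J *m J *m (eM x)^T)).
  rewrite /Em !mulmxA -[_ *m (eM x)^T *m pM x]mulmxA ep {1}(pTe cx).
  by rewrite mulmxN mulNmx -scalemxAr -!scalemxAl.
rewrite pEe eEp.
have -> : pM x *m (eM x)^T *m Em x = pM x *m J *m (eM x)^T.
  by rewrite /Em !mulmxA -[_ *m (eM x)^T *m _]mulmxA ee mulmx1.
have -> : Em x *m (eM x *m (pM x)^T) = eM x *m J *m (pM x)^T.
  by rewrite /Em !mulmxA -[_ *m (eM x)^T *m _]mulmxA ee mulmx1.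
rewrite /ham_w trmxB trmxZ trmx_mul trJ2 !mulmxBl mulmxBr.
rewrite -!scalemxAl -!scalemxAr !(mulmxN, mulNmx) !mulmxA.
by apply/matrixP => i j; rewrite ![_ i j]mxE; ring.
Qed.

Lemma dPhi_ham x : cotangent_stiefel x ->
  dPhi eta x (ham_vec x) = commutator Xi (Em x).
Proof.
move=> cx; rewrite dPhi_tan_lift /dPhi eM_mk pM_mk.
have -> : eta *: dEm x (mk_phase (ham_w x) (ham_u x)) =
    eta *: (ham_w x *m J *m (eM x)^T + eM x *m J *m (ham_w x)^T).
  by rewrite /dEm eM_mk.
have -> : ham_w x *m (pM x)^T =
    pM x *m (pM x)^T - ham_a x *: (eM x *m J *m (pM x)^T).
  by rewrite /ham_w mulmxBl -scalemxAl.
have -> : pM x *m (ham_w x)^T =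
    pM x *m (pM x)^T + ham_a x *: (pM x *m J *m (eM x)^T).
  rewrite /ham_w trmxB trmxZ trmx_mul trJ2 mulmxBr -scalemxAr mulNmx mulmxN.
  by rewrite scalerN opprK mulmxA.
have -> : (ham_u x)^T = ham_a x *: (J *m (pM x)^T) + J *m (eM x)^T *m Xi
    + eta *: (J *m (ham_w x)^T).
  rewrite /ham_u trmxB trmxD !trmxZ !trmx_mul trJ2 soXi.
  by rewrite !(mulmxN, mulNmx) opprK !scalerN scaleNr !opprK mulmxA.
rewrite /ham_u /commutator /Em; move: (ham_w x) => w.
rewrite mulmxBl !mulmxDl !mulmxDr -!scalemxAl -!scalemxAr !mulmxA.
by apply/matrixP => i j; rewrite ![_ i j]mxE; ring.
Qed.

End HamiltonianField.

Section LaxEquation.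
Variables (R : realType) (n : nat) (eta : R).
Implicit Types (x v X : phase R n) (Xi : 'M[R]_n).

Definition dLax (lambda : R[i]) x v : 'M[R[i]]_n :=
  lambda *: complexify (dPhi eta x v) + ('i)%C *: complexify (dEm x v).

Lemma jet_lax Xi lambda x v : jet_mx x v (lax_L eta Xi lambda) (dLax lambda x v).
Proof.
apply: jet_mx_ext (jet_mx_eq _ (jet_mxD
  (jet_mxZ lambda (rjet_mxC (rjet_Phi eta x v)))
  (jet_mxZ ('i)%C (jet_mxD (rjet_mxC (rjet_Em x v))
    (jet_mx_cst x v (- (lambda ^+ 2 *: complexify Xi))))))) => [y|].
  by rewrite /lax_L wedge_e.
by rewrite addr0.
Qed.

Lemma complexifyM m (A B : 'M[R]_m) : complexify (A *m B) = complexify A *m complexify B.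
Proof. exact: map_mxM. Qed.

Lemma complexifyB m (A B : 'M[R]_m) : complexify (A - B) = complexify A - complexify B.
Proof. exact: map_mxB. Qed.

Lemma sqr_iC : ('i)%C * ('i)%C = -1 :> R[i].
Proof. by rewrite -expr2 sqr_i. Qed.

(** The two contributions of degree 2 in lambda, multiples of [Phi, Xi] and [Xi, Phi], cancel.
    Stated for a single vector, it serves both the Lax equation and the commutation with the
    Hamiltonian. *)
Lemma lax_bracket Xi lambda x X :
  dPhi eta x X = commutator Xi (Em x) -> dEm x X = commutator (Phi eta x) (Em x) ->
  dLax lambda x X = commutator (lax_A eta Xi lambda x) (lax_L eta Xi lambda x).
Proof.
move=> hP hE; rewrite /dLax hP hE /commutator /lax_A /lax_L wedge_e.
rewrite !complexifyB !complexifyM.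
move: (complexify _) (complexify _) (complexify _) => P E Z.
rewrite -![- (_ *: Z)]scaleNr.
rewrite !(mulmxDl, mulmxDr, mulmxBl, mulmxBr, scalerDr, scalerBr).
rewrite -!(scalemxAl, scalemxAr) !scalerA.
have i2 := sqr_iC; apply/matrixP => i j; rewrite ![_ i j]mxE.
by ring: i2.
Qed.

Lemma is_derive_cmx_curve (t : R) (gamma : R -> phase R n) X (G : phase R n -> 'M[R[i]]_n) D :
  is_derive t 1 gamma X -> jet_mx (gamma t) X G D ->
  is_derive_cmx t (fun s => G (gamma s)) D.
Proof.
move=> [dg gX] jG.
have dg' : differentiable gamma t by apply/derivable1_diffP.
have chain (f : phase R n -> R) d : jet f (gamma t) X d ->
    is_derive t 1 (f \o gamma) d.
  move=> [df fd]; have dc := differentiable_comp dg' df.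
  apply: DeriveDef; first exact: diff_derivable.
  by rewrite deriveE// diff_comp//= -[X in 'd f _ X]deriveE// gX.
have mx (h : R[i] -> R) : (forall i j, jet (fun y => h (G y i j)) (gamma t) X (h (D i j))) ->
    is_derive t 1 (fun s => map_mx h (G (gamma s))) (map_mx h D).
  move=> jh.
  have jh' i j : is_derive t 1 (fun s => (map_mx h (G (gamma s))) i j) (h (D i j)).
    have := chain _ _ (jh i j); congr (is_derive _ _ _ _).
    by apply/funext => s /=; rewrite mxE.
  have dm : derivable (fun s => map_mx h (G (gamma s))) t 1.
    by apply/derivable_mxP => i j; case: (jh' i j).
  apply: DeriveDef => //; rewrite derive_mx//.
  by apply/matrixP => i j; rewrite !mxE; case: (jh' i j).
by split; apply: mx => i j; have [] := jG i j.
Qed.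

Lemma lax_equation (kappa : R) Xi (I : set R) (gamma : R -> phase R n) :
  in_so Xi -> integral_curve eta (Hamiltonian kappa Xi) I gamma ->
  forall (lambda : R[i]) (t : R), I t ->
    is_derive_cmx t (fun s => lax_L eta Xi lambda (gamma s))
      (commutator (lax_A eta Xi lambda (gamma t)) (lax_L eta Xi lambda (gamma t))).
Proof.
move=> so hc lambda t It; have [cx dg] := hc _ It.
rewrite (ham_fieldH _ _ so cx) in dg.
apply: (is_derive_cmx_curve dg).
apply: jet_mx_eq (jet_lax _ _ _ _).
by apply: lax_bracket; [exact: dPhi_ham|exact: dEm_ham].
Qed.

End LaxEquation.

(** * Involutivity *)

Section Interpolation.
Variable C : numFieldType.

Lemma poly_eq_nat (p q : {poly C}) : (forall k : nat, p.[k%:R] = q.[k%:R]) -> p = q.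
Proof.
move=> pq; apply/eqP; rewrite -subr_eq0; apply/eqP.
apply: (@roots_geq_poly_eq0 _ _ [seq k%:R | k <- iota 0 (size (p - q))]).
- by apply/allP => _ /mapP[k _ ->]; rewrite rootE hornerD hornerN pq subrr.
- by rewrite map_inj_uniq ?iota_uniq// => k l /eqP; rewrite eqr_nat => /eqP.
- by rewrite size_map size_iota.
Qed.

(** The weights are a column of the inverse Vandermonde matrix at the nodes s, ..., s + N - 1. The
    offset s allows disjoint node sets for two invariants. *)
Lemma interpolation N s j : exists w : 'I_N -> C, forall p : {poly C},
  (size p <= N)%N -> p`_j = \sum_(i < N) w i * p.[(s + i)%:R].
Proof.
have [Nj|jN] := leqP N j.
  exists (fun=> 0) => p pN; rewrite nth_default ?(leq_trans pN)//.
  by rewrite big1// => i _; rewrite mul0r.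
pose a : 'rV[C]_N := \row_i (s + i)%:R; pose V := Vandermonde N a.
have uV : V \in unitmx.
  rewrite unitmxE unitfE det_Vandermonde; apply/prodf_neq0 => i _.
  apply/prodf_neq0 => k ik; rewrite !mxE subr_eq0 eqr_nat eqn_add2l.
  by rewrite neq_ltn ik orbT.
exists (fun i => (invmx V) i (Ordinal jN)) => p pN.
pose c : 'rV[C]_N := \row_k p`_k.
have cV : c *m V = \row_i p.[(s + i)%:R].
  apply/rowP => i; rewrite !mxE (horner_coef_wide _ pN).
  by apply: eq_bigr => k _; rewrite !mxE.
have -> : p`_j = (c *m V *m invmx V) 0 (Ordinal jN) by rewrite mulmxK// mxE.
by rewrite cV mxE; apply: eq_bigr => i _; rewrite !mxE mulrC.
Qed.

(** The bound is uniform in g, which makes the interpolation weights the same at all points of phase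
    space, so that they can be treated as constants when differentiating. *)
Lemma meval_poly_size M (F : mpoly M C) d : exists N, forall g : 'I_M -> {poly C},
  (forall k, (size (g k) <= d)%N) ->
  exists2 p : {poly C}, (size p <= N)%N & forall z, p.[z] = meval (fun k => (g k).[z]) F.
Proof.
elim/mpoly_ring_ind: F => [c|i|p q [N hN] [N' hN']|p q [N hN] [N' hN']].
- exists 1%N => g _; exists c%:P; first exact: size_polyC_leq1.
  by move=> z; rewrite mevalC hornerC.
- by exists d => g gd; exists (g i) => // z; rewrite mevalXU.
- exists (maxn N N') => g gd.
  have [p1 s1 h1] := hN g gd; have [p2 s2 h2] := hN' g gd.
  exists (p1 + p2); last by move=> z; rewrite hornerD mevalD h1 h2.
  by rewrite (leq_trans (size_polyD _ _))// geq_max !leq_max s1 s2 orbT.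
- exists (N + N')%N => g gd.
  have [p1 s1 h1] := hN g gd; have [p2 s2 h2] := hN' g gd.
  exists (p1 * p2); last by move=> z; rewrite hornerM mevalM h1 h2.
  rewrite (leq_trans (size_polyMleq _ _))// (leq_trans (leq_pred _))//.
  exact: leq_add.
Qed.

End Interpolation.

Section LaxDifferential.
Variables (R : realType) (n : nat) (eta : R) (Xi : 'M[R]_n).
Implicit Types (x v X Y : phase R n) (f g : phase R n -> R).

Lemma lax_L_poly x : exists g : 'I_(n * n) -> {poly R[i]},
  (forall k, (size (g k) <= 3)%N) /\
  forall z k, mxvec (lax_L eta Xi z x) 0 k = (g k).[z].
Proof.
pose P := complexify (Phi eta x); pose E := complexify (wedge (e1 x) (e2 x)).
exists (fun k => ('i%C * mxvec E 0 k)%:P + mxvec P 0 k *: 'X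
   - ('i%C * mxvec (complexify Xi) 0 k) *: 'X^2); split=> [k|z k].
  rewrite (leq_trans (size_polyD _ _))// geq_max size_polyN.
  rewrite !(leq_trans (size_scale_leq _ _)) ?size_polyXn// andbT.
  rewrite (leq_trans (size_polyD _ _))// geq_max (leq_trans (size_polyC_leq1 _))//.
  by rewrite (leq_trans (size_scale_leq _ _)) ?size_polyX.
case/mxvec_indexP: k => i j; rewrite !mxvecE.
rewrite !(hornerD, hornerN, hornerZ, hornerC, hornerX, hornerXn).
rewrite /lax_L -/P -/E; move: (complexify Xi) P E => Q P E.
by rewrite !mxE; ring.
Qed.

Lemma lax_sum f s : lax_invariant eta Xi f ->
  exists (F : mpoly (n * n) R[i]) N (w : 'I_N -> R[i]), adjoint_invariant F /\
    forall x, real_complex R (f x) =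
      \sum_(i < N) w i * mx_eval F (lax_L eta Xi (s + i)%:R x).
Proof.
move=> [F [j [c [Finv _ hq]]]]; have [N hN] := meval_poly_size F 3.
have [w hw] := interpolation R[i] N s j.
exists F, N, (fun i => c * w i); split=> // x.
have [q [qF ->]] := hq x; have [g [gs gL]] := lax_L_poly x.
have [p sp ph] := hN g gs.
have Fp z : mx_eval F (lax_L eta Xi z x) = p.[z].
  by rewrite ph; apply: meval_eq => k; exact: gL.
have -> : q = p by apply: poly_eq_nat => k; rewrite qF Fp.
rewrite hw// mulr_sumr; apply: eq_bigr => i _.
by rewrite mulrA Fp.
Qed.

Lemma complexifyN m (A : 'M[R]_m) : complexify (- A) = - complexify A.
Proof. exact: map_mxN. Qed.

Lemma complexify_so m (A : 'M[R]_m) : in_so A -> in_so (complexify A).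
Proof.
move=> so; rewrite /in_so -complexifyN -so.
by apply/matrixP => i j; rewrite !mxE.
Qed.

Lemma lax_L_so z x : in_so Xi -> in_so (lax_L eta Xi z x).
Proof.
move=> /complexify_so; have := complexify_so (Phi_so eta x).
have := complexify_so (Em_so x); rewrite /lax_L wedge_e /in_so.
move: (complexify _) (complexify _) (complexify _) => Q P E hE hP hQ.
apply/matrixP => i j; rewrite !mxE.
have tr (A : 'M[R[i]]_n) : A^T = - A -> A j i = - A i j by move=> /matrixP/(_ i j); rewrite !mxE.
by rewrite (tr _ hE) (tr _ hP) (tr _ hQ); ring.
Qed.

Lemma dLax_so z x v : in_so (dLax eta z x v).
Proof.
have := complexify_so (dPhi_so eta x v); have := complexify_so (dEm_so x v).
rewrite /dLax /in_so; move: (complexify _) (complexify _) => P E hE hP.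
by rewrite linearD/= !linearZ/= hE hP !scalerN -opprD.
Qed.

Definition lax_rep f x s N (w : 'I_N -> R[i]) (Z : 'I_N -> 'M[R[i]]_n) : Prop :=
  (forall i, in_so (Z i) /\
    Z i *m lax_L eta Xi (s + i)%:R x = lax_L eta Xi (s + i)%:R x *m Z i) /\
  forall v, differentiable f x /\ real_complex R ('d f x v) =
    \sum_i w i * \tr (Z i *m dLax eta (s + i)%:R x v).

Lemma lax_differential f s x : (3 <= n)%N -> in_so Xi -> lax_invariant eta Xi f ->
  exists N (w : 'I_N -> R[i]) Z, lax_rep f x s w Z.
Proof.
move=> hn so /(lax_sum s)[F [N [w [Finv hf]]]].
pose L (i : 'I_N) := lax_L eta Xi (s + i)%:R x.
have /choice[Z hZ] (i : 'I_N) : exists Z : 'M[R[i]]_n, [/\ in_so Z, Z *m L i = L i *m Z &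
    forall B, in_so B -> \tr ((grad_mx F (L i))^T *m B) = \tr (Z *m B)].
  by apply: invariant_gradient => //; exact: lax_L_so.
exists N, w, Z; split=> [i|v]; first by have [] := hZ i.
have : jetC (fun y => real_complex R (f y)) x v
    (\sum_i w i * \tr (Z i *m dLax eta (s + i)%:R x v)).
  apply: jetC_ext (jetC_eq _ (jetC_sum (index_enum _) (P := xpredT) (fun i _ =>
    jetCZ (w i) (jet_mx_eval F (jet_lax eta Xi (s + i)%:R x v))))) => [y|].
    by rewrite hf.
  apply: eq_bigr => i _; congr (_ * _).
  by have [_ _ ->] := hZ i; [|exact: dLax_so].
move=> [/= [df ->] jI]; split=> //.
by rewrite [RHS]complexE (jet_unique jI (jet_cst 0 x v)) rmorph0 mulr0 addr0.
Qed.

Lemma so_trace0 (A : 'M[R]_n) : in_so A ->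
  (forall xi, in_so xi -> \tr (A *m xi) = 0) -> A = 0.
Proof.
move=> so h; apply: mxtrace_tr_mul0.
by rewrite so mulNmx mxtraceN h ?oppr0.
Qed.

Lemma ham_Psi_d0 x Y : cotangent_stiefel x -> is_ham_vector eta (@Psi R n) x Y ->
  dPhi eta x Y = 0 /\ dEm x Y = 0.
Proof.
move=> cx hY; split; apply: so_trace0.
- exact: dPhi_so.
- by move=> xi so; rewrite (ham_dPhi so hY) dPsi_rot ?mulr0.
- exact: dEm_so.
- by move=> xi so; rewrite (ham_dEm cx so hY) dPsi_shift ?mulr0.
Qed.

Lemma dLax0 z x v : dPhi eta x v = 0 -> dEm x v = 0 -> dLax eta z x v = 0.
Proof. by move=> hP hE; rewrite /dLax hP hE /complexify !map_mx0 !scaler0 addr0. Qed.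

Lemma real_complex_eq0 (a : R) : real_complex R a = 0 -> a = 0.
Proof. by move=> [->]. Qed.

Lemma lax_d0 f x v : (3 <= n)%N -> in_so Xi -> lax_invariant eta Xi f ->
  dPhi eta x v = 0 -> dEm x v = 0 -> 'd f x v = 0.
Proof.
move=> hn so hf hP hE; have [N [w [Z [_ /(_ v)[_ e]]]]] := lax_differential 0 x hn so hf.
apply: real_complex_eq0; rewrite e big1// => i _.
by rewrite dLax0// mulmx0 mxtrace0 mulr0.
Qed.

Lemma poisson_lax_Psi f : (3 <= n)%N -> in_so Xi -> lax_invariant eta Xi f ->
  poisson_commute eta f (@Psi R n).
Proof.
move=> hn so hf x cx; apply: (@poissonE _ _ _ _ _ _ 0) => // Y hY.
by have [hP hE] := ham_Psi_d0 cx hY; exact: lax_d0.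
Qed.

(** Antisymmetry exchanges the roles: the derivative of [Psi] along the flow of g is minus that of g
    along [spin_field]. *)
Lemma poisson_Psi g : (forall x, cotangent_stiefel x -> 'd g x (spin_field x) = 0) ->
  poisson_commute eta (@Psi R n) g.
Proof.
move=> h x cx; apply: (@poissonE _ _ _ _ _ _ 0) => // Y [tY hY].
have := form_spin eta cx tY; rewrite twisted_formC hY ?h// ?oppr0.
  by move=> /eqP; rewrite eq_sym oppr_eq0 => /eqP.
exact: spin_field_tangent.
Qed.

Lemma poisson_Psi_lax g : (3 <= n)%N -> in_so Xi -> lax_invariant eta Xi g ->
  poisson_commute eta (@Psi R n) g.
Proof.
move=> hn so hg; apply: poisson_Psi => x cx.
by apply: lax_d0 => //; [exact: dPhi_spin|exact: dEm_spin].
Qed.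

Lemma poisson_Psi_Psi : poisson_commute eta (@Psi R n) (@Psi R n).
Proof. by apply: poisson_Psi => x cx; exact: dPsi_spin. Qed.

Lemma dHam_spin kappa x : cotangent_stiefel x -> dHam kappa Xi x (spin_field x) = 0.
Proof.
move=> cx; rewrite /dHam dEm_spin mul0mx mxtrace0 mulr0 subr0 /= eM_mk pM_mk.
have -> : (pM x *m J2 R)^T *m eM x + (pM x)^T *m (eM x *m J2 R) = 0.
  rewrite trmx_mul -[_ *m _ *m eM x]mulmxA [(pM x)^T *m (_ *m _)]mulmxA (pTe cx).
  by rewrite -scalemxAl -!scalemxAr trJ2 mulNmx scalerN addNr.
rewrite !mxE mul0r mulr0 addr0 mulr0 subr0 mulmxA.
apply: mxtrace_sym_anti; first by rewrite trmx_mulT.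
by rewrite trJ2 subrr.
Qed.

Lemma poisson_Psi_Ham kappa : poisson_commute eta (@Psi R n) (Hamiltonian kappa Xi).
Proof.
by apply: poisson_Psi => x cx; rewrite (jet_Ham _ _ _ _).2 dHam_spin.
Qed.

(** Along the flow, each node contributes the trace of Z [A, L], and this is zero because Z commutes
    with L. *)
Lemma poisson_lax_Ham kappa f : (3 <= n)%N -> in_so Xi -> lax_invariant eta Xi f ->
  poisson_commute eta f (Hamiltonian kappa Xi).
Proof.
move=> hn so hf x cx; rewrite /poisson ham_fieldH//.
have [N [w [Z [hZ /(_ (ham_vec eta kappa Xi x))[_ e]]]]] := lax_differential 0 x hn so hf.
apply: real_complex_eq0; rewrite e big1// => i _; have [_ ZL] := hZ i.
rewrite (lax_bracket _ (dPhi_ham _ _ so cx) (dEm_ham _ _ _ cx)) /commutator.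
rewrite mulmxBr mxtraceB mulmxA [Z i *m (_ *m lax_A _ _ _ _)]mulmxA ZL.
by rewrite [\tr (_ *m lax_L _ _ _ _)]mxtrace_mulC mulmxA subrr mulr0.
Qed.

End LaxDifferential.

Section Commutators.
Variables (K : fieldType) (m : nat).
Implicit Types A B D P E Q Z W : 'M[K]_m.

Lemma commutatorDr A B D : commutator A (B + D) = commutator A B + commutator A D.
Proof. by rewrite /commutator mulmxDr mulmxDl opprD addrACA. Qed.

Lemma commutatorZr c A B : commutator A (c *: B) = c *: commutator A B.
Proof. by rewrite /commutator -scalemxAr -scalemxAl scalerBr. Qed.

Lemma commutatorDl A B D : commutator (A + B) D = commutator A D + commutator B D.
Proof. by rewrite /commutator mulmxDr mulmxDl opprD addrACA. Qed.

Lemma commutatorZl c A B : commutator (c *: A) B = c *: commutator A B.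
Proof. by rewrite /commutator -scalemxAr -scalemxAl scalerBr. Qed.

Lemma trace_mulmxD X A B : \tr (X *m (A + B)) = \tr (X *m A) + \tr (X *m B).
Proof. by rewrite mulmxDr mxtraceD. Qed.

Lemma trace_mulmxZ X c A : \tr (X *m (c *: A)) = c * \tr (X *m A).
Proof. by rewrite -scalemxAr mxtraceZ. Qed.

(** With coefficients (a, b) = (u, i) this is the differential of an invariant along the rotation by
    A, with (0, u) along the shift by A, where u lists the nodes; both are extended to complex A. *)
Definition bracket_form N (w a b : 'I_N -> K) (Zf : 'I_N -> 'M[K]_m) P E A : K :=
  \sum_k w k * \tr (Zf k *m (a k *: commutator A P + b k *: commutator A E)).

Lemma bracket_formD N (w a b : 'I_N -> K) (Zf : 'I_N -> 'M[K]_m) P E A B :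
  bracket_form w a b Zf P E (A + B) = bracket_form w a b Zf P E A + bracket_form w a b Zf P E B.
Proof.
rewrite /bracket_form -big_split; apply: eq_bigr => k _ /=.
rewrite (commutatorDl A B P) (commutatorDl A B E) -mulrDr; congr (_ * _).
move: (commutator A P) (commutator B P) (commutator A E) (commutator B E) => X1 X2 X3 X4.
by rewrite !scalerDr addrACA mulmxDr mxtraceD.
Qed.

Lemma bracket_formZ N (w a b : 'I_N -> K) (Zf : 'I_N -> 'M[K]_m) P E c A :
  bracket_form w a b Zf P E (c *: A) = c * bracket_form w a b Zf P E A.
Proof.
rewrite /bracket_form mulr_sumr; apply: eq_bigr => k _.
rewrite (commutatorZl c A P) (commutatorZl c A E) mulrCA; congr (_ * _).
move: (commutator A P) (commutator A E) => X1 X2.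
by rewrite -mxtraceZ scalemxAr (scalerDr c) !scalerA ![c * _]mulrC.
Qed.

(* The combination of L(l) and L(u) with coefficients u^2 and -l^2 does not
   contain Q: it is (u - l) times the matrix in the bracket below. *)
Lemma shifted_bracket0 (j l u : K) P E Q Z W : l != u ->
  let L z := z *: P + j *: (E - z ^+ 2 *: Q) in
  Z *m L l = L l *m Z -> W *m L u = L u *m W ->
  \tr (W *m commutator Z ((l * u) *: P + (j * (l + u)) *: E)) = 0.
Proof.
move=> lu L ZL WL; apply: (@mulfI _ (u - l)); first by rewrite subr_eq0 eq_sym.
rewrite mulr0 -mxtraceZ scalemxAr -commutatorZr.
have -> : (u - l) *: ((l * u) *: P + (j * (l + u)) *: E) =
    u ^+ 2 *: L l + (- l ^+ 2) *: L u.
  by rewrite /L; apply/matrixP => i k; rewrite !mxE; ring.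
rewrite commutatorDr !commutatorZr {1}/commutator ZL subrr scaler0 add0r.
rewrite -scalemxAr mxtraceZ; move: (L u) WL => M WL.
rewrite /commutator mulmxBr mxtraceB !mulmxA WL.
by rewrite [\tr (_ *m M)]mxtrace_mulC mulmxA subrr mulr0.
Qed.

Lemma bracket_form_comb N (w a : 'I_N -> K) (Zf : 'I_N -> 'M[K]_m) P E A (l j : K) :
  l * bracket_form w a (fun=> j) Zf P E A + j * bracket_form w (fun=> 0) a Zf P E A =
  \sum_k w k * \tr (Zf k *m commutator A ((l * a k) *: P + (j * (l + a k)) *: E)).
Proof.
rewrite /bracket_form !mulr_sumr -big_split; apply: eq_bigr => k _ /=.
rewrite mulrCA [X in _ + X]mulrCA -mulrDr; congr (_ * _).
rewrite commutatorDr !commutatorZr; move: (commutator A P) (commutator A E) => X1 X2.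
rewrite -!trace_mulmxZ -trace_mulmxD; congr (\tr (_ *m _)).
by apply/matrixP => i i'; rewrite !mxE; ring.
Qed.

Lemma bracket_form_comb0 N (w a : 'I_N -> K) (Zf : 'I_N -> 'M[K]_m) P E A (l j : K) :
  (forall k, \tr (Zf k *m commutator A ((l * a k) *: P + (j * (l + a k)) *: E)) = 0) ->
  l * bracket_form w a (fun=> j) Zf P E A + j * bracket_form w (fun=> 0) a Zf P E A = 0.
Proof. by move=> h; rewrite bracket_form_comb big1// => k _; rewrite h mulr0. Qed.

Lemma scale_additive (d : K) (h : 'M[K]_m -> K) A B :
  h (A + B) = h A + h B -> d * h (A + B) = d * h A + d * h B.
Proof. by move=> ->; rewrite mulrDr. Qed.

Lemma scale_scalable (d c : K) (h : 'M[K]_m -> K) A :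
  h (c *: A) = c * h A -> d * h (c *: A) = c * (d * h A).
Proof. by move=> ->; rewrite mulrCA. Qed.

Lemma mulr_eq0r (a b : K) : b = 0 -> a * b = 0.
Proof. by move=> ->; rewrite mulr0. Qed.

Lemma trace_dLax P E Z (l j d hp he : K) :
  \tr (P *m Z) = d * hp -> \tr (E *m Z) = d * he ->
  \tr (Z *m (l *: P + j *: E)) = d * (l * hp + j * he).
Proof.
move=> hP hE; rewrite mulmxDr mxtraceD -!scalemxAr !mxtraceZ.
by rewrite ![\tr (Z *m _)]mxtrace_mulC hP hE mulrDr ![d * (_ * _)]mulrCA.
Qed.

End Commutators.

Section LaxCommutation.
Variables (R : realType) (n : nat) (eta : R) (Xi : 'M[R]_n).
Implicit Types (x v X Y : phase R n) (f g : phase R n -> R).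
Local Notation C := R[i].

Lemma complexify_commutator m (A B : 'M[R]_m) :
  complexify (commutator A B) = commutator (complexify A) (complexify B).
Proof. by rewrite /commutator complexifyB !complexifyM. Qed.

Lemma dLax_rot z x (A : 'M[R]_n) : in_so A -> dLax eta z x (rot_field x A) =
  z *: commutator (complexify A) (complexify (Phi eta x)) +
  'i%C *: commutator (complexify A) (complexify (Em x)).
Proof.
move=> so; rewrite /dLax (dPhi_rot eta x so) (dEm_rot x so).
by rewrite (complexify_commutator A (Phi eta x)) (complexify_commutator A (Em x)).
Qed.

Lemma dLax_shift z x (A : 'M[R]_n) : in_so A -> dLax eta z x (shift_field x A) =
  0 *: commutator (complexify A) (complexify (Phi eta x)) +
  z *: commutator (complexify A) (complexify (Em x)).
Proof.
move=> so; rewrite /dLax (dPhi_shift eta x so) dEm_shift.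
rewrite (complexify_commutator A (Em x)).
by rewrite scale0r add0r /complexify map_mx0 scaler0 addr0.
Qed.

Definition cplx_re (A : 'M[C]_n) : 'M[R]_n := map_mx (@complex.Re R) A.
Definition cplx_im (A : 'M[C]_n) : 'M[R]_n := map_mx (@complex.Im R) A.

Lemma complexify_split (A : 'M[C]_n) :
  A = complexify (cplx_re A) + 'i%C *: complexify (cplx_im A).
Proof. by apply/matrixP => i j; rewrite !mxE -complexE. Qed.

Lemma cplx_re_so A : in_so A -> in_so (cplx_re A).
Proof.
move=> /matrixP so; apply/matrixP => i j; have := so i j; rewrite !mxE => ->.
by rewrite raddfN.
Qed.

Lemma cplx_im_so A : in_so A -> in_so (cplx_im A).
Proof.
move=> /matrixP so; apply/matrixP => i j; have := so i j; rewrite !mxE => ->.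
by rewrite raddfN.
Qed.

(** Needed because rotations and shifts have real generators, while the gradients Z that they are to
    be tested on are complex. *)
Lemma so_complex_ext (f g : 'M[C]_n -> C) :
  (forall A B, f (A + B) = f A + f B) -> (forall c A, f (c *: A) = c * f A) ->
  (forall A B, g (A + B) = g A + g B) -> (forall c A, g (c *: A) = c * g A) ->
  (forall A : 'M[R]_n, in_so A -> f (complexify A) = g (complexify A)) ->
  forall A, in_so A -> f A = g A.
Proof.
move=> fD fZ gD gZ h A soA; rewrite [A]complexify_split fD fZ gD gZ !h//.
  exact: cplx_im_so.
exact: cplx_re_so.
Qed.

Lemma complexify_tr m (A : 'M[R]_m) : \tr (complexify A) = real_complex R (\tr A).
Proof. by rewrite /mxtrace rmorph_sum; apply: eq_bigr => i _; rewrite mxE. Qed.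

Lemma poisson_lax f g : (3 <= n)%N -> in_so Xi ->
  lax_invariant eta Xi f -> lax_invariant eta Xi g -> poisson_commute eta f g.
Proof.
move=> hn so hf hg x cx.
apply: (@poissonE _ _ _ _ _ _ 0) => // Y hY; apply: real_complex_eq0.
have [N [w [Z [hZ hZd]]]] := lax_differential 0 x hn so hf.
(* The nodes of g start at N, just after those of f, so that l <> u for every pair. *)
have [M [w' [Z' [hZ' hZd']]]] := lax_differential N x hn so hg.
rewrite (hZd Y).2.
pose P := complexify (Phi eta x); pose E := complexify (Em x).
pose h a b A := bracket_form w' a b Z' P E A.
pose u (k : 'I_M) : C := (N + k)%:R.
have hP A : in_so A -> \tr (complexify (dPhi eta x Y) *m A) = 2 * h u (fun=> 'i%C) A.
  move: A; apply: so_complex_ext => [A B|c A|A B|c A|A soA].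
  - exact: trace_mulmxD.
  - exact: trace_mulmxZ.
  - exact: (@scale_additive _ _ 2 (h u (fun=> 'i%C)) A B (bracket_formD _ _ _ _ _ _ _ _)).
  - exact: (@scale_scalable _ _ 2 c (h u (fun=> 'i%C)) A (bracket_formZ _ _ _ _ _ _ _ _)).
  rewrite -complexifyM complexify_tr (ham_dPhi soA hY) rmorphM rmorph_nat; congr (_ * _).
  apply: (etrans (hZd' _).2); apply: eq_bigr => k _.
  exact: (congr1 (fun M => w' k * \tr (Z' k *m M)) (dLax_rot _ _ soA)).
have hE A : in_so A -> \tr (complexify (dEm x Y) *m A) = 2 * h (fun=> 0) u A.
  move: A; apply: so_complex_ext => [A B|c A|A B|c A|A soA].
  - exact: trace_mulmxD.
  - exact: trace_mulmxZ.
  - exact: (@scale_additive _ _ 2 (h (fun=> 0) u) A B (bracket_formD _ _ _ _ _ _ _ _)).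
  - exact: (@scale_scalable _ _ 2 c (h (fun=> 0) u) A (bracket_formZ _ _ _ _ _ _ _ _)).
  rewrite -complexifyM complexify_tr (ham_dEm cx soA hY) rmorphM rmorph_nat; congr (_ * _).
  apply: (etrans (hZd' _).2); apply: eq_bigr => k _.
  exact: (congr1 (fun M => w' k * \tr (Z' k *m M)) (dLax_shift _ _ soA)).
apply: big1 => i _; have [soZ ZL] := hZ i.
apply: mulr_eq0r.
apply: (etrans (trace_dLax _ _ (hP _ soZ) (hE _ soZ))).
apply: mulr_eq0r; apply: bracket_form_comb0 => k.
have [_ ZL'] := hZ' k.
have lu : (0 + i)%:R != (N + k)%:R :> C by rewrite eqr_nat neq_ltn ltn_addr// add0n.
rewrite /lax_L !wedge_e in ZL ZL'; exact: (shifted_bracket0 lu ZL ZL').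
Qed.

End LaxCommutation.

(** * Traces of powers of the Lax matrix *)

Section Pencil.
Variables (K : comNzRingType) (n : nat).
Implicit Types (Xi P E dP dE : 'M[K]_n).

(* [pencil Xi P E] is [Xi + s P + s^2 E] as a polynomial in s; up to the change
   of parameter s = i / lambda it is a multiple of the Lax matrix. *)
Definition pencil Xi P E : 'M[{poly K}]_n :=
  map_mx polyC Xi + 'X *: map_mx polyC P + 'X^2 *: map_mx polyC E.

Definition dpencil dP dE : 'M[{poly K}]_n :=
  'X *: map_mx polyC dP + 'X^2 *: map_mx polyC dE.

Lemma coef_pencil Xi P E i j d : (pencil Xi P E i j)`_d =
  Xi i j *+ (d == 0)%N + P i j *+ (d == 1)%N + E i j *+ (d == 2)%N.
Proof.
rewrite !mxE !coefD coefXM coefXnM !coefC.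
by case: d => [|[|[|d]]] /=; rewrite ?mulr0n ?mulr1n ?add0r ?addr0.
Qed.

Lemma coef_dpencil dP dE i j d : (dpencil dP dE i j)`_d =
  dP i j *+ (d == 1)%N + dE i j *+ (d == 2)%N.
Proof.
rewrite !mxE coefD coefXM coefXnM !coefC.
by case: d => [|[|[|d]]] /=; rewrite ?mulr0n ?mulr1n ?add0r ?addr0.
Qed.

Lemma size_pencil_exp Xi P E N i j : (size ((pencil Xi P E ^+ N) i j) <= (2 * N).+1)%N.
Proof.
elim: N i j => [|N IHN] i j.
  by rewrite expr0 mxE; case: (i == j); rewrite ?mulr1n ?mulr0n ?size_poly1 ?size_poly0.
rewrite exprS -mulmxE mxE; apply: (leq_trans (size_sum _ _ _)).
apply/bigmax_leqP => k _; apply: (leq_trans (size_polyMleq _ _)).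
have s3 : (size (pencil Xi P E i k) <= 3)%N.
  apply/leq_sizeP => d d3; rewrite coef_pencil.
  by case: d d3 => [|[|[|d]]]// _; rewrite /= !mulr0n !addr0.
have := IHN k j; move: s3; set a := size _; set b := size _; lia.
Qed.

Definition pencil_trace N Xi P E : {poly K} := \tr (pencil Xi P E ^+ N).

Lemma size_pencil_trace N Xi P E : (size (pencil_trace N Xi P E) <= (2 * N).+1)%N.
Proof.
apply: (leq_trans (size_sum _ _ _)); apply/bigmax_leqP => i _.
exact: size_pencil_exp.
Qed.

(** A closed formula for the derivative of a coefficient of [pencil_trace], meaningful for arbitrary
    matrices and hence polynomial in all of them. *)
Definition dtrace N j Xi P E dP dE : K :=
  (N%:R * \tr (pencil Xi P E ^+ N.-1 *m dpencil dP dE))`_j.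

End Pencil.

Section PowerDerivative.
Variables (A : comNzRingType) (n : nat) (G D : 'M[A]_n).

Fixpoint dexp N : 'M[A]_n :=
  if N is N'.+1 then D *m G ^+ N' + G *m dexp N' else 0.

(** G and D do not commute; under the trace each summand G^a D G^b can be rotated. The extra power
    G^M collects the factors peeled off in the induction. *)
Lemma trace_dexp N M : \tr (G ^+ M *m dexp N) = N%:R * \tr (G ^+ (M + N).-1 *m D).
Proof.
elim: N M => [|N IHN] M; first by rewrite mulmx0 mxtrace0 mul0r.
rewrite /= mulmxDr mxtraceD !mulmxA mxtrace_mulC mulmxA.
have -> : G ^+ M *m G = G ^+ M.+1 by rewrite exprSr.
rewrite IHN addSn addnS /= mulrS mulrDl mul1r; congr (\tr (_ *m _) + _).
by rewrite -[LHS]/(G ^+ N * G ^+ M) -exprD addnC.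
Qed.

End PowerDerivative.

Section MatrixPowers.

Lemma map_mx_exp (A B : pzRingType) (f : {rmorphism A -> B}) n (M : 'M[A]_n) N :
  map_mx f (M ^+ N) = map_mx f M ^+ N.
Proof.
elim: N => [|N IHN]; first by rewrite !expr0 [LHS]map_mx1.
by rewrite !exprS -!mulmxE map_mxM IHN.
Qed.

Lemma scale_mx_exp (A : comNzRingType) n (c : A) (M : 'M[A]_n) N :
  (c *: M) ^+ N = c ^+ N *: M ^+ N.
Proof.
elim: N => [|N IHN]; first by rewrite !expr0 scale1r.
by rewrite !exprS IHN -!mulmxE -scalemxAl -scalemxAr scalerA.
Qed.

Lemma trace_conj_exp (K : fieldType) n (g M : 'M[K]_n) N : g \in unitmx ->
  \tr ((g *m M *m invmx g) ^+ N) = \tr (M ^+ N).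
Proof.
move=> gu; have -> : (g *m M *m invmx g) ^+ N = g *m M ^+ N *m invmx g.
  elim: N => [|N IHN]; first by rewrite !expr0 mulmx1 mulmxV.
  by rewrite !exprS IHN -!mulmxE !mulmxA mulmxKV.
by rewrite mxtrace_mulC mulmxA mulVmx// mul1mx.
Qed.

Lemma fun_alg_exp_mx T (K : comNzRingType) (A : (T -> K) -> Prop) n (B : T -> 'M[K]_n) N :
  fun_alg A -> (forall i j, A (fun x => B x i j)) ->
  forall i j, A (fun x => (B x ^+ N) i j).
Proof.
move=> algA AB; elim: N => [|N IHN] i j.
  apply: fun_alg_ext (fun_alg_cst algA ((1%:M : 'M[K]_n) i j)) => x.
  by rewrite expr0.
apply: (@fun_alg_ext _ _ _ (fun x => (B x *m (B x ^+ N)) i j)) => [x|].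
  by rewrite exprS.
exact: fun_alg_mulmx.
Qed.

Lemma trace_exp_mpoly (K : fieldType) n N :
  exists F : mpoly (n * n) K, forall A, mx_eval F A = \tr (A ^+ N).
Proof.
have [F hF] : polyfun (fun A : 'M[K]_n => \tr (A ^+ N)).
  have alg := @polyfun_alg K n n; apply: (fun_alg_sum alg) => i _.
  by apply: (fun_alg_exp_mx _ alg) => a b; exact: polyfun_coord.
by exists F => A; rewrite hF.
Qed.

End MatrixPowers.

(** The value at 0 has to be avoided, since the substitution s = j / l below requires l <> 0. *)
Lemma poly_eq_natS (C : numFieldType) (p q : {poly C}) :
  (forall k : nat, p.[k.+1%:R] = q.[k.+1%:R]) -> p = q.
Proof.
move=> pq; suff : 'X * p = 'X * q by move/mulfI; apply; rewrite polyX_eq0.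
apply: poly_eq_nat => -[|k]; rewrite !hornerM hornerX ?mul0r//.
by rewrite pq.
Qed.

Section PencilReversal.
Variables (C : numFieldType) (n : nat) (j : C).
Hypothesis j2 : j ^+ 2 = -1.
Implicit Types (P E Q : 'M[C]_n).

Definition lax_mx P E Q (l : C) : 'M[C]_n := l *: P + j *: (E - l ^+ 2 *: Q).

Lemma horner_pencil_trace N Q P E s :
  (pencil_trace N Q P E).[s] = \tr ((Q + s *: P + s ^+ 2 *: E) ^+ N).
Proof.
rewrite /pencil_trace -[LHS]/(horner_eval s _) -trace_map_mx map_mx_exp.
congr (\tr (_ ^+ _)); apply/matrixP => a b; rewrite /pencil !mxE /= /horner_eval.
by rewrite !(hornerD, hornerM, hornerC, hornerX, hornerXn).
Qed.

Lemma lax_mx_pencil P E Q l : l != 0 ->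
  lax_mx P E Q l = (- j * l ^+ 2) *: (Q + (j / l) *: P + (j / l) ^+ 2 *: E).
Proof.
move=> l0; apply/matrixP => a b; rewrite !mxE expr_div_n j2.
have -> : - j * l ^+ 2 * (Q a b + j / l * P a b + -1 / l ^+ 2 * E a b) =
  - (j * l ^+ 2) * Q a b - j ^+ 2 * l * P a b + j * E a b by field.
by rewrite j2; ring.
Qed.

(** By [lax_mx_pencil], L(l) is - j l^2 times the pencil at s = j / l, so the coefficients of its
    trace are those of the pencil trace in reverse order, up to powers of j. *)
Lemma lax_trace_coef N P E Q (q : {poly C}) d : (d <= 2 * N)%N ->
  (forall l, q.[l] = \tr (lax_mx P E Q l ^+ N)) ->
  q`_(2 * N - d) = (- j) ^+ N * j ^+ d * (pencil_trace N Q P E)`_d.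
Proof.
move=> dN hq; set p := pencil_trace N Q P E.
pose r := \poly_(e < (2 * N).+1) ((- j) ^+ N * j ^+ (2 * N - e) * p`_(2 * N - e)).
have -> : q = r.
  apply: poly_eq_natS => k; set l := k.+1%:R : C.
  have l0 : l != 0 by rewrite pnatr_eq0.
  rewrite hq lax_mx_pencil// scale_mx_exp mxtraceZ -horner_pencil_trace -/p.
  rewrite (horner_coef_wide _ (size_pencil_trace _ _ _ _)) horner_poly.
  rewrite mulr_sumr (reindex_inj rev_ord_inj)/=; apply: eq_bigr => e _.
  rewrite subSS; have eN : (e <= 2 * N)%N by rewrite -ltnS.
  have -> : (- j * l ^+ 2) ^+ N = (- j) ^+ N * (l ^+ (2 * N - e) * l ^+ e).
    by rewrite exprMn -exprM -exprD subnK.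
  rewrite expr_div_n; have := expf_neq0 (2 * N - e) l0.
  by move: (l ^+ (2 * N - e)) (l ^+ e) => u v u0; field.
rewrite coef_poly ltnS leq_subr subKn//.
Qed.

End PencilReversal.

Section Family.
Variables (R : realType) (n : nat) (eta : R) (Xi : 'M[R]_n).
Implicit Types (x v : phase R n).

(** Only even powers: for skew Xi the pencil is skew and its odd powers have trace zero. The
    parameter s makes these integrals real. *)
Definition trace_integral (k j : nat) x : R :=
  (pencil_trace (2 * k) Xi (Phi eta x) (Em x))`_j.

Lemma map_pencil_trace N (P E : 'M[R]_n) :
  map_poly (real_complex R) (pencil_trace N Xi P E) =
  pencil_trace N (complexify Xi) (complexify P) (complexify E).
Proof.
rewrite /pencil_trace -trace_map_mx map_mx_exp; congr (\tr (_ ^+ _)).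
apply/matrixP => a b; rewrite /pencil !mxE !rmorphD !rmorphM/= !map_polyC map_polyX.
by [].
Qed.

Lemma trace_integral_lax k j : (j <= 4 * k)%N -> lax_invariant eta Xi (trace_integral k j).
Proof.
move=> jk; have [F hF] := trace_exp_mpoly R[i] n (2 * k).
have i2 : 'i%C ^+ 2 = -1 :> R[i] by exact: sqr_i.
have i0 : 'i%C != 0 :> R[i] by rewrite -sqrf_eq0 i2 oppr_eq0 oner_eq0.
(* The factor of [lax_trace_coef] for the power 2k; its inverse is the normalizing constant. *)
pose c : R[i] := (- 'i%C) ^+ (2 * k) * 'i%C ^+ j.
have c0 : c != 0 by rewrite mulf_neq0// expf_neq0// oppr_eq0.
exists F, (2 * (2 * k) - j)%N, c^-1; split.
- move=> g A gg _ _; rewrite !hF trace_conj_exp//.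
  by have [] := mulmx1_unit gg.
- by rewrite invr_eq0.
move=> x; have [N hN] := meval_poly_size F 3.
have [g [gs gL]] := lax_L_poly eta Xi x; have [q _ qF] := hN g gs.
have qF' z : q.[z] = mx_eval F (lax_L eta Xi z x).
  by rewrite qF; apply: meval_eq => l; rewrite gL.
exists q; split=> //.
have jk' : (j <= 2 * (2 * k))%N by rewrite mulnA.
have -> := @lax_trace_coef _ n _ i2 (2 * k) (complexify (Phi eta x))
  (complexify (wedge (e1 x) (e2 x))) (complexify Xi) q j jk'.
  by rewrite mulKf// wedge_e -map_pencil_trace coef_map.
by move=> l; rewrite qF' hF.
Qed.

Lemma polyfun_Em (i j : 'I_n) : polyfun (fun x : phase R n => Em x i j).
Proof.
have alg := @polyfun_alg R n 4.
have pe a b : polyfun (fun x : phase R n => eM x a b).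
  by apply: (fun_alg_ext _ (polyfun_coord _ _ _)) => x; rewrite mxE.
apply: (fun_alg_mulmx alg) => a b; last first.
  by apply: (fun_alg_ext _ (pe b a)) => x; rewrite [RHS]mxE.
by apply: (fun_alg_mulmx alg); [exact: pe|move=> *; exact: (fun_alg_cst alg)].
Qed.

Lemma polyfun_Phi (i j : 'I_n) : polyfun (fun x : phase R n => Phi eta x i j).
Proof.
have alg := @polyfun_alg R n 4.
have pe a b : polyfun (fun x : phase R n => eM x a b).
  by apply: (fun_alg_ext _ (polyfun_coord _ _ _)) => x; rewrite mxE.
have pp a b : polyfun (fun x : phase R n => pM x a b).
  by apply: (fun_alg_ext _ (polyfun_coord _ _ _)) => x; rewrite mxE.
have peT a b : polyfun (fun x : phase R n => (eM x)^T a b).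
  by apply: (fun_alg_ext _ (pe b a)) => x; rewrite [RHS]mxE.
have ppT a b : polyfun (fun x : phase R n => (pM x)^T a b).
  by apply: (fun_alg_ext _ (pp b a)) => x; rewrite [RHS]mxE.
pose f x := (pM x *m (eM x)^T) i j - (eM x *m (pM x)^T) i j + eta * Em x i j.
apply: (@fun_alg_ext _ _ _ f) => [x|].
  by rewrite PhiE /f; move: (_ *m _) (_ *m (pM x)^T) (Em x) => A B D; rewrite !mxE.
apply: (fun_algD alg).
  by apply: (fun_algB alg); apply: (fun_alg_mulmx alg).
by apply: (fun_algM alg); [exact: (fun_alg_cst alg)|exact: polyfun_Em].
Qed.

Lemma polynomial_Psi : polynomial_fun (@Psi R n).
Proof.
have alg := @polyfun_alg R n 4.
suff pd (a b : 'I_4) : polyfun (fun x : phase R n => dot (col a x) (col b x)).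
  by apply: (fun_algB alg); exact: pd.
apply: (fun_alg_sum alg) => i _; apply: (fun_algM alg).
  by apply: (fun_alg_ext _ (polyfun_coord _ i a)) => x; rewrite mxE.
by apply: (fun_alg_ext _ (polyfun_coord _ i b)) => x; rewrite mxE.
Qed.

Lemma polynomial_lax f : lax_invariant eta Xi f -> polynomial_fun f.
Proof.
move=> /(lax_sum 0)[F [N [w [_ hf]]]]; apply/polyfunC_real.
have alg := @polyfunC_alg R n 4.
apply: (@fun_alg_ext _ _ _ (fun x => \sum_i w i * mx_eval F (lax_L eta Xi (0 + i)%:R x))).
  by move=> x; rewrite hf.
apply: (fun_alg_sum alg) => l _; apply: (fun_algM alg); first exact: (fun_alg_cst alg).
apply: fun_alg_meval => // k; case/mxvec_indexP: k => i j.
pose z : R[i] := (0 + l)%:R.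
pose h x := z * real_complex R (Phi eta x i j) +
  'i%C * (real_complex R (Em x i j) - z ^+ 2 * real_complex R (Xi i j)).
apply: (@fun_alg_ext _ _ _ h) => [x|].
  rewrite mxvecE /h /lax_L wedge_e /complexify -/z.
  by move: (Phi eta x) (Em x) => P E; rewrite !mxE.
apply: (fun_algD alg); apply: (fun_algM alg); try exact: (fun_alg_cst alg).
  by apply/polyfunC_real; exact: polyfun_Phi.
apply: (fun_algB alg); last exact: (fun_alg_cst alg).
by apply/polyfunC_real; exact: polyfun_Em.
Qed.

End Family.

Section PolynomialJets.
Variables (R : realType) (V : normedModType R) (x v : V).

Definition pjet_mx m n (G : V -> 'M[{poly R}]_(m, n)) (D : 'M[{poly R}]_(m, n)) :=
  forall i j d, jet (fun y => (G y i j)`_d) x v ((D i j)`_d).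

Lemma pjet_mulmx m n p (G : V -> 'M[{poly R}]_(m, n)) (H : V -> 'M[{poly R}]_(n, p)) D D' :
  pjet_mx G D -> pjet_mx H D' ->
  pjet_mx (fun y => G y *m H y) (D *m H x + G x *m D').
Proof.
move=> jG jH i j d; rewrite !mxE -big_split/= coef_sum.
apply: jet_ext; last first.
  apply: jet_sum => k _; rewrite coefD !coefM -big_split/=; apply: jet_sum => l _.
  exact: jetM (jG i k l) (jH k j (d - l)%N).
by move=> y; rewrite mxE coef_sum; apply: eq_bigr => k _; rewrite coefM.
Qed.

Lemma pjet_exp n (G : V -> 'M[{poly R}]_n) D N :
  pjet_mx G D -> pjet_mx (fun y => G y ^+ N) (dexp (G x) D N).
Proof.
move=> jG; elim: N => [|N IHN].
  move=> i j d; have -> : (dexp (G x) D 0 i j)`_d = 0 by rewrite mxE coef0.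
  have := jet_cst ((1%:M : 'M[{poly R}]_n) i j)`_d x v.
  by apply: jet_ext => y; rewrite expr0.
move=> i j d; have := pjet_mulmx jG IHN i j d.
by apply: jet_ext => y; rewrite exprS.
Qed.

End PolynomialJets.

Section FormalDerivative.
Variables (R : realType) (n : nat) (eta : R) (Xi : 'M[R]_n).
Implicit Types (x v : phase R n).

Lemma jet_trace_integral k j x v : jet (trace_integral eta Xi k j) x v
  (dtrace (2 * k) j Xi (Phi eta x) (Em x) (dPhi eta x v) (dEm x v)).
Proof.
have jG : pjet_mx x v (fun y => pencil Xi (Phi eta y) (Em y))
    (dpencil (dPhi eta x v) (dEm x v)).
  move=> a b d; rewrite coef_dpencil.
  apply: jet_ext (jet_eq _ (jetD (jetD (jet_cst (Xi a b *+ (d == 0)%N) x v)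
    (jetZ (d == 1)%N%:R (rjet_Phi eta x v a b))) (jetZ (d == 2)%N%:R (rjet_Em x v a b)))).
    by move=> y; rewrite coef_pencil !mulr_natl.
  by rewrite add0r !mulr_natl.
have := @trace_dexp _ _ (pencil Xi (Phi eta x) (Em x))
  (dpencil (dPhi eta x v) (dEm x v)) (2 * k) 0.
rewrite expr0 mul1mx add0n /dtrace => <-.
apply: jet_ext; last first.
  by rewrite /mxtrace coef_sum; apply: jet_sum => i _; exact: (pjet_exp _ jG).
by move=> y; rewrite /trace_integral /pencil_trace /mxtrace coef_sum.
Qed.

End FormalDerivative.

(** * The Gram determinant *)

Section Directions.
Variables (K : fieldType) (n : nat).
Implicit Types (P E Xi : 'M[K]_n).

Definition so_unit i j : 'M[K]_n := delta_mx i j - delta_mx j i.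

Lemma so_unit_so i j : in_so (so_unit i j).
Proof. by rewrite /in_so /so_unit trmxB !trmx_delta opprB. Qed.

(* Infinitesimal rotations, vertical shifts, and the vertical vector along E. *)
Definition direction := ('I_n * 'I_n + 'I_n * 'I_n + unit)%type.

Definition dirP P E (c : direction) : 'M[K]_n :=
  match c with
  | inl (inl ij) => commutator (so_unit ij.1 ij.2) P
  | inl (inr ij) => commutator (so_unit ij.1 ij.2) E
  | inr _ => E
  end.

Definition dirE E (c : direction) : 'M[K]_n :=
  if c is inl (inl ij) then commutator (so_unit ij.1 ij.2) E else 0.

Variables (p : nat) (kap : 'I_p -> nat * nat).

Definition jac Xi P E (a : 'I_p) (c : direction) : K :=
  dtrace (2 * (kap a).1) (kap a).2 Xi P E (dirP P E c) (dirE E c).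

Definition gram Xi P E : 'M[K]_p :=
  \matrix_(a, b) \sum_c jac Xi P E a c * jac Xi P E b c.

Definition jac_kernel Xi P E (w : 'I_p -> K) : Prop :=
  forall c, \sum_a w a * jac Xi P E a c = 0.

(** Applied with Xi as variable it yields the genericity condition, with the phase point as variable
    the density argument. *)
Lemma fun_alg_gram T (A : (T -> K) -> Prop) (fXi fP fE : T -> 'M[K]_n) :
  fun_alg A -> (forall i j, A (fun x => fXi x i j)) ->
  (forall i j, A (fun x => fP x i j)) -> (forall i j, A (fun x => fE x i j)) ->
  A (fun x => \det (gram (fXi x) (fP x) (fE x))).
Proof.
move=> alg AX AP AE.
have A0 : A (fun=> 0) by exact: fun_alg_cst.
have Acomm (S : 'M[K]_n) (F : T -> 'M[K]_n) : (forall i j, A (fun x => F x i j)) ->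
    forall i j, A (fun x => commutator S (F x) i j).
  move=> AF i j; pose h x := (S *m F x) i j - (F x *m S) i j.
  apply: (@fun_alg_ext _ _ _ h) => [x|]; first by rewrite /h /commutator !mxE.
  by apply: (fun_algB alg); apply: (fun_alg_mulmx alg) => // *; exact: fun_alg_cst.
have AdP c i j : A (fun x => dirP (fP x) (fE x) c i j).
  by case: c => [[[a b]|[a b]]|[]] /=; [exact: Acomm|exact: Acomm|exact: AE].
have AdE c i j : A (fun x => dirE (fE x) c i j).
  case: c => [[[a b]|[a b]]|[]] /=; first exact: Acomm.
    by apply: fun_alg_ext A0 => x; rewrite mxE.
  by apply: fun_alg_ext A0 => x; rewrite mxE.
have Amuln (f : T -> K) m : A f -> A (fun x => f x *+ m).
  move=> Af; apply: (@fun_alg_ext _ _ _ (fun x => f x * m%:R)) => [x|].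
    by rewrite mulr_natr.
  by apply: (fun_algM alg) => //; exact: fun_alg_cst.
have Ajac a c : A (fun x => jac (fXi x) (fP x) (fE x) a c).
  rewrite /jac /dtrace; apply: (fun_alg_coefM alg).
    by move=> d; exact: fun_alg_cst.
  apply: (fun_alg_coef_tr alg); apply: (fun_alg_coef_mulmx alg).
    apply: (fun_alg_coef_exp alg) => i j d.
    apply: (@fun_alg_ext _ _ _ (fun x => fXi x i j *+ (d == 0)%N + fP x i j *+ (d == 1)%N
      + fE x i j *+ (d == 2)%N)) => [x|]; first by rewrite coef_pencil.
    by apply: (fun_algD alg); [apply: (fun_algD alg)|]; exact: Amuln.
  move=> i j d; apply: (@fun_alg_ext _ _ _ (fun x => dirP (fP x) (fE x) c i j *+ (d == 1)%N
      + dirE (fE x) c i j *+ (d == 2)%N)) => [x|]; first by rewrite coef_dpencil.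
  by apply: (fun_algD alg); exact: Amuln.
apply: (fun_alg_det alg) => a b.
apply: (@fun_alg_ext _ _ _ (fun x => \sum_c jac (fXi x) (fP x) (fE x) a c *
  jac (fXi x) (fP x) (fE x) b c)) => [x|]; first by rewrite [RHS]mxE.
by apply: (fun_alg_sum alg) => c _; exact: (fun_algM alg).
Qed.

Lemma jac_kernel_det Xi P E w : jac_kernel Xi P E w -> \det (gram Xi P E) != 0 ->
  forall a, w a = 0.
Proof.
move=> hw dn a; have gu : gram Xi P E \in unitmx by rewrite unitmxE unitfE.
pose r : 'rV[K]_p := \row_b w b.
have r0 : r *m gram Xi P E = 0.
  apply/rowP => b; rewrite !mxE.
  under eq_bigr do rewrite !mxE mulr_sumr; rewrite exchange_big big1//= => c _.
  under eq_bigr do rewrite mulrA.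
  by rewrite -mulr_suml hw mul0r.
have : r = 0 by rewrite -[r](mulmxK gu) r0 mul0mx.
by move/rowP/(_ a); rewrite !mxE.
Qed.

End Directions.

(** For r in the kernel of the Gram matrix, r G r^T is a sum of squares, so over an ordered field
    each square vanishes. The converse [jac_kernel_det] is plain linear algebra. *)
Lemma det_jac_kernel (K : realFieldType) n p (kap : 'I_p -> nat * nat) (Xi P E : 'M[K]_n) :
  (forall w, jac_kernel kap Xi P E w -> forall a, w a = 0) ->
  \det (gram kap Xi P E) != 0.
Proof.
move=> h; apply/negP => /det0P[r /negP r0 rG]; apply: r0; apply/eqP.
suff hr : jac_kernel kap Xi P E (fun a => r 0 a).
  by apply/rowP => a; rewrite mxE; exact: h hr a.
pose f c := \sum_a r 0 a * jac kap Xi P E a c.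
suff s0 : \sum_c f c ^+ 2 = 0.
  move=> c; apply/eqP; rewrite -sqrf_eq0; move/eqP: s0.
  rewrite psumr_eq0 => [/allP/(_ c (mem_index_enum _))//|c' _].
  exact: sqr_ge0.
have <- : (r *m gram kap Xi P E *m r^T) 0 0 = \sum_c f c ^+ 2.
  rewrite mxE; under eq_bigr => a _.
    rewrite [(r *m _) _ _]mxE [r^T _ _]mxE mulr_suml.
    under eq_bigr do rewrite mxE mulr_sumr mulr_suml.
    over.
  rewrite /= exchange_big/=.
  under eq_bigr do rewrite exchange_big.
  rewrite /= exchange_big/=; apply: eq_bigr => c _.
  rewrite expr2 /f mulr_suml; apply: eq_bigr => a _.
  by rewrite mulr_sumr; apply: eq_bigr => b _; ring.
by rewrite rG mul0mx mxE.
Qed.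

Section Independence.
Variables (R : realType) (n : nat) (eta : R).
Implicit Types (x v : phase R n) (Xi P E : 'M[R]_n).

(** The factor 1/2 in the last case makes the variation of Phi equal to E: both p e^T and - e p^T
    produce a copy of e J e^T. *)
Definition dir_field x (c : direction n) : phase R n :=
  match c with
  | inl (inl ij) => rot_field x (so_unit R ij.1 ij.2)
  | inl (inr ij) => shift_field x (so_unit R ij.1 ij.2)
  | inr _ => mk_phase 0 (2^-1 *: (eM x *m J2 R))
  end.

Lemma dir_field_tangent x c : cotangent_stiefel x -> tangent x (dir_field x c).
Proof.
move=> cx; case: c => [[[i j]|[i j]]|[]] /=.
- exact/rot_field_tangent/so_unit_so.
- exact: shift_field_tangent.
have /cotangentE[ee _] := cx; apply/tangentE; rewrite eM_mk pM_mk trmx0.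
rewrite !mulmx0 !mul0mx !addr0 add0r; split=> //.
rewrite trmxZ trmx_mul -scalemxAl -scalemxAr mulmxA ee mul1mx -mulmxA ee mulmx1.
by rewrite trJ2 scalerN subrr.
Qed.

Lemma dir_fieldP x c : dPhi eta x (dir_field x c) = dirP (Phi eta x) (Em x) c.
Proof.
case: c => [[[i j]|[i j]]|[]] /=.
- exact/dPhi_rot/so_unit_so.
- exact/dPhi_shift/so_unit_so.
rewrite /dPhi /dEm eM_mk pM_mk trmx0 !mulmx0 !mul0mx !addr0 scaler0 addr0 subr0.
rewrite trmxZ trmx_mul trJ2 -scalemxAl -scalemxAr mulNmx mulmxN scalerN opprK mulmxA.
by rewrite -scalerDl (_ : 2^-1 + 2^-1 = 1) ?scale1r//; lra.
Qed.

Lemma dir_fieldE x c : dEm x (dir_field x c) = dirE (Em x) c.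
Proof.
case: c => [[[i j]|[i j]]|[]] /=.
- exact/dEm_rot/so_unit_so.
- exact: dEm_shift.
by rewrite /dEm eM_mk trmx0 mulmx0 !mul0mx addr0.
Qed.

Lemma gram_independent p (kap : 'I_p -> nat * nat) Xi x : cotangent_stiefel x ->
  \det (gram kap Xi (Phi eta x) (Em x)) != 0 ->
  independent_at (fun a => trace_integral eta Xi (kap a).1 (kap a).2) x.
Proof.
move=> cx dn w hw; apply: jac_kernel_det dn => c.
rewrite -[RHS](hw _ (dir_field_tangent c cx)); apply: eq_bigr => a _.
rewrite (jet_trace_integral eta Xi _ _ x _).2.
by rewrite dir_fieldP dir_fieldE.
Qed.

End Independence.

Section Scaling.
Variables (K : fieldType) (n : nat).
Implicit Types (P E Xi : 'M[K]_n).

Lemma coef_comp_scale (p : {poly K}) c d : (p \Po (c *: 'X))`_d = c ^+ d * p`_d.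
Proof.
rewrite comp_polyE coef_sum.
under eq_bigr do rewrite exprZn !coefZ coefXn.
have [dp|pd] := ltnP d (size p).
  rewrite (bigD1 (Ordinal dp))//= eqxx mulr1 big1 ?addr0 1?mulrC// => i id.
  by rewrite eq_sym (negbTE (_ : (i : nat) != d)) ?mulr0//.
rewrite nth_default// mulr0 big1// => i _.
by rewrite [d == _]gtn_eqF ?mulr0// (leq_trans (ltn_ord i)).
Qed.

(** The dilation (c P, c^2 E) is the substitution s |-> c s in the pencil. The scalar b accounts for
    the direction: it is 1 for rotations and c for vertical directions. *)
Lemma dtrace_scale N j Xi P E dP dE c b :
  dtrace N j Xi (c *: P) (c ^+ 2 *: E) ((b * c) *: dP) ((b * c ^+ 2) *: dE) =
  b * c ^+ j * dtrace N j Xi P E dP dE.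
Proof.
pose f := comp_poly (c *: 'X) : {poly K} -> {poly K}.
have hG : pencil Xi (c *: P) (c ^+ 2 *: E) = map_mx f (pencil Xi P E).
  apply/matrixP => i k; apply/polyP => d; rewrite [in RHS]mxE coef_comp_scale !coef_pencil !mxE.
  by case: d => [|[|[|d]]] /=; rewrite ?mulr0n ?mulr1n ?add0r ?addr0 ?mulr0 ?mul1r.
have hD : dpencil ((b * c) *: dP) ((b * c ^+ 2) *: dE) = b%:P *: map_mx f (dpencil dP dE).
  apply/matrixP => i k; apply/polyP => d.
  rewrite [in RHS]mxE coefCM [in RHS]mxE coef_comp_scale !coef_dpencil !mxE.
  by case: d => [|[|[|d]]] /=; rewrite ?mulr0n ?mulr1n ?add0r ?addr0 ?mulr0 ?mulrA.
rewrite /dtrace hG hD -map_mx_exp -scalemxAr mxtraceZ -map_mxM trace_map_mx.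
rewrite mulrCA coefCM -mulrA; congr (_ * _).
by rewrite -coef_comp_scale comp_polyM rmorph_nat.
Qed.

Lemma jac_kernel_scale p (kap : 'I_p -> nat * nat) Xi P E c w : c != 0 ->
  jac_kernel kap Xi (c *: P) (c ^+ 2 *: E) w ->
  jac_kernel kap Xi P E (fun a => w a * c ^+ (kap a).2).
Proof.
move=> c0 h dr; pose b (d : direction n) := if d is inl (inl _) then 1 else c.
have b0 : b dr != 0 by rewrite /b; case: dr => [[]|]; rewrite ?oner_eq0.
have jE a : jac kap Xi (c *: P) (c ^+ 2 *: E) a dr =
    b dr * c ^+ (kap a).2 * jac kap Xi P E a dr.
  have eP : dirP (c *: P) (c ^+ 2 *: E) dr = (b dr * c) *: dirP P E dr.
    by case: dr {b0} => [[ij|ij]|u]; rewrite /= ?commutatorZr ?mul1r.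
  have eE : dirE (c ^+ 2 *: E) dr = (b dr * c ^+ 2) *: dirE E dr.
    by case: dr {b0 eP} => [[ij|ij]|u]; rewrite /= ?commutatorZr ?mul1r ?scaler0.
  by rewrite /jac eP eE dtrace_scale.
apply: (mulfI b0); rewrite mulr0 -[RHS](h dr) mulr_sumr; apply: eq_bigr => a _.
by rewrite jE; ring.
Qed.

End Scaling.

(** * Density *)

Section Retraction.
Variables (R : realType) (n : nat) (eta : R).
Implicit Types (x z : phase R n) (A B : 'M[R]_2).
Local Notation J := (J2 R).

(** With y = p + (eta / 2) e J one has Phi = y e^T - e y^T. The map sends y to c y B, then subtracts
    the twist of the new frame e A; when A B^T = 1 this multiplies y e^T by c. *)
Definition retr_u z A B (c : R) : 'M[R]_(n, 2) :=
  c *: ((pM z + (eta / 2) *: (eM z *m J)) *m B) - (eta / 2) *: (eM z *m A *m J).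

Definition retr_S z A B c : 'M[R]_2 := - 2^-1 *:
  ((eM z *m A)^T *m retr_u z A B c + (retr_u z A B c)^T *m (eM z *m A)).

(* Right multiplication of the frame by A and of the momenta (in the gauge where
   eta = 0) by c A^{-T}, followed by a correction that does not change Phi. *)
Definition retr z A B c : phase R n :=
  mk_phase (eM z *m A) (retr_u z A B c + eM z *m A *m retr_S z A B c).

Lemma retr_S_sym z A B c : (retr_S z A B c)^T = retr_S z A B c.
Proof.
rewrite /retr_S trmxZ; congr (_ *: _); rewrite trmxD !trmx_mulT; exact: addrC.
Qed.

Lemma retr_cotangent z A B c : A^T *m ((eM z)^T *m eM z) *m A = 1%:M ->
  cotangent_stiefel (retr z A B c).
Proof.
move=> AGA; have ee : (eM z *m A)^T *m (eM z *m A) = 1%:M.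
  by rewrite trmx_mul -AGA !mulmxA.
apply/cotangentE; rewrite eM_mk pM_mk; split=> //.
rewrite mulmxDr trmxD mulmxDl [(_ *m retr_S _ _ _ _)^T]trmx_mul retr_S_sym.
rewrite [(eM z *m A)^T *m (_ *m retr_S _ _ _ _)]mulmxA ee mul1mx.
rewrite -[retr_S _ _ _ _ *m _ *m _]mulmxA ee mulmx1 addrACA.
have -> : retr_S z A B c + retr_S z A B c =
    - ((eM z *m A)^T *m retr_u z A B c + (retr_u z A B c)^T *m (eM z *m A)).
  by rewrite /retr_S -scalerDl -opprD (_ : 2^-1 + 2^-1 = 1) ?scaleN1r//; lra.
by rewrite subrr.
Qed.

Lemma Em_retr z A B c : A *m J *m A^T = c ^+ 2 *: J ->
  Em (retr z A B c) = c ^+ 2 *: Em z.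
Proof.
move=> AJ; rewrite /Em eM_mk trmx_mul !mulmxA.
have -> : eM z *m A *m J *m A^T = c ^+ 2 *: (eM z *m J).
  by rewrite -!mulmxA [A *m _]mulmxA AJ scalemxAr.
by rewrite -scalemxAl.
Qed.

Lemma Phi_retr z A B c : A *m J *m A^T = c ^+ 2 *: J -> A *m B^T = 1%:M ->
  Phi eta (retr z A B c) = c *: Phi eta z.
Proof.
move=> AJ AB; rewrite !PhiE (Em_retr _ _ AJ) eM_mk pM_mk.
have BA : B *m A^T = 1%:M by rewrite -[LHS]trmxK trmx_mul trmxK AB trmx1.
rewrite mulmxDl trmxD [(_ *m retr_S _ _ _ _)^T]trmx_mul retr_S_sym mulmxDr.
rewrite [eM z *m A *m (retr_S _ _ _ _ *m _)]mulmxA opprD addrACA subrr addr0.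
set y := pM z + (eta / 2) *: (eM z *m J).
have uE : retr_u z A B c *m (eM z *m A)^T =
    c *: (y *m (eM z)^T) - (eta / 2) *: (c ^+ 2 *: Em z).
  rewrite /retr_u -/y mulmxBl -!scalemxAl trmx_mul; congr (_ - _).
    by rewrite !mulmxA -[y *m B *m _]mulmxA BA mulmx1.
  by rewrite -(Em_retr z B AJ) /Em eM_mk trmx_mul.
have Eu : eM z *m A *m (retr_u z A B c)^T =
    c *: (eM z *m y^T) + (eta / 2) *: (c ^+ 2 *: Em z).
  have := congr1 trmx uE; rewrite trmx_mul trmxK => ->.
  by rewrite trmxB !trmxZ trmx_mul trmxK (Em_so z : _^T = _) !scalerN opprK.
rewrite uE Eu /y trmxD trmxZ trmx_mul trJ2 mulmxDl mulmxDr.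
rewrite -!scalemxAl -!scalemxAr mulNmx mulmxN !mulmxA -/(Em z).
by apply/matrixP => i j; rewrite /Em ![_ i j]mxE; field.
Qed.

End Retraction.

(** * Orthonormalization of two vectors *)

Section GramSchmidt.
Variable R : realType.
Implicit Types G : 'M[R]_2.

Definition mx2 (a b c d : R) : 'M[R]_2 :=
  \matrix_(i, j) (if i == 0 then if j == 0 then a else b else if j == 0 then c else d).

Lemma mx2P (M N : 'M[R]_2) :
  M 0 0 = N 0 0 -> M 0 1 = N 0 1 -> M 1 0 = N 1 0 -> M 1 1 = N 1 1 -> M = N.
Proof. by move=> *; apply/matrixP; apply: ord2P; apply: ord2P. Qed.

(** Here G is the Gram matrix of the frame and [gs_h] the squared distance of the second vector to
    the line of the first. [gs_A] is the triangular change of basis, [gs_B] its inverse transpose.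
    Since A J A^T = (det A) J for 2 x 2 matrices, [gs_c] is the square root of the determinant of
    [gs_A]. *)
Definition gs_h G : R := G 1 1 - G 0 1 ^+ 2 / G 0 0.
Definition gs_A G : 'M[R]_2 :=
  mx2 (Num.sqrt (G 0 0))^-1 (- (G 0 1 / G 0 0) * (Num.sqrt (gs_h G))^-1)
      0 (Num.sqrt (gs_h G))^-1.
Definition gs_B G : 'M[R]_2 :=
  mx2 (Num.sqrt (G 0 0)) 0 (G 0 1 / G 0 0 * Num.sqrt (G 0 0)) (Num.sqrt (gs_h G)).
Definition gs_c G : R := Num.sqrt ((Num.sqrt (G 0 0))^-1 * (Num.sqrt (gs_h G))^-1).

Variable G : 'M[R]_2.
Hypotheses (Gsym : G 1 0 = G 0 1) (g0 : 0 < G 0 0) (h0 : 0 < gs_h G).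

Let s := Num.sqrt (G 0 0).
Let t := Num.sqrt (gs_h G).
Let s0 : s != 0. Proof. by rewrite gt_eqF// sqrtr_gt0. Qed.
Let t0 : t != 0. Proof. by rewrite gt_eqF// sqrtr_gt0. Qed.
Let s2 : G 0 0 = s ^+ 2. Proof. by rewrite sqr_sqrtr// ltW. Qed.
Let t2 : G 1 1 = t ^+ 2 + G 0 1 ^+ 2 / s ^+ 2.
Proof. by rewrite sqr_sqrtr ?ltW// /gs_h -s2 subrK. Qed.

Lemma gs_AGA : (gs_A G)^T *m G *m gs_A G = 1%:M.
Proof.
rewrite /gs_A -/s -/t s2; apply: mx2P; rewrite !(mxE, sum_ord2) /= ?Gsym s2 t2;
  by field; rewrite ?s0 ?t0.
Qed.

Lemma gs_AB : gs_A G *m (gs_B G)^T = 1%:M.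
Proof.
rewrite /gs_A /gs_B -/s -/t s2; apply: mx2P; rewrite !(mxE, sum_ord2) /=;
  by field; rewrite ?s0 ?t0.
Qed.

Lemma gs_AJ : gs_A G *m J2 R *m (gs_A G)^T = gs_c G ^+ 2 *: J2 R.
Proof.
rewrite /gs_c sqr_sqrtr; last by rewrite mulr_ge0// invr_ge0 sqrtr_ge0.
rewrite /gs_A -/s -/t s2; apply: mx2P; rewrite !(mxE, sum_ord2) /=;
  by field; rewrite ?s0 ?t0.
Qed.

Lemma gs_c_neq0 : gs_c G != 0.
Proof. by rewrite gt_eqF// sqrtr_gt0 mulr_gt0// invr_gt0 sqrtr_gt0. Qed.

End GramSchmidt.

Section Continuity.
Variables (R : realType) (T : topologicalType).

Definition cts_at (x : T) (f : T -> R) : Prop := f y @[y --> x] --> f x.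

Lemma cts_at_alg x : fun_alg (cts_at x).
Proof.
split=> [c|f g cf cg|f g cf cg]; first exact: cvg_cst.
  exact: cvgD.
exact: cvgM.
Qed.

Lemma cts_atV x f : f x != 0 -> cts_at x f -> cts_at x (fun y => (f y)^-1).
Proof. by move=> f0 cf; exact: cvgV. Qed.

Lemma cts_at_sqrt x f : cts_at x f -> cts_at x (fun y => Num.sqrt (f y)).
Proof.
move=> cf; apply: (@cvg_comp _ _ _ f Num.sqrt _ (nbhs (f x))) => //.
exact: sqrt_continuous.
Qed.

Lemma cts_at_mx m n x (M : T -> 'M[R]_(m, n)) :
  (forall i j, cts_at x (fun y => M y i j)) -> M y @[y --> x] --> M x.
Proof.
move=> cM; apply/cvgrPdist_le => /= e e0; near=> y.
rewrite /Num.Def.normr/= mx_normrE (bigmax_le _ (ltW e0))//= => i _.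
rewrite !mxE/=.
move: i; near: y; apply: filter_forall => /= i.
exact: ((cvgrPdist_le _ _).1 (cM i.1 i.2)).
Unshelve. all: by end_near. Qed.

End Continuity.

Section PolynomialLines.
Variables (R : realType) (n p : nat).

Lemma polyfun_cts (f : 'M[R]_(n, p) -> R) : polyfun f -> continuous f.
Proof.
move=> [P hP] x; rewrite (funext hP).
have : cts_at x (fun y : 'M[R]_(n, p) => meval (fun k => mxvec y 0 k) P); last exact.
apply: fun_alg_meval => [|k]; first exact: cts_at_alg.
case/mxvec_indexP: k => i j.
apply: (@fun_alg_ext _ _ (@cts_at R 'M[R]_(n, p) x) (fun y : 'M[R]_(n, p) => y i j)) => [y|].
  by rewrite mxvecE.
exact: coord_continuous.
Qed.

Lemma polyfun_line (f : 'M[R]_(n, p) -> R) x y : polyfun f ->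
  exists q : {poly R}, forall s, f (x + s *: y) = q.[s].
Proof.
move=> [P hP].
pose A (h : R -> R) := exists q : {poly R}, forall s, h s = q.[s].
have algA : fun_alg A.
  split=> [c|f1 f2 [q1 h1] [q2 h2]|f1 f2 [q1 h1] [q2 h2]].
  - by exists c%:P => s; rewrite hornerC.
  - by exists (q1 + q2) => s; rewrite hornerD h1 h2.
  - by exists (q1 * q2) => s; rewrite hornerM h1 h2.
have [|q hq] := @fun_alg_meval _ _ A _ (fun s k => mxvec (x + s *: y) 0 k) P algA.
  move=> k; case/mxvec_indexP: k => i j.
  exists ((x i j)%:P + y i j *: 'X) => s.
  by rewrite mxvecE !mxE !(hornerD, hornerZ, hornerC, hornerX) mulrC.
by exists q => s; rewrite hP -hq.
Qed.

(** The points e / (k + 2) are distinct, lie strictly below e, and are more numerous than the roots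
    of q. *)
Lemma poly_nonroot_near (q : {poly R}) (e : R) : q != 0 -> 0 < e ->
  exists2 s, 0 < s < e & q.[s] != 0.
Proof.
move=> q0 e0; apply: contrapT => h; move/negP: q0; apply; apply/eqP.
apply: (@roots_geq_poly_eq0 _ _ [seq e / k.+2%:R | k <- iota 0 (size q)]).
- apply/allP => _ /mapP[k _ ->]; apply/negPn/negP => nr; apply: h.
  exists (e / k.+2%:R) => //; rewrite divr_gt0//= ltr_pdivrMr//.
  by rewrite ltr_pMr// ltr1n.
- rewrite map_inj_uniq ?iota_uniq// => k l /(mulfI (lt0r_neq0 e0)).
  by move=> /invr_inj/eqP; rewrite eqr_nat => /eqP[].
- by rewrite size_map size_iota.
Qed.

End PolynomialLines.

Section Density.
Variables (R : realType) (n : nat) (eta : R) (Xi : 'M[R]_n).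
Variables (p : nat) (kap : 'I_p -> nat * nat).
Implicit Types (x z : phase R n).

Definition gram_det x : R := \det (gram kap Xi (Phi eta x) (Em x)).

Lemma polyfun_gram_det : polyfun gram_det.
Proof.
apply: (fun_alg_gram kap (@polyfun_alg R n 4)) => [i j|i j|i j].
- exact: (fun_alg_cst (@polyfun_alg R n 4)).
- exact: polyfun_Phi.
- exact: polyfun_Em.
Qed.

Lemma gram_det_retr z A B c : A *m J2 R *m A^T = c ^+ 2 *: J2 R -> A *m B^T = 1%:M ->
  c != 0 -> gram_det z != 0 -> gram_det (retr eta z A B c) != 0.
Proof.
move=> AJ AB c0 dz; rewrite /gram_det (Em_retr _ _ _ AJ) (Phi_retr _ _ AJ AB).
apply: det_jac_kernel => w hw a; have := jac_kernel_det (jac_kernel_scale c0 hw) dz a.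
by move=> /eqP; rewrite mulf_eq0 expf_eq0 (negbTE c0) andbF orbF => /eqP.
Qed.

Definition gs_retr z : phase R n :=
  let G := (eM z)^T *m eM z in retr eta z (gs_A G) (gs_B G) (gs_c G).

Lemma gs_retr_id x : cotangent_stiefel x -> gs_retr x = x.
Proof.
move=> /cotangentE[ee ep]; rewrite /gs_retr ee.
have h1 : gs_h (1%:M : 'M[R]_2) = 1 by rewrite /gs_h !mxE /= expr0n mul0r subr0.
have A1 : gs_A (1%:M : 'M[R]_2) = 1%:M.
  by apply: mx2P; rewrite /gs_A h1 !mxE /= ?mul0r ?oppr0 ?mul0r ?sqrtr1 ?invr1.
have B1 : gs_B (1%:M : 'M[R]_2) = 1%:M.
  by apply: mx2P; rewrite /gs_B h1 !mxE /= ?sqrtr1 ?mul0r.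
have c1 : gs_c (1%:M : 'M[R]_2) = 1 by rewrite /gs_c h1 !mxE /= !sqrtr1 invr1 mulr1 sqrtr1.
rewrite A1 B1 c1 /retr.
have uE : retr_u eta x 1%:M 1%:M 1 = pM x.
  by rewrite /retr_u scale1r !mulmx1 addrK.
have SE : retr_S eta x 1%:M 1%:M 1 = 0.
  by rewrite /retr_S uE mulmx1 ep scaler0.
by rewrite uE SE !mulmx1 mulmx0 addr0 mk_phaseK.
Qed.

Lemma cts_frame_gram (T : topologicalType) (t : T) (f : T -> phase R n) :
  (forall i j, cts_at t (fun s => f s i j)) ->
  forall i j, cts_at t (fun s => ((eM (f s))^T *m eM (f s)) i j).
Proof.
move=> cf.
have ce i j : cts_at t (fun s => eM (f s) i j).
  by apply: (@fun_alg_ext _ _ (cts_at t) (fun s => f s i (lshift 2 j))) => // s; rewrite mxE.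
apply: (fun_alg_mulmx (@cts_at_alg R T t)) => // i j.
by apply: (@fun_alg_ext _ _ (cts_at t) (fun s => eM (f s) j i)) => // s; rewrite [RHS]mxE.
Qed.

Lemma cts_gs_h (T : topologicalType) (t : T) (G : T -> 'M[R]_2) :
  (forall i j, cts_at t (fun s => G s i j)) -> G t = 1%:M ->
  cts_at t (fun s => gs_h (G s)).
Proof.
move=> cG Gt; have alg := @cts_at_alg R T t.
apply: (fun_algB alg) => //; apply: (fun_algM alg); last first.
  by apply: cts_atV => //; rewrite Gt mxE oner_eq0.
apply: (@fun_alg_ext _ _ (cts_at t) (fun s => G s 0 1 * G s 0 1)) => [s|].
  by rewrite expr2.
exact: (fun_algM alg).
Qed.

Lemma gs_h1 : gs_h (1%:M : 'M[R]_2) = 1.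
Proof. by rewrite /gs_h !mxE /= expr0n mul0r subr0. Qed.

(** At a point of the bundle the Gram matrix is 1, so every quantity inverted on the way is 1 there
    and the algebra of continuous functions applies. *)
Lemma cts_gs_retr (T : topologicalType) (t : T) (f : T -> phase R n) :
  (forall i j, cts_at t (fun s => f s i j)) -> cotangent_stiefel (f t) ->
  gs_retr (f s) @[s --> t] --> gs_retr (f t).
Proof.
move=> cf /cotangentE[ee _].
have alg := @cts_at_alg R T t; have cst c := fun_alg_cst alg c.
have ce i j : cts_at t (fun s => eM (f s) i j).
  by apply: (@fun_alg_ext _ _ (cts_at t) (fun s => f s i (lshift 2 j))) => // s; rewrite mxE.
have cp i j : cts_at t (fun s => pM (f s) i j).
  by apply: (@fun_alg_ext _ _ (cts_at t) (fun s => f s i (rshift 2 j))) => // s; rewrite mxE.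
have ctr m q (M : T -> 'M[R]_(m, q)) : (forall i j, cts_at t (fun s => M s i j)) ->
    forall i j, cts_at t (fun s => (M s)^T i j).
  move=> cM i j; apply: (@fun_alg_ext _ _ (cts_at t) (fun s => M s j i)) => // s.
  by rewrite [RHS]mxE.
have cD m q (M N : T -> 'M[R]_(m, q)) : (forall i j, cts_at t (fun s => M s i j)) ->
    (forall i j, cts_at t (fun s => N s i j)) ->
    forall i j, cts_at t (fun s => (M s + N s) i j).
  move=> cM cN i j; apply: (@fun_alg_ext _ _ (cts_at t) (fun s => M s i j + N s i j)) => [s|].
    by rewrite [RHS]mxE.
  exact: (fun_algD alg).
have cZ m q (a : T -> R) (M : T -> 'M[R]_(m, q)) : cts_at t a ->
    (forall i j, cts_at t (fun s => M s i j)) ->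
    forall i j, cts_at t (fun s => (a s *: M s) i j).
  move=> ca cM i j; apply: (@fun_alg_ext _ _ (cts_at t) (fun s => a s * M s i j)) => [s|].
    by rewrite [RHS]mxE.
  exact: (fun_algM alg).
have cN m q (M : T -> 'M[R]_(m, q)) : (forall i j, cts_at t (fun s => M s i j)) ->
    forall i j, cts_at t (fun s => (- M s) i j).
  move=> cM i j; apply: (@fun_alg_ext _ _ (cts_at t) (fun s => - M s i j)) => [s|].
    by rewrite [RHS]mxE.
  exact: (fun_algN alg).
have cM2 m q r (M : T -> 'M[R]_(m, q)) (N : T -> 'M[R]_(q, r)) :
    (forall i j, cts_at t (fun s => M s i j)) -> (forall i j, cts_at t (fun s => N s i j)) ->
    forall i j, cts_at t (fun s => (M s *m N s) i j).
  exact: (fun_alg_mulmx alg).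
pose G s := (eM (f s))^T *m eM (f s).
have cG i j : cts_at t (fun s => G s i j) by exact: cts_frame_gram.
have Gt : G t = 1%:M by [].
have g00 : G t 0 0 != 0 by rewrite Gt mxE oner_eq0.
have ch : cts_at t (fun s => gs_h (G s)) by exact: cts_gs_h.
have h1 : gs_h (G t) = 1 by rewrite Gt gs_h1.
have csh := cts_at_sqrt ch; have csg := cts_at_sqrt (cG 0 0).
have cshV : cts_at t (fun s => (Num.sqrt (gs_h (G s)))^-1).
  by apply: cts_atV => //; rewrite h1 sqrtr1 oner_eq0.
have csgV : cts_at t (fun s => (Num.sqrt (G s 0 0))^-1).
  by apply: cts_atV => //; rewrite Gt mxE sqrtr1 oner_eq0.
have cq : cts_at t (fun s => G s 0 1 / G s 0 0).
  by apply: (fun_algM alg) => //; exact: cts_atV.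
have cmx2 (a b c d : T -> R) : cts_at t a -> cts_at t b -> cts_at t c -> cts_at t d ->
    forall i j, cts_at t (fun s => mx2 (a s) (b s) (c s) (d s) i j).
  move=> ca cb cc cd; apply: ord2P; apply: ord2P.
  - by apply: (@fun_alg_ext _ _ (cts_at t) a) => // s; rewrite mxE.
  - by apply: (@fun_alg_ext _ _ (cts_at t) b) => // s; rewrite mxE.
  - by apply: (@fun_alg_ext _ _ (cts_at t) c) => // s; rewrite mxE.
  - by apply: (@fun_alg_ext _ _ (cts_at t) d) => // s; rewrite mxE.
have cA : forall i j, cts_at t (fun s => gs_A (G s) i j).
  by apply: (cmx2) => //; apply: (fun_algM alg) => //; exact: (fun_algN alg).
have cB : forall i j, cts_at t (fun s => gs_B (G s) i j).
  by apply: (cmx2) => //; apply: (fun_algM alg).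
have cc : cts_at t (fun s => gs_c (G s)).
  by apply: cts_at_sqrt; exact: (fun_algM alg).
have ceA : forall i j, cts_at t (fun s => (eM (f s) *m gs_A (G s)) i j) by exact: cM2.
have cu : forall i j, cts_at t
    (fun s => retr_u eta (f s) (gs_A (G s)) (gs_B (G s)) (gs_c (G s)) i j).
  apply: (cD); first apply: (cZ) => //; first (apply: (cM2) => //; apply: (cD) => //; apply: (cZ) => //).
    by apply: (cM2) => // *; exact: cst.
  by apply: (cN); apply: (cZ) => //; apply: (cM2) => // *; exact: cst.
have cS : forall i j, cts_at t
    (fun s => retr_S eta (f s) (gs_A (G s)) (gs_B (G s)) (gs_c (G s)) i j).
  by apply: (cZ); [exact: cst|apply: (cD); apply: (cM2) => //; exact: ctr].
apply: cts_at_mx => i j; rewrite /gs_retr /retr /mk_phase.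
have [k ->|k ->] := @split_ordP 2 2 j.
  by apply: (fun_alg_ext _ (ceA i k)) => s; exact/esym/(@row_mxEl R n 2 2).
apply: (@fun_alg_ext _ _ (cts_at t) (fun s =>
  (retr_u eta (f s) (gs_A (G s)) (gs_B (G s)) (gs_c (G s)) +
   eM (f s) *m gs_A (G s) *m retr_S eta (f s) (gs_A (G s)) (gs_B (G s)) (gs_c (G s))) i k)).
  by move=> s; exact/esym/(@row_mxEr R n 2 2).
by apply: (cD) => //; exact: cM2.
Qed.

Lemma gram_independent_open_dense z : gram_det z != 0 ->
  independent_on_open_dense
    (fun a => trace_integral eta Xi (kap a).1 (kap a).2).
Proof.
move=> dz; exists [set x | gram_det x != 0]; split.
- apply: (@open_comp _ _ gram_det [set y | y != 0]); last exact: open_neq.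
  by move=> x _; exact: polyfun_cts polyfun_gram_det x.
- move=> x cx B nB.
  pose f (s : R) : phase R n := x + s *: (z - x).
  have f0 : f 0 = x by rewrite /f scale0r addr0.
  have cf i j : cts_at 0 (fun s => f s i j).
    have alg := @cts_at_alg R R 0.
    apply: (@fun_alg_ext _ _ (@cts_at R R 0) (fun s => x i j + s * (z - x) i j)) => [s|].
      by rewrite /f !mxE.
    apply: (fun_algD alg); first exact: (fun_alg_cst alg).
    by apply: (fun_algM alg); [exact: cvg_id|exact: (fun_alg_cst alg)].
  have cx0 : cotangent_stiefel (f 0) by rewrite f0.
  pose G s := (eM (f s))^T *m eM (f s).
  have cG : forall i j, cts_at (0 : R) (fun s => G s i j) by exact: cts_frame_gram.
  have G0 : G 0 = 1%:M by have /cotangentE[] := cx0.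
  have nB' : \forall s \near (0 : R), B (gs_retr (f s)).
    have := cts_gs_retr cf cx0; rewrite gs_retr_id//.
    by apply; rewrite f0.
  have ng : \forall s \near (0 : R), 0 < G s 0 0.
    by have /cvgr_gt := cG 0 0; apply; rewrite G0 mxE ltr01.
  have nh : \forall s \near (0 : R), 0 < gs_h (G s).
    by have /cvgr_gt := cts_gs_h cG G0; apply; rewrite G0 gs_h1 ltr01.
  (* Within radius e the retracted segment stays in B, and the positivity conditions of Gram-Schmidt
     hold. *)
  have [e /= e0 he] := (nbhs_ballP _ _).1 (filterI nB' (filterI ng nh)).
  have [q hq] := polyfun_line x (z - x) polyfun_gram_det.
  have q0 : q != 0.
    apply: contraNneq dz => q0; have := hq 1.
    by rewrite scale1r addrC subrK q0 horner0 => ->.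
  have [s /andP[s0 se] qs] := poly_nonroot_near q0 e0.
  have [|Bs [gs hs]] := he s.
    by rewrite /ball/= sub0r normrN gtr0_norm.
  have Gsym : G s 1 0 = G s 0 1 by rewrite /G tr_coef.
  have cr : cotangent_stiefel (gs_retr (f s)).
    apply: (@retr_cotangent R n eta (f s) (gs_A (G s)) (gs_B (G s)) (gs_c (G s))).
    exact: (gs_AGA Gsym gs hs).
  have dr : gram_det (gs_retr (f s)) != 0.
    apply: (gram_det_retr (gs_AJ gs hs) (gs_AB gs hs) (gs_c_neq0 gs hs)).
    by rewrite hq.
  by exists (gs_retr (f s)).
- by move=> x cx dx; exact: gram_independent.
Qed.

End Density.

(** * Independence at a special point *)

Section MatrixCoefficients.
Variables (K : comNzRingType).

Definition coef_mx m n (d : nat) (A : 'M[{poly K}]_(m, n)) : 'M[K]_(m, n) :=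
  \matrix_(i, j) (A i j)`_d.

Lemma coef_mulmx m n p d (A : 'M[{poly K}]_(m, n)) (B : 'M[{poly K}]_(n, p)) :
  coef_mx d (A *m B) = \sum_(l < d.+1) coef_mx l A *m coef_mx (d - l) B.
Proof.
apply/matrixP => i j; rewrite summxE !mxE coef_sum.
under [RHS]eq_bigr do rewrite mxE.
rewrite exchange_big; apply: eq_bigr => k _; rewrite coefM.
by apply: eq_bigr => l _; rewrite !mxE.
Qed.

Lemma coef_mxtrace n d (A : 'M[{poly K}]_n) : (\tr A)`_d = \tr (coef_mx d A).
Proof. by rewrite /mxtrace coef_sum; apply: eq_bigr => i _; rewrite mxE. Qed.

Variables (n : nat) (Xi E : 'M[K]_n).

(* The coefficient of t in (Xi + t E)^N. *)
Fixpoint first_var N : 'M[K]_n :=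
  if N is N'.+1 then Xi *m first_var N' + E *m Xi ^+ N' else 0.

Lemma first_var_rec N : first_var N.+1 = first_var N *m Xi + Xi ^+ N *m E.
Proof.
elim: N => [|N IHN]; first by rewrite /= mulmx0 mul0mx !expr0 mulmx1 mul1mx.
rewrite -[LHS]/(Xi *m first_var N.+1 + E *m Xi ^+ N.+1) {1}IHN.
rewrite -[first_var N.+1]/(Xi *m first_var N + E *m Xi ^+ N).
have e1 : Xi *m (Xi ^+ N *m E) = Xi ^+ N.+1 *m E by rewrite mulmxA exprS -mulmxE.
have e2 : E *m Xi ^+ N *m Xi = E *m Xi ^+ N.+1 by rewrite -mulmxA exprSr -mulmxE.
by rewrite mulmxDr mulmxDl e1 e2 mulmxA addrAC.
Qed.

Lemma tr_exp N (A : 'M[K]_n) : A^T = - A -> (A ^+ N)^T = (-1) ^+ N *: A ^+ N.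
Proof.
move=> AT; elim: N => [|N IHN]; first by rewrite !expr0 scale1r trmx1.
rewrite {1}exprS -mulmxE trmx_mul IHN AT mulmxN -scalemxAl -scaleN1r scalerA.
by rewrite -exprS mulmxE -exprSr.
Qed.

Lemma tr_first_var N : Xi^T = - Xi -> E^T = - E ->
  (first_var N)^T = (-1) ^+ N *: first_var N.
Proof.
move=> XT ET; elim: N => [|N IHN]; first by rewrite /= trmx0 scaler0.
rewrite {2}first_var_rec /= trmxD !trmx_mul IHN (tr_exp N XT) XT ET.
rewrite !mulmxN -!scalemxAl scalerDr exprS mulN1r !scaleNr.
by [].
Qed.

Lemma coef_pencil0 d : coef_mx d (pencil Xi 0 E) =
  if d is 0%N then Xi else if d is 2 then E else 0.
Proof.
apply/matrixP => i j; rewrite mxE coef_pencil.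
by case: d => [|[|[|d]]] /=; rewrite ?mxE ?mulr0n ?mulr1n ?add0r ?addr0.
Qed.

Lemma coef_dpencilE (dP dE : 'M[K]_n) d : coef_mx d (dpencil dP dE) =
  if d is 1 then dP else if d is 2 then dE else 0.
Proof.
apply/matrixP => i j; rewrite mxE coef_dpencil.
by case: d => [|[|[|d]]] /=; rewrite ?mxE ?mulr0n ?mulr1n ?add0r ?addr0.
Qed.

Lemma coef_pencil_exp N : [/\ coef_mx 0 (pencil Xi 0 E ^+ N) = Xi ^+ N,
  coef_mx 1 (pencil Xi 0 E ^+ N) = 0, coef_mx 2 (pencil Xi 0 E ^+ N) = first_var N &
  coef_mx 3 (pencil Xi 0 E ^+ N) = 0].
Proof.
elim: N => [|N [h0 h1 h2 h3]].
  split; apply/matrixP => i j; rewrite expr0 !mxE; case: (i == j);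
    by rewrite ?mulr1n ?mulr0n ?coef0 ?coef1.
rewrite exprS -mulmxE !coef_mulmx !big_ord_recl !big_ord0 !coef_pencil0 /=.
rewrite h0 h1 h2 h3 ?mul0mx ?mulmx0 !addr0 ?add0r; split=> //.
by rewrite exprS.
Qed.

(** For P = 0 the pencil is even in s, while dP comes with s and dE with s^2: odd coefficients see
    only dP and even ones only dE. *)
Lemma dtrace0 N j (dP dE : 'M[K]_n) : (0 < j <= 4)%N ->
  dtrace N j Xi 0 E dP dE = N%:R *
    match j with
    | 1 => \tr (Xi ^+ N.-1 *m dP)
    | 2 => \tr (Xi ^+ N.-1 *m dE)
    | 3 => \tr (first_var N.-1 *m dP)
    | _ => \tr (first_var N.-1 *m dE)
    end.
Proof.
have [h0 h1 h2 h3] := coef_pencil_exp N.-1.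
rewrite /dtrace -[N%:R]polyC_natr coefCM coef_mxtrace coef_mulmx.
case: j => [|[|[|[|[|j]]]]]//= _; congr (_ * \tr _);
  rewrite !big_ord_recl !big_ord0 !coef_dpencilE /=;
  by rewrite ?h0 ?h1 ?h2 ?h3 ?mul0mx ?mulmx0 ?addr0 ?add0r.
Qed.

End MatrixCoefficients.

Lemma mxtrace_mul_delta (K : pzRingType) n (C : 'M[K]_n) a b :
  \tr (C *m delta_mx a b) = C b a.
Proof.
rewrite /mxtrace (bigD1 b)//= big1 ?addr0 => [|k kb]; last first.
  by rewrite mxE big1// => l _; rewrite mxE (negbTE kb) andbF mulr0.
rewrite mxE (bigD1 a)//= big1 ?addr0 => [|k ka]; first by rewrite mxE !eqxx mulr1.
by rewrite mxE (negbTE ka) mulr0.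
Qed.

Lemma mx11_tr (K : Type) (A : 'M[K]_1) : A^T = A.
Proof. by apply/matrixP => i j; rewrite !ord1 mxE. Qed.

(** * Skew matrices commuting with a bivector *)

Section Commutant.
Variables (K : numFieldType) (n : nat) (u v : 'cV[K]_n) (N : 'M[K]_n).
Hypothesis soN : in_so N.
Let E := wedge u v.

Lemma commutator_units0 : (forall i j, \tr (N *m commutator (so_unit K i j) E) = 0) ->
  commutator E N = 0.
Proof.
move=> h; set C := commutator E N.
have CT : C^T = - C.
  rewrite /C /commutator trmxB !trmx_mul soN (wedge_so u v : _^T = _).
  by rewrite !(mulmxN, mulNmx) !opprK opprB.
apply/matrixP => i j; rewrite [RHS]mxE.
have := h i j; have -> : \tr (N *m commutator (so_unit K i j) E) = \tr (C *m so_unit K i j).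
  by rewrite -[RHS]opprK -[in RHS]mxtraceN -mulNmx /C /commutator opprB mxtrace_mul_comm opprK.
rewrite /so_unit mulmxBr mxtraceB.
rewrite !mxtrace_mul_delta; have -> : C j i = - C i j by have /matrixP/(_ i j) := CT; rewrite !mxE.
move=> /eqP; rewrite -opprD oppr_eq0 -mulr2n mulrn_eq0/= => /eqP.
by [].
Qed.

Variable mu : K.
Hypotheses (mu0 : 0 < mu) (vv : v^T *m v = mu%:M) (uu : u^T *m u = (mu + 1)%:M)
  (uv : u^T *m v = 0) (EN : commutator E N = 0).

Let tau := (v^T *m N *m u) 0 0.

(** Since the image of E lies in the span of u and v, E N v and E N u are known from the products of
    N on the frame. Commuting with E, these equal N E v = mu N u and N E u = - (mu + 1) N v. On the
    frame N is therefore a multiple of E. *)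
Lemma commutant_frame :
  N *m u = (tau / mu) *: v /\ N *m v = - (tau / (mu + 1)) *: u.
Proof.
have tauE : v^T *m N *m u = tau%:M by rewrite [LHS]mx11_scalar.
have anti (x y : 'cV[K]_n) : x^T *m N *m y = - (y^T *m N *m x).
  by rewrite -[LHS]mx11_tr !trmx_mul trmxK soN mulNmx mulmxN mulmxA.
have quad (x : 'cV[K]_n) : x^T *m N *m x = 0.
  apply/eqP; have /eqP := anti x x; rewrite -addr_eq0 -mulr2n => /eqP h.
  apply/eqP/matrixP => i j; have := congr1 (fun A : 'M[K]_1 => A i j) h.
  by rewrite mulmxnE !mxE => /eqP; rewrite mulrn_eq0/= => /eqP.
have uNv : u^T *m N *m v = - tau%:M by rewrite anti tauE.
have vu : v^T *m u = 0 by rewrite -[LHS]trmxK trmx_mul trmxK uv trmx0.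
have Eu : E *m u = - (mu + 1) *: v.
  by rewrite /E /wedge mulmxBl -!mulmxA vu uu mulmx0 sub0r mul_mx_scalar scaleNr.
have Ev : E *m v = mu *: u.
  by rewrite /E /wedge mulmxBl -!mulmxA vv uv mulmx0 subr0 mul_mx_scalar.
have EN' (x : 'cV[K]_n) : E *m (N *m x) = N *m (E *m x).
  move/eqP: EN; rewrite subr_eq0 => /eqP h.
  by rewrite mulmxA h mulmxA.
have ENu : E *m (N *m u) = tau *: u.
  rewrite /E /wedge mulmxBl -!mulmxA [v^T *m _]mulmxA [u^T *m (N *m u)]mulmxA.
  by rewrite quad tauE mulmx0 subr0 mul_mx_scalar.
have ENv : E *m (N *m v) = tau *: v.
  rewrite /E /wedge mulmxBl -!mulmxA [v^T *m _]mulmxA [u^T *m (N *m v)]mulmxA.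
  by rewrite quad uNv mulmx0 sub0r mulmxN opprK mul_mx_scalar.
have mu1 : mu + 1 != 0 by rewrite gt_eqF// addr_gt0.
have mu0' : mu != 0 by rewrite gt_eqF.
split.
  have := EN' v; rewrite ENv Ev -scalemxAr => h.
  by rewrite [tau / mu]mulrC -scalerA h scalerA mulVf// scale1r.
have := EN' u; rewrite ENu Eu -scalemxAr => h.
rewrite -mulNr mulrC -scalerA scaleNr h scaleNr opprK scalerA mulVf// scale1r.
by [].
Qed.

Lemma trace_commutant : \tr (N *m E) = 2 * tau.
Proof.
have tr1 (x y : 'cV[K]_n) : \tr (N *m (x *m y^T)) = (y^T *m N *m x) 0 0.
  by rewrite mulmxA mxtrace_mulC mulmxA /mxtrace big_ord1.
rewrite /E /wedge mulmxBr mxtraceB !tr1 -/tau.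
have -> : (u^T *m N *m v) 0 0 = - tau.
  have -> : u^T *m N *m v = - (v^T *m N *m u)^T.
    by rewrite !trmx_mul trmxK soN mulNmx mulmxN opprK mulmxA.
  by rewrite mx11_tr [LHS]mxE.
by ring.
Qed.

End Commutant.

(** * The block diagonal matrix and its bivector *)

Section SpecialPoint.
Variables (K : numFieldType) (n : nat).
Hypothesis hn : (2 < n)%N.
Local Notation M := (n.-1./2).
Local Notation m := (n./2).
Implicit Types (i j : 'I_n) (y : 'cV[K]_n).

(** Positive, constant on each block {2l, 2l + 1} and distinct on different blocks, so that the
    squares separate the blocks. *)
Definition freq (i : nat) : K := (i./2.+1)%:R.

Definition Xi_sp : 'M[K]_n := \matrix_(i, j)
  (if ~~ odd i && (j == i.+1 :> nat) then freq i
   else if odd i && (i == j.+1 :> nat) then - freq i else 0).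

(* The support of v_sp misses the last block of Xi_sp, of size 1 or 2 according to
   the parity of n; this asymmetry is what separates the integrals. *)
Definition u_sp : 'cV[K]_n := \col_i (~~ odd i)%:R.
Definition v_sp : 'cV[K]_n := \col_i (odd i && (i < 2 * M)%N)%:R.

Definition E_sp : 'M[K]_n := wedge u_sp v_sp.

Local Notation X := Xi_sp.
Local Notation u := u_sp.
Local Notation v := v_sp.

Lemma Xi_sp_so : in_so X.
Proof.
apply/matrixP => i j; rewrite !mxE.
have [oi|ei] := boolP (odd i); have [oj|ej] := boolP (odd j) => //=; rewrite ?oppr0//.
- case: eqP => [ij|_]; first by move: oj; rewrite ij /= oi.
  by case: eqP => [ij|_]; rewrite ?oppr0//; move: oi; rewrite ij /= oj.
- case: eqP => [ij|_]; last by rewrite oppr0.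
  by rewrite opprK ij /freq /= uphalf_half (negbTE ej).
- case: eqP => [ij|_]; last by rewrite oppr0.
  by rewrite ij /freq /= uphalf_half (negbTE ei).
- case: eqP => [ij|_]; first by move: ei; rewrite ij /= (negbTE ej).
  by case: eqP => [ij|_]; rewrite ?oppr0//; move: ej; rewrite ij /= (negbTE ei).
Qed.

Lemma Xi_sp_even i j y : ~~ odd i -> j = i.+1 :> nat -> (X *m y) i 0 = freq i * y j 0.
Proof.
move=> ei ij; rewrite mxE (bigD1 j)//= mxE ei ij eqxx /= big1 ?addr0// => k kj.
by rewrite mxE ei -ij (negbTE (_ : (k : nat) != j)) ?mul0r// (negbTE ei) mul0r.
Qed.

Lemma Xi_sp_odd i j y : ~~ odd i -> j = i.+1 :> nat -> (X *m y) j 0 = - freq i * y i 0.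
Proof.
move=> ei ij; have oj : odd j by rewrite ij /= ei.
have fj : freq j = freq i by rewrite /freq ij /= uphalf_half (negbTE ei).
rewrite mxE (bigD1 i)//= mxE oj ij eqxx /= -ij fj big1 ?addr0// => k ki.
rewrite mxE oj /= ij eqSS eq_sym (negbTE (_ : (k : nat) != i)) ?mul0r//.
Qed.

Lemma Xi_sp_last i y : ~~ odd i -> i.+1 = n -> (X *m y) i 0 = 0.
Proof.
move=> ei ien; rewrite mxE big1// => k _; rewrite mxE ei ien.
by rewrite ltn_eqF ?ltn_ord//= (negbTE ei) mul0r.
Qed.

(* Xi_sp squared is diagonal with entries theta. *)
Definition theta (i : nat) : K := if odd i || (i.+1 < n)%N then - freq i ^+ 2 else 0.

Lemma Xi_sp_sqr i y : (X *m (X *m y)) i 0 = theta i * y i 0.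
Proof.
have [oi|ei] := boolP (odd i).
  have i0 : (0 < i)%N by case: (nat_of_ord i) oi.
  have hi : (i.-1 < n)%N by rewrite (leq_ltn_trans (leq_pred _)).
  pose i' := Ordinal hi; have ei' : ~~ odd i' by rewrite /= -oddS prednK ?oi ?negbK.
  have ii' : i = i'.+1 :> nat by rewrite /= prednK.
  rewrite (Xi_sp_odd _ ei' ii') (Xi_sp_even _ ei' ii') /theta oi.
  have -> : freq i = freq i' by rewrite /freq ii' /= uphalf_half (negbTE ei').
  by rewrite /=; ring.
have [ln|nl] := ltnP i.+1 n.
  rewrite (@Xi_sp_even i (Ordinal ln))// (@Xi_sp_odd i (Ordinal ln))//.
  by rewrite /theta ln orbT; ring.
have ien : i.+1 = n by apply/eqP; rewrite eqn_leq nl ltn_ord.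
by rewrite Xi_sp_last// /theta (negbTE ei) ien ltnn mul0r.
Qed.

Lemma Xi_sp_even_exp p i y : (X ^+ (2 * p) *m y) i 0 = theta i ^+ p * y i 0.
Proof.
elim: p => [|p IHp]; first by rewrite muln0 !expr0 mul1mx mul1r.
rewrite mulnS addSn add1n !exprS -!mulmxE -!mulmxA Xi_sp_sqr IHp.
by rewrite mulrA.
Qed.

Lemma Xi_sp_odd_exp p y : X ^+ (2 * p).+1 *m y = X *m (X ^+ (2 * p) *m y).
Proof. by rewrite exprS -mulmxE mulmxA. Qed.

Lemma le_2M : (2 * M < n)%N.
Proof. by have := odd_double_half n.-1; rewrite -muln2; case: n hn => //= k _; lia. Qed.

(** In each block below index 2M the weights 1 and -1 meet the same theta and cancel. Index 2M keeps
    weight 1, and index 2M + 1, present when n is even, has weight 0. *)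
Lemma weight_sum p :
  \sum_i (u i 0 - v i 0) * theta i ^+ p = theta (2 * M) ^+ p.
Proof.
pose f (l : nat) : K := ((~~ odd l)%:R - (odd l && (l < 2 * M)%N)%:R) * theta l ^+ p.
have -> : \sum_i (u i 0 - v i 0) * theta i ^+ p = \sum_(0 <= l < n) f l.
  by rewrite big_mkord; apply: eq_bigr => i _; rewrite !mxE.
rewrite (@big_cat_nat _ _ _ (2 * M)%N)//=; last exact: ltnW le_2M.
have -> : \sum_(0 <= l < 2 * M) f l = 0.
  suff H k : (k <= M)%N -> \sum_(0 <= l < 2 * k) f l = 0 by exact: H.
  elim: k => [|k IHk] kM; first by rewrite muln0 big_geq.
  rewrite mulnS addSn add1n !big_nat_recr//= IHk ?(ltnW kM)// add0r.
  have k2 : ((2 * k).+1 < 2 * M)%N by lia.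
  have o2 : odd (2 * k) = false by rewrite mul2n odd_double.
  rewrite /f /= o2 /= k2 /theta /= o2 /=.
  have -> : ((2 * k).+1 < n)%N by rewrite (ltn_trans k2) ?le_2M.
  by rewrite /freq /= uphalf_half o2 add0n; ring.
rewrite add0r big_ltn ?le_2M// big_nat big1 => [|i /andP[i1 i2]].
  rewrite addr0 /f ltnn andbF subr0 mul2n odd_double/= mul1r//.
have -> : i = (2 * M).+1.
  apply/eqP; rewrite eqn_leq i1 andbT.
  have := odd_double_half n.-1; rewrite -muln2; case: n hn i2 => //= k _; lia.
by rewrite /f /= mul2n odd_double/= -mul2n ltnNge leqnSn/= subrr mul0r.
Qed.

Lemma dotE (x y : 'cV[K]_n) : (x^T *m y) 0 0 = \sum_i x i 0 * y i 0.
Proof. by rewrite mxE; apply: eq_bigr => i _; rewrite mxE. Qed.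

Definition mu_sp : K := (v^T *m v) 0 0.

Lemma uv_even p : (u^T *m (X ^+ (2 * p) *m v)) 0 0 = 0.
Proof.
rewrite dotE big1// => i _; rewrite Xi_sp_even_exp !mxE.
by case: (odd i); rewrite ?mul0r ?mulr0.
Qed.

Lemma vu_even p : (v^T *m (X ^+ (2 * p) *m u)) 0 0 = 0.
Proof.
rewrite dotE big1// => i _; rewrite Xi_sp_even_exp !mxE.
by case: (odd i); rewrite ?mul0r ?mulr0.
Qed.

Lemma uu_vv_even p : (u^T *m (X ^+ (2 * p) *m u)) 0 0 =
  (v^T *m (X ^+ (2 * p) *m v)) 0 0 + theta (2 * M) ^+ p.
Proof.
apply/eqP; rewrite addrC -subr_eq; apply/eqP.
rewrite !dotE -weight_sum -sumrB; apply: eq_bigr => i _.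
rewrite !Xi_sp_even_exp !mxE.
by case: (odd i); case: (i < 2 * M)%N; rewrite /= ?mulr0 ?mul0r ?mulr1 ?mul1r; ring.
Qed.

Lemma odd_exp_anti p (x y : 'cV[K]_n) :
  (x^T *m (X ^+ (2 * p).+1 *m y)) 0 0 = - (y^T *m (X ^+ (2 * p).+1 *m x)) 0 0.
Proof.
rewrite -[in LHS](mx11_tr (_ *m _)) !trmx_mul trmxK (tr_exp _ Xi_sp_so).
rewrite exprS exprM sqrrN expr1n expr1n mulr1 scaleN1r mulmxN mulNmx -mulmxA.
by rewrite mxE.
Qed.

Lemma odd_exp_quad p (x : 'cV[K]_n) : (x^T *m (X ^+ (2 * p).+1 *m x)) 0 0 = 0.
Proof.
have /eqP := odd_exp_anti p x x; rewrite -addr_eq0 -mulr2n mulrn_eq0/=.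
by move=> /eqP.
Qed.

Lemma E_spE i y : (E_sp *m y) i 0 =
  u i 0 * (v^T *m y) 0 0 - v i 0 * (u^T *m y) 0 0.
Proof.
have mul1E (x : 'cV[K]_n) (A : 'M[K]_1) : (x *m A) i 0 = x i 0 * A 0 0.
  by rewrite mxE big_ord1.
have subE (a b : 'cV[K]_n) : (a - b) i 0 = a i 0 - b i 0 by rewrite !mxE.
by rewrite /E_sp /wedge mulmxBl -!mulmxA subE !mul1E.
Qed.

Lemma mu_sp_gt0 : 0 < mu_sp.
Proof.
have h1 : (1 < n)%N by lia.
have M1 : (1 < 2 * M)%N by case: n hn => [|[|[|k]]]//= _; lia.
rewrite /mu_sp dotE (bigD1 (Ordinal h1))//= !mxE /= M1 mulr1.
by rewrite ltr_wpDr ?ltr01// sumr_ge0// => i _; rewrite mxE -natrM ler0n.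
Qed.

Lemma vv_sp : v^T *m v = mu_sp%:M.
Proof. by rewrite [LHS]mx11_scalar. Qed.

Lemma uu_sp : u^T *m u = (mu_sp + 1)%:M.
Proof.
have := uu_vv_even 0; rewrite muln0 !expr0 !mul1mx => e.
by rewrite [LHS]mx11_scalar e.
Qed.

Lemma uv_sp : u^T *m v = 0.
Proof.
have := uv_even 0; rewrite muln0 !expr0 !mul1mx => e.
by rewrite [LHS]mx11_scalar e raddf0.
Qed.

Local Notation W := (first_var X E_sp).

Section Pair.
Variables i j : 'I_n.
Hypotheses (ei : ~~ odd i) (ij : j = i.+1 :> nat).

Lemma theta_pair : theta j = theta i.
Proof.
by rewrite /theta ij /= ei -ij ltn_ord orbT /freq ij /= uphalf_half (negbTE ei).
Qed.

Lemma odd_exp_u p : (X ^+ (2 * p).+1 *m u) j 0 = - freq i * theta i ^+ p.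
Proof.
by rewrite Xi_sp_odd_exp (Xi_sp_odd _ ei ij) Xi_sp_even_exp mxE ei mulr1.
Qed.

Hypothesis jM : (j < 2 * M)%N.

Lemma odd_exp_v p : (X ^+ (2 * p).+1 *m v) i 0 = freq i * theta i ^+ p.
Proof.
rewrite Xi_sp_odd_exp (Xi_sp_even _ ei ij) Xi_sp_even_exp mxE jM ij /= ei mulr1.
by rewrite -ij theta_pair.
Qed.

(* On this combination the terms odd in Xi_sp cancel, which leaves a divided
   difference of powers of theta. *)
Definition var_pair p : K := (W (2 * p).+1 *m v) i 0 + (W (2 * p).+1 *m u) j 0.

Lemma even_term p : (E_sp *m (X ^+ (2 * p) *m v)) i 0 +
  (E_sp *m (X ^+ (2 * p) *m u)) j 0 = - theta (2 * M) ^+ p.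
Proof.
rewrite !E_spE uv_even vu_even uu_vv_even !mxE jM ij /= ei (negbTE ei) /=.
by ring.
Qed.

Lemma odd_term p : (X *m (E_sp *m (X ^+ (2 * p).+1 *m v))) i 0 +
  (X *m (E_sp *m (X ^+ (2 * p).+1 *m u))) j 0 = 0.
Proof.
rewrite (Xi_sp_even _ ei ij) (Xi_sp_odd _ ei ij) !E_spE !odd_exp_quad.
rewrite (odd_exp_anti _ u v) !mxE jM ij /= ei (negbTE ei) /=.
by ring.
Qed.

(** Two steps of the recursion of W: the leading X^2 acts as theta i, the middle terms X E X^(2p+1)
    cancel by [odd_term], and [even_term] evaluates the rest. *)
Lemma var_pair_rec p : var_pair p.+1 = theta i * var_pair p - theta (2 * M) ^+ p.+1.
Proof.
have rec (y : 'cV[K]_n) : W (2 * p.+1).+1 *m y = X *m (X *m (W (2 * p).+1 *m y)) +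
    X *m (E_sp *m (X ^+ (2 * p).+1 *m y)) + E_sp *m (X ^+ (2 * p.+1) *m y).
  have -> : (2 * p.+1)%N = (2 * p).+2 by rewrite mulnS.
  rewrite -[W (2 * p).+3]/(X *m (X *m W (2 * p).+1 + E_sp *m X ^+ (2 * p).+1) +
    E_sp *m X ^+ (2 * p).+2).
  by rewrite mulmxDl mulmxDr mulmxDl -!mulmxA.
rewrite /var_pair !rec.
have addE (a b : 'cV[K]_n) k : (a + b) k 0 = a k 0 + b k 0 by rewrite mxE.
rewrite !addE !Xi_sp_sqr theta_pair addrACA even_term addrACA odd_term addr0.
by rewrite mulrDr.
Qed.

Lemma var_pairE p :
  (theta i - theta (2 * M)) * var_pair p = - (theta i ^+ p.+1 - theta (2 * M) ^+ p.+1).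
Proof.
elim: p => [|p IHp].
  have -> : var_pair 0 = - 1.
    have := even_term 0; rewrite muln0 !expr0 !mul1mx /var_pair muln0 /=.
    by rewrite mulmx0 add0r expr0 mulmx1.
  by rewrite !expr1; ring.
rewrite var_pair_rec mulrBr mulrCA IHp !exprS; ring.
Qed.

End Pair.
End SpecialPoint.

Section SpecialCore.
Variables (K : numFieldType) (n : nat).
Hypothesis hn : (2 < n)%N.
Local Notation M := (n.-1./2).
Local Notation m := (n./2).
Local Notation X := (Xi_sp K n).
Local Notation u := (u_sp K n).
Local Notation v := (v_sp K n).
Local Notation W := (first_var X (E_sp K n)).
Local Notation theta := (theta K n).

Lemma theta_double (l : nat) :
  theta (2 * l) = if ((2 * l).+1 < n)%N then - (l.+1%:R ^+ 2) else 0.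
Proof. by rewrite /theta mul2n odd_double /freq doubleK. Qed.

Lemma theta_double_inj (k l : nat) : (k <= M)%N -> (l <= M)%N ->
  theta (2 * k) = theta (2 * l) -> k = l.
Proof.
move=> kM lM; rewrite !theta_double.
have sq (a b : nat) : - (a.+1%:R ^+ 2) = - (b.+1%:R ^+ 2) :> K -> a = b.
  move=> /oppr_inj/eqP; rewrite eqrXn2 ?ler0n// eqr_nat => /eqP[].
  by [].
have nz (a : nat) : - (a.+1%:R ^+ 2) <> 0 :> K.
  by move/eqP; rewrite oppr_eq0 sqrf_eq0 pnatr_eq0.
have n2 := odd_double_half n.-1; rewrite -muln2 in n2.
case: ltnP => hk; case: ltnP => hl.
- exact: sq.
- by move/nz.
- by move/esym/nz.
- by move: hn; case: n kM lM hk hl n2 => //= n' kM lM hk hl n2; lia.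
Qed.

Lemma theta_roots (N : nat) (q : {poly K}) : (N <= M.+1)%N -> (size q <= N)%N ->
  (forall l, (l < N)%N -> q.[theta (2 * l)] = 0) -> q = 0.
Proof.
move=> NM sq hq.
apply: (@roots_geq_poly_eq0 _ _ [seq theta (2 * l) | l <- iota 0 N]).
- apply/allP => _ /mapP[l + ->]; rewrite mem_iota add0n => /andP[_ lN].
  by rewrite rootE hq.
- rewrite map_inj_in_uniq ?iota_uniq// => k l.
  rewrite !mem_iota !add0n => /andP[_ kN] /andP[_ lN].
  by apply: theta_double_inj; rewrite -ltnS (leq_trans _ NM).
- by rewrite size_map size_iota.
Qed.

Variables (a : 'I_m -> K) (c : 'I_M -> K).

Definition odd_comb : 'M[K]_n := \sum_k a k *: X ^+ (2 * k).+1.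
Definition var_comb : 'M[K]_n := \sum_k c k *: W (2 * k).+1.

Lemma comb_mul (I : finType) (b : I -> K) (F : I -> 'M[K]_n) (y : 'cV[K]_n) i :
  ((\sum_k b k *: F k) *m y) i 0 = \sum_k b k * (F k *m y) i 0.
Proof.
rewrite mulmx_suml summxE; apply: eq_bigr => k _.
by rewrite -scalemxAl mxE.
Qed.

Lemma m_leq : (m <= M.+1)%N.
Proof.
have := odd_double_half n; have := odd_double_half n.-1; rewrite -!muln2.
by case: n hn => //= n' _; lia.
Qed.

Lemma ltn_pair (l : nat) : (l < m)%N -> ((2 * l).+1 < n)%N.
Proof. by have := odd_double_half n; rewrite -muln2; lia. Qed.

Lemma M_leq : (M <= m)%N.
Proof. by apply: half_leq; exact: leq_pred. Qed.

Hypotheses (hu : (odd_comb + var_comb) *m u = 0) (hv : (odd_comb + var_comb) *m v = 0).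

Let addE (x y : 'cV[K]_n) i : (x + y) i 0 = x i 0 + y i 0.
Proof. by rewrite mxE. Qed.

(** Adding entry i of the image of v and entry j of the image of u cancels the powers of X and
    leaves the divided difference of q at theta i and t. So q vanishes at M values of theta and, by
    construction, at t: M + 1 roots for degree at most M. *)
Lemma var_coef0 k : c k = 0.
Proof.
pose t := theta (2 * M).
pose q := \sum_(k < M) c k *: ('X^(k.+1) - (t ^+ k.+1)%:P).
have qE z : q.[z] = \sum_(k < M) c k * (z ^+ k.+1 - t ^+ k.+1).
  rewrite /q horner_sum; apply: eq_bigr => l _.
  by rewrite hornerZ hornerD hornerN hornerXn hornerC.
suff q0 : q = 0.
  have : q`_k.+1 = 0 by rewrite q0 coef0.
  rewrite /q coef_sum (bigD1 k)//= big1 ?addr0 => [|l lk].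
    by rewrite coefZ coefB coefXn coefC eqxx subr0 mulr1.
  by rewrite coefZ coefB coefXn coefC eqSS eq_sym (negbTE (_ : (l : nat) != k))// subr0 mulr0.
apply: (@theta_roots M.+1) => //.
  apply: (leq_trans (size_sum _ _ _)); apply/bigmax_leqP => l _.
  rewrite (leq_trans (size_scale_leq _ _))// (leq_trans (size_polyD _ _))//.
  rewrite geq_max size_polyXn size_polyN ltnS ltn_ord/=.
  by rewrite (leq_trans (size_polyC_leq1 _)).
move=> l; rewrite ltnS leq_eqVlt => /orP[/eqP ->|lM].
  by rewrite qE big1// => l' _; rewrite subrr mulr0.
have l2 := ltn_pair (leq_trans lM M_leq).
pose i : 'I_n := Ordinal (ltnW l2); pose j : 'I_n := Ordinal l2.
have ei : ~~ odd i by rewrite /= mul2n odd_double.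
have ij : j = i.+1 :> nat by [].
have jM : (j < 2 * M)%N by rewrite /=; lia.
have : ((odd_comb + var_comb) *m v) i 0 + ((odd_comb + var_comb) *m u) j 0 = 0.
  by rewrite hu hv !mxE addr0.
rewrite !mulmxDl !addE !comb_mul addrACA -!big_split/=.
have -> : \sum_(k < m) (a k * (X ^+ (2 * k).+1 *m v) i 0 +
    a k * (X ^+ (2 * k).+1 *m u) j 0) = 0.
  rewrite big1// => k' _; rewrite (odd_exp_v K ei ij jM) (odd_exp_u K ei ij).
  by ring.
rewrite add0r => h; rewrite qE -[RHS]oppr0 -[in RHS](mulr0 (theta i - t)) -[in RHS]h.
rewrite mulr_sumr -sumrN; apply: eq_bigr => k' _.
rewrite -mulrDr mulrCA -mulrN; congr (_ * _).
by have := var_pairE K hn ei ij jM k'; rewrite /var_pair -/t => ->; rewrite opprK.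
Qed.


(** With [var_comb] gone, the odd entries of the image of u are, up to the nonzero frequency, values
    of a polynomial of size at most m at m distinct points. *)
Lemma odd_coef0 k : a k = 0.
Proof.
pose q := \sum_(k < m) a k *: 'X^k.
suff q0 : q = 0.
  have : q`_k = 0 by rewrite q0 coef0.
  rewrite /q coef_sum (bigD1 k)//= big1 ?addr0 => [|l lk].
    by rewrite coefZ coefXn eqxx mulr1.
  by rewrite coefZ coefXn eq_sym (negbTE (_ : (l : nat) != k))// mulr0.
apply: (@theta_roots m) m_leq _ _ => [|l lm].
  apply: (leq_trans (size_sum _ _ _)); apply/bigmax_leqP => l _.
  by rewrite (leq_trans (size_scale_leq _ _))// size_polyXn.
have l2 := ltn_pair lm.
pose i : 'I_n := Ordinal (ltnW l2); pose j : 'I_n := Ordinal l2.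
have ei : ~~ odd i by rewrite /= mul2n odd_double.
have ij : j = i.+1 :> nat by [].
have vc0 : var_comb = 0 by apply: big1 => k' _; rewrite var_coef0 scale0r.
have : (odd_comb *m u) j 0 = 0 by have := hu; rewrite vc0 addr0 => ->; rewrite mxE.
rewrite comb_mul => h.
have f0 : - freq K i != 0 by rewrite oppr_eq0 pnatr_eq0.
apply: (mulfI f0); rewrite mulr0 -[RHS]h /q horner_sum mulr_sumr.
apply: eq_bigr => k' _; rewrite hornerZ hornerXn (odd_exp_u K ei ij).
by rewrite mulrCA.
Qed.

End SpecialCore.

Section SpecialKernel.
Variables (K : numFieldType) (n : nat).
Hypothesis hn : (2 < n)%N.
Local Notation M := (n.-1./2).
Local Notation m := (n./2).
Local Notation X := (Xi_sp K n).
Local Notation E := (E_sp K n).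
Local Notation u := (u_sp K n).
Local Notation v := (v_sp K n).
Local Notation W := (first_var X E).

Lemma odd_comb_so a : in_so (@odd_comb K n a).
Proof.
rewrite /in_so /odd_comb linear_sum -sumrN; apply: eq_bigr => k _ /=.
rewrite trmxZ (tr_exp _ (Xi_sp_so K n)) exprS exprM sqrrN expr1n expr1n mulr1 scaleN1r.
by rewrite scalerN.
Qed.

Lemma var_comb_so c : in_so (@var_comb K n c).
Proof.
rewrite /in_so /var_comb linear_sum -sumrN; apply: eq_bigr => k _.
rewrite -[LHS]/((c k *: W (2 * k).+1)^T).
rewrite trmxZ (tr_first_var _ (Xi_sp_so K n) (wedge_so u v : E^T = - E)).
by rewrite exprS exprM sqrrN expr1n expr1n mulr1 scaleN1r scalerN.
Qed.

Lemma in_soD (A B : 'M[K]_n) : in_so A -> in_so B -> in_so (A + B).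
Proof. by rewrite /in_so => hA hB; rewrite trmxD hA hB opprD. Qed.

(** The second condition, from the direction along E, forces tau = 0; then the matrix kills u and
    v. *)
Lemma comb_kernel (a : 'I_m -> K) (c : 'I_M -> K) :
  (forall i j, \tr ((odd_comb a + var_comb c) *m commutator (so_unit K i j) E) = 0) ->
  \tr ((odd_comb a + var_comb c) *m E) = 0 ->
  (forall k, a k = 0) /\ (forall k, c k = 0).
Proof.
move=> hc ht.
have so := in_soD (odd_comb_so a) (var_comb_so c).
have EN := commutator_units0 so hc.
have mu0 := mu_sp_gt0 K hn.
have [Nu Nv] := commutant_frame so mu0 (vv_sp K n) (uu_sp K hn) (uv_sp K n) EN.
have := trace_commutant u v so; rewrite -/E ht => /esym/eqP.
rewrite mulf_eq0 pnatr_eq0/= => /eqP t0.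
rewrite t0 mul0r scale0r in Nu; rewrite t0 mul0r oppr0 scale0r in Nv.
by split=> k; [exact: odd_coef0 Nu Nv k|exact: var_coef0 Nu Nv k].
Qed.

(* Here the matrix only annihilates the frame up to a multiple of E, which is the
   missing term of index 0. *)
Lemma comb_kernel_mod (a : 'I_m -> K) (c : 'I_M -> K) :
  (forall k : 'I_M, k = 0%N :> nat -> c k = 0) ->
  (forall i j, \tr ((odd_comb a + var_comb c) *m commutator (so_unit K i j) E) = 0) ->
  (forall k, a k = 0) /\ (forall k, c k = 0).
Proof.
move=> c0 hc.
have so := in_soD (odd_comb_so a) (var_comb_so c).
have EN := commutator_units0 so hc.
have mu0 := mu_sp_gt0 K hn.
have [Nu Nv] := commutant_frame so mu0 (vv_sp K n) (uu_sp K hn) (uv_sp K n) EN.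
set tau := (v^T *m _ *m u) 0 0 in Nu Nv.
set mu := mu_sp K n in mu0 Nu Nv.
(* The multiple for which adding [kappa *: E] makes the matrix kill u and v. As [first_var] of order
   1 is E itself, this only alters the coefficient of index 0. *)
pose kappa := tau / (mu * (mu + 1)).
have M0 : (0 < M)%N by case: n hn => [|[|[|k]]].
pose k0 := Ordinal M0.
pose c' k := c k + (if k == k0 then kappa else 0).
have vc : var_comb c' = var_comb c + kappa *: E.
  have W0 : kappa *: W (2 * k0).+1 = kappa *: E.
    by rewrite muln0 /= mulmx0 add0r expr0 mulmx1.
  rewrite -W0 /var_comb /c'; under eq_bigr do rewrite scalerDl.
  rewrite big_split; congr (_ + _); rewrite (bigD1 k0)// big1 => [|k /negbTE ->].
    by rewrite eqxx; exact: addr0.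
  by rewrite scale0r.
have mu1 : mu + 1 != 0 by rewrite gt_eqF// addr_gt0.
have mu0' : mu != 0 by rewrite gt_eqF.
have vu : v^T *m u = 0 by rewrite -[LHS]trmxK trmx_mul trmxK (uv_sp K n) trmx0.
have Eu : E *m u = - (mu + 1) *: v.
  by rewrite /E_sp /wedge mulmxBl -!mulmxA vu (uu_sp K hn) mulmx0 sub0r mul_mx_scalar scaleNr.
have Ev : E *m v = mu *: u.
  by rewrite /E_sp /wedge mulmxBl -!mulmxA vv_sp (uv_sp K n) mulmx0 subr0 mul_mx_scalar.
have Nu' : (odd_comb a + var_comb c') *m u = 0.
  rewrite vc addrA mulmxDl Nu -scalemxAl Eu scalerA -scalerDl.
  by rewrite (_ : _ + _ = 0) ?scale0r// /kappa; field; rewrite ?mu0' ?mu1.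
have Nv' : (odd_comb a + var_comb c') *m v = 0.
  rewrite vc addrA mulmxDl Nv -scalemxAl Ev scalerA -scalerDl.
  by rewrite (_ : _ + _ = 0) ?scale0r// /kappa; field; rewrite ?mu0' ?mu1.
have ha := odd_coef0 hn Nu' Nv'; have hc' := var_coef0 hn Nu' Nv'.
have kap0 : kappa = 0 by have := hc' k0; rewrite /c' eqxx c0// add0r.
split=> // k; have := hc' k; rewrite /c' kap0.
by case: ifP => _; rewrite addr0.
Qed.


(** Pads w with a zero at index 0, the place of the omitted integral. *)
Lemma sum_shift (N : nat) (w : 'I_N.-1 -> K) : exists c : 'I_N -> K,
  [/\ forall k : 'I_N, k = 0%N :> nat -> c k = 0,
      forall F : nat -> K, \sum_(k < N) c k * F k = \sum_(k < N.-1) w k * F k.+1 &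
      (forall k, c k = 0) -> forall k, w k = 0].
Proof.
case: N w => [|N] w.
  by exists w; split=> [[]|F|//]//; rewrite !big_ord0.
exists (fun k => if unlift ord0 k is Some k' then w k' else 0); split.
- by move=> k k0; rewrite (_ : k = ord0) ?unlift_none//; exact: val_inj.
- move=> F; rewrite big_ord_recl unlift_none mul0r add0r.
  by apply: eq_bigr => k _; rewrite liftK.
- by move=> h k; have := h (lift ord0 k); rewrite liftK.
Qed.

Definition integral_index := ('I_m + 'I_m + ('I_M + 'I_M.-1))%type.

(** The pair (k, j) stands for the coefficient of s^j in the trace of the power 2k. The last family
    starts at k = 2, because (1, 4) is the constant tr E^2. *)
Definition integral_index_data (t : integral_index) : nat * nat :=
  match t with
  | inl (inl k) => (k.+1, 1)
  | inl (inr k) => (k.+1, 2)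
  | inr (inl k) => (k.+1, 3)
  | inr (inr k) => (k.+2, 4)
  end%N.

Lemma card_integral_index : #|{: integral_index}| = (2 * n - 3)%N.
Proof.
rewrite !card_sum !card_ord; have := odd_double_half n; have := odd_double_half n.-1.
by rewrite -!muln2; case: n hn => [|[|[|k]]]//= _; lia.
Qed.

Definition kap_sp (a : 'I_(2 * n - 3)) : nat * nat :=
  integral_index_data (enum_val (cast_ord (esym card_integral_index) a)).

Lemma kap_sp_bound a : (0 < (kap_sp a).2 <= 4)%N /\ (0 < (kap_sp a).1)%N.
Proof.
rewrite /kap_sp; set t : integral_index := enum_val _; move: t.
by move=> [[k|k]|[k|k]].
Qed.

Lemma trace_odd_comb (a : 'I_m -> K) (D : 'M[K]_n) :
  \tr (odd_comb a *m D) = \sum_k a k * \tr (X ^+ (2 * k).+1 *m D).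
Proof.
rewrite /odd_comb mulmx_suml linear_sum; apply: eq_bigr => k _.
by rewrite -scalemxAl; exact: mxtraceZ.
Qed.

Lemma trace_var_comb (c : 'I_M -> K) (D : 'M[K]_n) :
  \tr (var_comb c *m D) = \sum_k c k * \tr (W (2 * k).+1 *m D).
Proof.
rewrite /var_comb mulmx_suml linear_sum; apply: eq_bigr => k _.
by rewrite -scalemxAl; exact: mxtraceZ.
Qed.

(** For P = 0 a rotation has dP = 0 and dE = [xi, E], whereas the vertical directions have dE = 0.
    So shifts and E test the coefficients of s and s^3, rotations those of s^2 and s^4. *)
Lemma special_kernel w : jac_kernel kap_sp X 0 E w -> forall b, w b = 0.
Proof.
move=> hw; pose wT (t : integral_index) := w (cast_ord card_integral_index (enum_rank t)).
have wE b : w b = wT (enum_val (cast_ord (esym card_integral_index) b)).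
  by rewrite /wT enum_valK cast_ordKV.
suff wT0 t : wT t = 0 by move=> b; rewrite wE wT0.
pose D (t : integral_index) (c : direction n) := dtrace (2 * (integral_index_data t).1) (integral_index_data t).2 X 0 E
  (dirP 0 E c) (dirE E c).
have hT c : \sum_t wT t * D t c = 0.
  rewrite -[RHS](hw c) (reindex (fun b => enum_val (cast_ord (esym card_integral_index) b)))/=.
    by apply: eq_bigr => b _; rewrite -wE.
  apply: onW_bij; exists (fun t => cast_ord card_integral_index (enum_rank t)) => b.
    by rewrite enum_valK cast_ordKV.
  by rewrite cast_ordK enum_rankK.
(* The weights absorb the exponent that [dtrace] carries as a factor. *)
pose w1 k := wT (inl (inl k)) * (2 * k.+1)%:R.
pose w2 k := wT (inl (inr k)) * (2 * k.+1)%:R.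
pose w3 k := wT (inr (inl k)) * (2 * k.+1)%:R.
pose w4 k := wT (inr (inr k)) * (2 * k.+2)%:R.
have [c4 [c40 c4E c4w]] := sum_shift w4.
have e (k : nat) : (2 * k).+1 = (2 * k.+1).-1 by rewrite mulnS.
have D1 k c : D (inl (inl k)) c = (2 * k.+1)%:R * \tr (X ^+ (2 * k).+1 *m dirP 0 E c).
  by rewrite /D dtrace0// e.
have D2 k c : D (inl (inr k)) c = (2 * k.+1)%:R * \tr (X ^+ (2 * k).+1 *m dirE E c).
  by rewrite /D dtrace0// e.
have D3 k c : D (inr (inl k)) c = (2 * k.+1)%:R * \tr (W (2 * k).+1 *m dirP 0 E c).
  by rewrite /D dtrace0// e.
have D4 k c : D (inr (inr k)) c = (2 * k.+2)%:R * \tr (W (2 * k.+1).+1 *m dirE E c).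
  by rewrite /D dtrace0// e.
have main c : \tr ((odd_comb w1 + var_comb w3) *m dirP 0 E c) +
    \tr ((odd_comb w2 + var_comb c4) *m dirE E c) = 0.
  rewrite -[RHS](hT c) !big_sumType/= !mulmxDl !mxtraceD.
  rewrite !trace_odd_comb !trace_var_comb.
  rewrite (c4E (fun k => \tr (W (2 * k).+1 *m dirE E c))).
  rewrite addrACA; congr (_ + _ + (_ + _)); apply: eq_bigr => k _.
  - by rewrite D1 mulrA.
  - by rewrite D3 mulrA.
  - by rewrite D2 mulrA.
  - by rewrite D4 mulrA.
have main1 : (forall i j, \tr ((odd_comb w1 + var_comb w3) *m commutator (so_unit K i j) E) = 0).
  by move=> i j; have := main (inl (inr (i, j))); rewrite /= mulmx0 mxtrace0 addr0.
have main2 : \tr ((odd_comb w1 + var_comb w3) *m E) = 0.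
  by have := main (inr tt); rewrite /= mulmx0 mxtrace0 addr0.
have main3 : (forall i j, \tr ((odd_comb w2 + var_comb c4) *m commutator (so_unit K i j) E) = 0).
  move=> i j; have := main (inl (inl (i, j))).
  by rewrite /= {1}/commutator mulmx0 mul0mx subr0 mulmx0 mxtrace0 add0r.
have [h1 h3] := comb_kernel main1 main2.
have [h2 /c4w h4] := comb_kernel_mod c40 main3.
have nz (k : nat) : (2 * k.+1)%:R != 0 :> K by rewrite pnatr_eq0 mulnS.
have cancel (x : K) (k : nat) : x * (2 * k.+1)%:R = 0 -> x = 0.
  by move=> /eqP; rewrite mulf_eq0 (negbTE (nz k)) orbF => /eqP.
case: t => [[k|k]|[k|k]].
- exact: cancel (h1 k).
- exact: cancel (h2 k).
- exact: cancel (h3 k).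
- exact: cancel (h4 k).
Qed.

End SpecialKernel.

Section SpecialPhasePoint.
Variables (R : realType) (n : nat) (eta : R).

(** The momentum p1 = eta e2 makes p1 /\ e1 compensate the twist, so that Phi = 0. The frame is
    orthogonal but not normalized: this is an ambient point off the bundle. *)
Definition z_sp : phase R n := mk_phase
  (\matrix_(i, j) if j == 0 then u_sp R n i 0 else v_sp R n i 0)
  (\matrix_(i, j) if j == 0 then eta * v_sp R n i 0 else 0).

Lemma e1_z_sp : e1 z_sp = u_sp R n.
Proof. by rewrite e1E eM_mk; apply/matrixP => i j; rewrite !ord1 !mxE. Qed.

Lemma e2_z_sp : e2 z_sp = v_sp R n.
Proof. by rewrite e2E eM_mk; apply/matrixP => i j; rewrite !ord1 !mxE. Qed.

Lemma Em_z_sp : Em z_sp = E_sp R n.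
Proof. by rewrite -wedge_e e1_z_sp e2_z_sp. Qed.

Lemma Phi_z_sp : Phi eta z_sp = 0.
Proof.
have hp1 : p1 z_sp = eta *: v_sp R n.
  by rewrite p1E pM_mk; apply/matrixP => i j; rewrite !ord1 !mxE.
have hp2 : p2 z_sp = 0.
  by rewrite p2E pM_mk; apply/matrixP => i j; rewrite !ord1 !mxE.
rewrite /Phi hp1 hp2 e1_z_sp e2_z_sp /wedge trmx0 mul0mx mulmx0 subrr addr0.
rewrite trmxZ -scalemxAl -scalemxAr -scalerBr -scalerDr.
by rewrite addrC addrA subrK subrr scaler0.
Qed.

End SpecialPhasePoint.

Theorem theorem3 (R : realType) (n : nat) (eta kappa : R)
    (hn : (3 <= n)%N) (hkappa : -1 < kappa) :
  (forall Xi : 'M[R]_n, in_so Xi ->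
     forall (I : set R) (gamma : R -> phase R n),
       open I -> integral_curve eta (Hamiltonian kappa Xi) I gamma ->
       forall (lambda : R[i]) (t : R), I t ->
         is_derive_cmx t (fun s => lax_L eta Xi lambda (gamma s))
           (commutator (lax_A eta Xi lambda (gamma t))
                       (lax_L eta Xi lambda (gamma t)))) /\
  generically_on_so (fun Xi : 'M[R]_n =>
     [/\ forall f, lax_integrals eta Xi f -> polynomial_fun f,
         complete_involutive eta (lax_integrals eta Xi) &
         forall f, lax_integrals eta Xi f ->
           poisson_commute eta f (Hamiltonian kappa Xi)]).
Proof.
split=> [Xi so I gamma _ hc lambda t It|]; first exact: lax_equation hc _ _ It.
pose kap := kap_sp hn.
(* Generic means that the Gram determinant at the ambient point [z_sp] does not vanish; [Xi_sp]
   witnesses that this is a nonempty condition. *)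
have [P hP] : polyfun (fun Xi : 'M[R]_n => \det (gram kap Xi 0 (E_sp R n))).
  have alg := @polyfun_alg R n n.
  apply: (fun_alg_gram kap alg) => i j; first exact: polyfun_coord.
    exact: (fun_alg_cst alg).
  exact: (fun_alg_cst alg).
exists P; split.
  exists (Xi_sp R n); split; first exact: Xi_sp_so.
  by rewrite -hP; apply: det_jac_kernel; exact: special_kernel.
move=> Xi so; rewrite -hP => dXi.
split.
- by move=> f [->|]; [exact: polynomial_Psi|exact: polynomial_lax].
- split=> [f g [->|hf] [->|hg]|].
  + exact: poisson_Psi_Psi.
  + exact: poisson_Psi_lax hg.
  + exact: poisson_lax_Psi hf.
  + exact: poisson_lax hf hg.
  exists (fun a => trace_integral eta Xi (kap a).1 (kap a).2); split=> [a|].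
    right; apply: trace_integral_lax.
    have [/andP[_ j4] k0] := kap_sp_bound hn a.
    by rewrite (leq_trans j4)// leq_pmulr.
  apply: (gram_independent_open_dense (z := z_sp n eta)).
  by rewrite /gram_det Phi_z_sp Em_z_sp.
- by move=> f [->|hf]; [exact: poisson_Psi_Ham|exact: poisson_lax_Ham hf].
Qed.
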